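(* Let $\lambda^{(1)}, \lambda^{(2)}, \ldots$ be a sequence of partitions, and for each $N$ let $X_N$ be the random variable $\mathrm{maj}(T)$, where $T$ is chosen uniformly at random from the set $\mathrm{SYT}(\lambda^{(N)})$ of standard Young tableaux of shape $\lambda^{(N)}$. Then the sequence $(X_N^* )_{N\ge1}$ of normalized random variables converges in distribution if and only if (i) $\mathrm{aft}(\lambda^{(N)}) \to \infty$; or (ii) $|\lambda^{(N)}| \to \infty$ and $\mathrm{aft}(\lambda^{(N)}) \to M < \infty$ for some $M$; or (iii) the distribution of $X_N^*$ is eventually constant (as a function of $N$). The limit law is the standard normal distribution $\mathcal{N}(0,1)$ in case (i), the normalized Irwin--Hall distribution $\mathcal{IH}_M^*$ in case (ii), and discrete in case (iii).
   Context: For a partition $\lambda=(\lambda_1\ge\lambda_2\ge\cdots)$ of $n=|\lambda|$, $\lambda'$ denotes the conjugate partition, and $\mathrm{aft}(\lambda) := |\lambda| - \max\{\lambda_1, \lambda_1'\}$. Diagrams are drawn in English notation (row 1 at the top). A standard Young tableau of shape $\lambda$ is a bijective filling of the cells of $\lambda$ with $1,\ldots,n$ increasing to the right along rows and downward along columns. An integer $i\in\{1,\dots,n-1\}$ is a descent of $T$ if $i+1$ lies in a strictly lower row of $T$ than $i$; $\mathrm{maj}(T)$ is the sum of the descents of $T$. For a real random variable $X$ with mean $\mu$ and variance $\sigma^2>0$, the normalized variable is $X^* := (X-\mu)/\sigma$; if $\sigma=0$, by convention $X^*:=0$. The Irwin--Hall random variable $\mathcal{IH}_M$ is the sum of $M$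 independent random variables uniformly distributed on $[0,1]$ ($\mathcal{IH}_0=0$), and $\mathcal{IH}_M^*$ is its normalization. Convergence in distribution means convergence of cumulative distribution functions at every continuity point of the limiting cumulative distribution function. *)

(* Defs.v *)
From HB Require Import structures.
From mathcomp Require Import all_boot all_order all_algebra.
From mathcomp Require Import all_classical all_reals all_analysis.
From mathcomp Require Import measurable_realfun.

Set Implicit Arguments.
Unset Strict Implicit.
Unset Printing Implicit Defensive.

Import Order.TTheory GRing.Theory Num.Theory.
Import numFieldNormedType.Exports.

Local Open Scope classical_set_scope.
Local Open Scope ring_scope.

Definition is_partition (s : seq nat) : bool := sorted geq s && (0%N \notin s).

Record intpart := Intpart {
  parts :> seq nat;
  intpartP : is_partition parts
}.

(* The j-th part of the conjugate (j counted from 0) is the number of parts of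
   [lam] exceeding j, that is, the height of column j. *)
Definition conj_parts (lam : seq nat) : seq nat :=
  mkseq (fun j => count (fun r => j < r)%N lam) (head 0%N lam).

Definition aft (lam : intpart) : nat :=
  (sumn lam - maxn (head 0 lam) (head 0 (conj_parts lam)))%N.

(* Rows and columns are counted from 0, row 0 being the top one; row i has
   [nth 0 lam i] cells. *)
Definition cell (lam : intpart) : finType :=
  {i : 'I_(size lam) & 'I_(nth 0%N lam i)}.

Definition cell_row (lam : intpart) (c : cell lam) : nat := tag c.
Definition cell_col (lam : intpart) (c : cell lam) : nat := tagged c.

Definition filling (lam : intpart) : finType :=
  {ffun cell lam -> 'I_(sumn lam)}.

(* 'I_n is {0, ..., n-1}, whereas the entries of a tableau are 1, ..., n. *)
Definition entry (lam : intpart) (T : filling lam) (c : cell lam) : nat :=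
  (T c).+1.

Definition standard (lam : intpart) (T : filling lam) : Prop :=
  [/\ bijective T,
      forall c d, cell_row c = cell_row d -> (cell_col c < cell_col d)%N ->
        (entry T c < entry T d)%N
    & forall c d, cell_col c = cell_col d -> (cell_row c < cell_row d)%N ->
        (entry T c < entry T d)%N].

Definition SYT (lam : intpart) := {T : filling lam | `[< standard T >]}.

Definition is_descent (lam : intpart) (T : filling lam) (i : nat) : bool :=
  [exists c, exists d,
    [&& entry T c == i, entry T d == i.+1 & (cell_row c < cell_row d)%N]].

Definition maj (lam : intpart) (T : SYT lam) : nat :=
  (\sum_(1 <= i < sumn lam | is_descent (val T) i) i)%N.

(* There is always a standard tableau: fill in the cells in reading order. *)
Lemma SYT_inhabited (lam : intpart) : exists T : filling lam, standard T.
Proof.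
pose f (c : cell lam) := flatten_index lam (cell_row c) (cell_col c).
have f_lt c : (f c < sumn lam)%N.
  by apply: flatten_indexP; rewrite /cell_row /cell_col; case: c => i [].
exists [ffun c => Ordinal (f_lt c)]; split.
- have gP (k : 'I_(sumn lam)) :
      exists c : cell lam, f c = k.
    have i_lt := reshape_indexP (ltn_ord k).
    have j_lt : (reshape_offset lam k < nth 0 lam (Ordinal i_lt))%N.
      exact: reshape_offsetP.
    exists (Tagged (fun i : 'I_(size lam) => 'I_(nth 0%N lam i))
      (Ordinal j_lt)).
    exact: reshape_indexK.
  have inj_f : injective f.
    move=> [i [j jlt]] [i' [j' j'lt]] fE.
    have iE : i = i'.
      apply: val_inj; move: fE; rewrite /f /cell_row /cell_col /=.
      by move=> /(congr1 (reshape_index lam)); rewrite !flatten_indexKl.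
    subst i'; congr existT; apply: val_inj.
    move: fE; rewrite /f /cell_row /cell_col /=.
    by move=> /(congr1 (reshape_offset lam)); rewrite !flatten_indexKr.
  exists (fun k => projT1 (cid (gP k))) => [c|k].
    by apply: inj_f; case: cid => c' /= ->; rewrite ffunE.
  by apply: val_inj; rewrite ffunE /=; case: cid.
- move=> c d rE; rewrite /entry !ffunE /= ltnS /f /flatten_index rE.
  by rewrite ltn_add2l.
- move=> c d cE rlt; rewrite /entry !ffunE /= ltnS /f /flatten_index.
  have col_lt (e : cell lam) : (cell_col e < nth 0 lam (cell_row e))%N by case: e => i [].
  have size_lt (e : cell lam) : (cell_row e < size lam)%N by case: e => -[].
  apply: leq_trans (_ : sumn (take (cell_row c).+1 lam) <= _)%N.
    by rewrite (take_nth 0%N) ?size_lt// sumn_rcons ltn_add2l col_lt.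
  rewrite -(subnKC rlt) takeD sumn_cat -addnA; exact: leq_addr.
Qed.

HB.instance Definition _ (lam : intpart) := Finite.on (SYT lam).

Lemma SYT_pt_subproof (lam : intpart) :
  exists T : filling lam, `[< standard T >].
Proof. by have [T sT] := SYT_inhabited lam; exists T; apply/asboolP. Qed.

HB.instance Definition _ (lam : intpart) := isPointed.Build (SYT lam)
  (exist _ (xchoose (SYT_pt_subproof lam))
           (xchooseP (SYT_pt_subproof lam))).

HB.instance Definition _ (lam : intpart) :=
  @isMeasurable.Build default_measure_display (SYT lam)
    discrete_measurable discrete_measurable0
    discrete_measurableC discrete_measurableU.

Section uniform_SYT.
Context (R : realType) (lam : intpart).

Definition unif_SYT (A : set (SYT lam)) : \bar R :=
  (\sum_(T : SYT lam) (#|{: SYT lam}|%:R^-1)%:E * \d_T A)%E.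

Lemma card_SYT_gt0 : (0 < #|{: SYT lam}|)%N.
Proof. by apply/card_gt0P; exists point. Qed.

Let unif0 : unif_SYT set0 = 0%E.
Proof. by rewrite /unif_SYT big1// => T _; rewrite measure0 mule0. Qed.

Let unif_ge0 A : (0 <= unif_SYT A)%E.
Proof. by apply: sume_ge0 => T _; rewrite mule_ge0// lee_fin invr_ge0. Qed.

Let unif_sigma_additive : semi_sigma_additive unif_SYT.
Proof.
have r_ge0 : 0 <= #|{: SYT lam}|%:R^-1 :> R by rewrite invr_ge0.
pose r : {nonneg R} := NngNum r_ge0.
pose m n : {measure set (SYT lam) -> \bar R} :=
  mscale r (\d_(nth point (enum {: SYT lam}) n)).
suff -> : unif_SYT = msum m #|{: SYT lam}|.
  exact: measure_semi_sigma_additive.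
apply/funext => A; rewrite /unif_SYT /msum.
rewrite (reindex (@enum_val _ {: SYT lam})) /=; last exact/onW_bij/enum_val_bij.
by apply: eq_bigr => i _; rewrite (enum_val_nth (point : SYT lam)).
Qed.

HB.instance Definition _ := isMeasure.Build _ _ _ unif_SYT
  unif0 unif_ge0 unif_sigma_additive.

Let unif_setT : unif_SYT setT = 1%E.
Proof.
rewrite /unif_SYT (eq_bigr (fun=> (#|{: SYT lam}|%:R^-1)%:E)); last first.
  by move=> T _; rewrite diracT mule1.
rewrite sumEFin sumr_const -[RHS]/(1%:E); congr EFin.
by rewrite -[LHS]mulr_natr mulVf// pnatr_eq0 -lt0n card_SYT_gt0.
Qed.

HB.instance Definition _ := @Measure_isProbability.Build _ _ R unif_SYT unif_setT.

Definition majRV (T : SYT lam) : R := (maj T)%:R.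

Let measurable_majRV : measurable_fun setT majRV.
Proof. by []. Qed.

HB.instance Definition _ :=
  isMeasurableFun.Build _ _ _ _ majRV measurable_majRV.

End uniform_SYT.
Arguments unif_SYT {R} lam.
Arguments majRV {R} lam.

(* Since [0^-1 = 0], this is the zero random variable when the variance is 0. *)
Definition normalized d (T : measurableType d) (R : realType)
    (P : probability T R) (X : {RV P >-> R}) (t : T) : R :=
  (X t - fine 'E_P[X]) / Num.sqrt (fine 'V_P[X]).

Section normalized_measurable.
Context d (T : measurableType d) (R : realType) (P : probability T R)
  (X : {RV P >-> R}).

Let measurable_normalized : measurable_fun setT (normalized X).
Proof.
apply: measurable_funM; last exact: measurable_cst.
by apply: measurable_funB => //; exact: measurable_cst.
Qed.

HB.instance Definition _ :=
  isMeasurableFun.Build _ _ _ _ (normalized X) measurable_normalized.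

End normalized_measurable.

Definition normalized_law d (T : measurableType d) (R : realType)
    (P : probability T R) (X : {RV P >-> R}) : probability R R :=
  distribution P (normalized X : {RV P >-> R}).

Definition normalized_maj_law (R : realType) (lam : intpart) : probability R R :=
  normalized_law (majRV lam : {RV (unif_SYT lam : probability _ R) >-> R}).

(* The library's [normal_prob] and [uniform_prob] are probabilities on
   [measurableTypeR R], which carries the same sigma-algebra as [R] but another
   display; pushing them forward along the identity moves them to [R]. *)
Section real_laws.
Context (R : realType).

Definition borel_id : measurableTypeR R -> R := idfun.

HB.instance Definition _ :=
  isMeasurableFun.Build _ _ _ _ borel_id (@measurable_id _ _ setT).

Definition normal_law (m s : R) : probability R R :=
  distribution (normal_prob m s : probability (measurableTypeR R) R) borel_id.

Definition unif01_law : probability R R :=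
  distribution (uniform_prob (@ltr01 R) : probability (measurableTypeR R) R)
    borel_id.

End real_laws.

Section iid_uniform.
Context (R : realType).

Definition cons_pair n (x : R * n.-tuple R) : n.+1.-tuple R :=
  [tuple of x.1 :: x.2].

Let measurable_cons_pair n : measurable_fun setT (@cons_pair n).
Proof. exact: measurable_cons. Qed.

HB.instance Definition _ n :=
  isMeasurableFun.Build _ _ _ _ (@cons_pair n) (@measurable_cons_pair n).

(* The M-fold product of the uniform probability on [0, 1]: under it the
   coordinates are M independent uniform random variables. *)
Fixpoint unif_cube (M : nat) : probability (M.-tuple R) R :=
  match M with
  | 0 => \d_([tuple] : 0.-tuple R)
  | n.+1 => distribution
      ((unif01_law R \x unif_cube n)%E : probability _ R)
      (@cons_pair n)
  end.

Definition irwin_hall (M : nat) (u : M.-tuple R) : R := \sum_(i < M) tnth u i.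

Let measurable_irwin_hall M : measurable_fun setT (@irwin_hall M).
Proof.
apply: measurable_sum => i; exact: measurable_tnth.
Qed.

HB.instance Definition _ M :=
  isMeasurableFun.Build _ _ _ _ (@irwin_hall M) (@measurable_irwin_hall M).

Definition normalized_irwin_hall_law (M : nat) : probability R R :=
  normalized_law (@irwin_hall M : {RV (unif_cube M) >-> R}).

End iid_uniform.

(* [law_cdf (distribution P X)] is the library's [cdf X]. *)
Definition law_cdf (R : realType) (mu : probability R R) (x : R) : \bar R :=
  mu `]-oo, x]%classic.

Definition cvg_in_distribution (R : realType) (mu_ : nat -> probability R R)
    (mu : probability R R) : Prop :=
  forall x : R, {for x, continuous (law_cdf mu)} ->
    law_cdf (mu_ N) x @[N --> \oo] --> law_cdf mu x.

Definition same_law (R : realType) (mu nu : probability R R) : Prop :=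
  forall A : set R, measurable A -> mu A = nu A.

Definition discrete_law (R : realType) (mu : probability R R) : Prop :=
  exists2 A : set R, countable A & mu A = 1%E.

(* Main.v *)
Require Import Defs.
From HB Require Import structures.
From mathcomp Require Import all_boot all_order all_algebra.
From mathcomp Require Import all_classical all_reals all_analysis.
From mathcomp Require Import measurable_realfun.
From mathcomp Require complex.
From mathcomp Require Import ring lra zify.
Set Implicit Arguments.
Unset Strict Implicit.
Unset Printing Implicit Defensive.
Import Order.TTheory GRing.Theory Num.Theory.
Import numFieldNormedType.Exports.
Local Open Scope classical_set_scope.
Local Open Scope ring_scope.

(* The q-hook length formula gives
     sum_T q^maj(T) * prod_{hooks h} (1 - q^h) = q^b * prod_{j <= n} (1 - q^j).
   The hooks in the first row or the first column (whichever is longer) are n - k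
   distinct elements of 1, ..., n, where k = aft lam, so after cancelling them only k
   factors remain on each side: k hooks h in Re, and the k missing values j in Mi.
   At q = e^it, with s(x) = sin(x/2)/(x/2), the centred statistic satisfies
     E cos(t (maj - mean)) * prod_Re s(h t) = prod_Mi s(j t)
   and its variance is (sum_Mi j^2 - sum_Re h^2) / 12, which is at least k n^2 / 192.
   If k grows, log s(x) = -x^2/24 + O(x^4) yields exp(-t^2/2) after normalization; if
   k = M is fixed and n grows, then the j in Mi are n (1 + o(1)) and the h in Re are
   O(sqrt n), which yields s(t / sqrt(M/12))^M, the transform of the normalized
   Irwin-Hall law. Convergence of these cosine integrals and tightness (Chebyshev)
   give convergence in distribution, by approximating steps by trigonometric
   polynomials.
   Conversely, every sequence of partitions has a subsequence along which k grows, or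
   k is constant while n grows, or the partition is constant. The possible limits are
   told apart by their cosine integrals: the normal one never vanishes, that of
   Irwin-Hall with M > 0 first vanishes at 2 pi sqrt(M/12), and a law carried by a
   lattice has the value 1 away from 0. *)

(** * Determinants of q-binomial type *)

(** The q-hook formula is itself proved here, by induction on n. The sum of q^maj over the tableaux
    of one shape is not closed under deleting the largest entry n, because the row of n decides
    whether n - 1 is a descent. The sum therefore carries a parameter r, the row of an imagined
    entry n + 1. Raising r by one isolates the tableaux with n in row r, hence the shape with one
    cell fewer, and the extreme values of r differ by the factor q^n. The determinants [strip_det]
    obey the same two rules, and these rules leave only one solution. The argument divides by 1 -
    q^j; it is run at q = 2, 3, ... and reaches q = e^it as an identity of polynomials. Mean and
    variance of maj are read off from the trigonometric identity as t tends to 0. In the converse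
    the boundary case is M = 0. IH_0 is the point mass at 0, which is also the normalized law for a
    single row or column, so it is grouped with the lattice laws, and a limit of that kind leads to
    case (iii). *)

Section qdet.
Variables (F : fieldType) (q : F).
Hypothesis q_neq0 : q != 0.
Hypothesis q_nroot : forall j, (0 < j)%N -> q ^+ j != 1.

Definition qfact (n : nat) : F := \prod_(1 <= j < n.+1) (1 - q ^+ j).

Definition qrow (j l : nat) : F := q ^+ (j * l) / qfact l.

Definition qrow_sum (j L : nat) : F := \sum_(l < L) q ^+ l * qrow j l.

(* Up to a constant this is [word_sum] below. Raising r by one exchanges row r for
   its last increment, so the difference of two consecutive values is the
   determinant of the partition with one cell fewer in row r. *)
Definition strip_det (m : nat) (l : 'I_m -> nat) (r : nat) : F :=
  \det (\matrix_(i < m, j < m)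
    if (i < r)%N then q ^+ l i * qrow j (l i) else qrow_sum j (l i).+1).

Lemma qfact0 : qfact 0 = 1.
Proof. by rewrite /qfact big_geq. Qed.

Lemma qfactS n : qfact n.+1 = qfact n * (1 - q ^+ n.+1).
Proof. by rewrite /qfact big_nat_recr. Qed.

Lemma qfact_neq0 n : qfact n != 0.
Proof.
elim: n => [|n IH]; first by rewrite qfact0 oner_neq0.
by rewrite qfactS mulf_neq0// subr_eq0 eq_sym q_nroot.
Qed.

Lemma qrow_sumS j L : qrow_sum j L.+1 = qrow_sum j L + q ^+ L * qrow j L.
Proof. by rewrite /qrow_sum big_ord_recr. Qed.

(** The factor 1 - q^(l+1) cancels the last factor of [qfact], which lowers l. For j = 0 this makes
    [qrow_sum] telescope. *)
Lemma qrow_shift j l : q ^+ l.+1 * qrow j l.+1 = qrow j l.+1 - q ^+ j * qrow j l.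
Proof.
have h1 : 1 - q ^+ l.+1 != 0 by rewrite subr_eq0 eq_sym q_nroot.
have h2 := qfact_neq0 l.
rewrite /qrow qfactS mulnS exprD.
by field; rewrite h2 h1.
Qed.

Lemma qrow_sum_rec j l :
  qrow_sum j.+1 l.+1 = q ^+ j.+1 * qrow j.+1 l + (1 - q ^+ j.+1) * qrow_sum j l.+1.
Proof.
elim: l => [|l IH].
  rewrite !qrow_sumS /qrow_sum !big_ord0 /qrow !muln0 !expr0 qfact0 divr1; ring.
rewrite qrow_sumS {}IH [qrow_sum j l.+2]qrow_sumS qrow_shift.
have -> : q ^+ l.+1 * qrow j l.+1 = qrow j.+1 l.+1.
  by rewrite /qrow mulSn exprD mulrA.
ring.
Qed.

Lemma qrow_sum0 l : qrow_sum 0 l.+1 = qrow 0 l.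
Proof.
elim: l => [|l IH].
  by rewrite qrow_sumS /qrow_sum big_ord0 add0r expr0 mul1r.
by rewrite qrow_sumS IH qrow_shift expr0 mul1r addrC subrK.
Qed.

(** Unfolding [qrow_sum_rec] in j down to 0 leaves a combination of columns 0, ..., j of [qrow] with
    coefficient q^j on column j: a triangular change of columns. *)
Lemma qrow_sumE j l : qrow_sum j l.+1 =
  \sum_(i < j.+1) qrow i l * (q ^+ i * \prod_(i.+1 <= t < j.+1) (1 - q ^+ t)).
Proof.
elim: j => [|j IH].
  by rewrite big_ord1 expr0 big_geq// !mulr1 qrow_sum0.
rewrite qrow_sum_rec IH [in RHS]big_ord_recr /= [in RHS]big_geq// mulr1 [LHS]addrC.
congr (_ + _); last by rewrite mulrC.
rewrite mulr_sumr; apply: eq_bigr => i _.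
by rewrite [in RHS]big_nat_recr //= mulrC !mulrA.
Qed.

Lemma strip_det_all m (l : 'I_m -> nat) r : (m <= r)%N ->
  strip_det l r = q ^+ (\sum_i l i) * \det (\matrix_(i < m, j < m) qrow j (l i)).
Proof.
move=> mr; rewrite /strip_det.
have -> : (\matrix_(i < m, j < m) if (i < r)%N then q ^+ l i * qrow j (l i)
     else qrow_sum j (l i).+1) =
   diag_mx (\row_i q ^+ l i) *m (\matrix_(i < m, j < m) qrow j (l i)).
  apply/matrixP => i j; rewrite mxE (leq_trans (ltn_ord i) mr) mul_diag_mx.
  by rewrite !mxE.
rewrite det_mulmx det_diag; congr (_ * _).
under eq_bigr do rewrite mxE.
by rewrite expr_sum.
Qed.

(** The matrix is the [qrow] matrix times an upper triangular one with diagonal 1, q, q^2, .... With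
    [strip_det_all], both extreme values of r are thus powers of q times one and the same
    determinant. *)
Lemma strip_det0 m (l : 'I_m -> nat) : strip_det l 0 =
  q ^+ (\sum_(i < m) i) * \det (\matrix_(i < m, j < m) qrow j (l i)).
Proof.
rewrite /strip_det.
pose U := \matrix_(i < m, j < m) if (i <= j)%N then
   (q ^+ i * \prod_(i.+1 <= t < j.+1) (1 - q ^+ t)) else 0.
have -> : (\matrix_(i < m, j < m) if (i < 0)%N then q ^+ l i * qrow j (l i)
     else qrow_sum j (l i).+1) =
   (\matrix_(i < m, j < m) qrow j (l i)) *m U.
  apply/matrixP => i j; rewrite !mxE qrow_sumE.
  rewrite (big_ord_widen m (fun k => qrow k (l i) * (q ^+ k * \prod_(k.+1 <= t < j.+1) (1 - q ^+ t)))) //.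
  rewrite big_mkcond; apply: eq_bigr => k _; rewrite !mxE ltnS.
  by case: ifP; rewrite ?mulr0.
rewrite det_mulmx mulrC; congr (_ * _).
rewrite -det_tr det_trig; last first.
  by apply/is_trig_mxP => i j ij; rewrite !mxE leqNgt ij.
rewrite expr_sum; apply: eq_bigr => i _.
by rewrite !mxE leqnn big_geq// mulr1.
Qed.

Lemma strip_det_diff m (l : 'I_m -> nat) (r : 'I_m) :
  strip_det l r - strip_det l r.+1 =
  \det (\matrix_(i < m, j < m)
    if (i < r)%N then q ^+ l i * qrow j (l i)
    else qrow_sum j (if i == r then l i else (l i).+1)).
Proof.
rewrite /strip_det; set B := (X in _ = \det X); set C := (X in _ - \det X).
rewrite (@determinant_multilinear _ _ _ B C r 1 1) ?mul1r ?addrK //.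
- apply/rowP => j; rewrite !mxE ltnn eqxx ltnSn !mul1r.
  by rewrite qrow_sumS.
- apply/matrixP => i j; rewrite !mxE eq_sym (negbTE (neq_lift _ _)).
  by [].
- apply/matrixP => i j; rewrite !mxE ltnS [in RHS]ltn_neqAle.
  by have -> : (lift r i != r :> nat); first by rewrite eq_sym neq_lift.
Qed.

Lemma strip_det_diff_part m (l l' : 'I_m -> nat) (r : 'I_m) :
  l r = (l' r).+1 -> (forall i, i != r -> l i = l' i) ->
  strip_det l r - strip_det l r.+1 = strip_det l' r.
Proof.
move=> lr lE; rewrite strip_det_diff; congr (\det _).
apply/matrixP => i j; rewrite !mxE.
case: ltnP => ri; first by rewrite lE // -val_eqE /= ltn_eqF.
by have [->|/lE ->] := eqVneq i r; rewrite ?lr.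
Qed.

(** Shortened by one, row r coincides with row r + 1, so the determinant of the difference has two
    equal rows. *)
Lemma strip_det_diff_adj m (l : 'I_m -> nat) (r s : 'I_m) :
  (s = r.+1 :> nat) -> l r = (l s).+1 -> strip_det l r - strip_det l r.+1 = 0.
Proof.
move=> sr lrs; rewrite strip_det_diff; apply: (@determinant_alternate _ _ _ r s).
  by rewrite -val_eqE /= sr ltn_eqF.
move=> j; rewrite !mxE ltnn eqxx -val_eqE /= sr ltnNge leqnSn /= gtn_eqF //.
by rewrite lrs.
Qed.

Lemma strip_det_diff_last m (l : 'I_m -> nat) (r : 'I_m) :
  l r = 0%N -> strip_det l r - strip_det l r.+1 = 0.
Proof.
move=> lr0; rewrite strip_det_diff (expand_det_row _ r) big1// => j _.
by rewrite !mxE ltnn eqxx lr0 /qrow_sum big_ord0 mul0r.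
Qed.

Lemma det_qrow m (l : 'I_m -> nat) :
  \det (\matrix_(i < m, j < m) qrow j (l i)) =
  (\prod_(i < m) \prod_(j < m | (i < j)%N) (q ^+ l j - q ^+ l i)) /
  \prod_(i < m) qfact (l i).
Proof.
have -> : (\matrix_(i < m, j < m) qrow j (l i)) =
   diag_mx (\row_i (qfact (l i))^-1) *m (Vandermonde m (\row_i q ^+ l i))^T.
  apply/matrixP => i j; rewrite mul_diag_mx !mxE /qrow mulrC.
  by rewrite -exprM mulnC.
rewrite det_mulmx det_diag det_tr det_Vandermonde mulrC; congr (_ * _).
  by apply: eq_bigr => i _; apply: eq_bigr => j _; rewrite !mxE.
by rewrite -prodfV; apply: eq_bigr => i _; rewrite !mxE.
Qed.

End qdet.

(** * Tableaux as Yamanouchi words *)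

Section words.
Variable m : nat.
Implicit Types (s : seq 'I_m) (c : 'I_m -> nat).

Definition dominant c := [forall i : 'I_m, forall j : 'I_m, (i <= j)%N ==> (c j <= c i)%N].

Definition content s : 'I_m -> nat := fun i => count_mem i s.

(* A word lists the rows of the entries n, n-1, ..., 1 of a tableau. *)
Fixpoint yamanouchi s : bool :=
  if s is _ :: s' then dominant (content s) && yamanouchi s' else true.

(** The letter after x belongs to the entry numbered [size s'], so that number is the descent
    created when x is a lower row. *)
Fixpoint word_maj s : nat :=
  if s is x :: s' then
    ((if s' is y :: _ then if (y < x)%N then size s' else 0 else 0) + word_maj s')%N
  else 0%N.

Definition words_of n c : pred (n.-tuple 'I_m) :=
  [pred s : n.-tuple 'I_m | yamanouchi s & [forall i : 'I_m, content s i == c i]].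

Definition beta_set c : 'I_m -> nat := fun i => (c i + (m.-1 - i))%N.

Lemma dominantP c :
  reflect (forall i j : 'I_m, (i <= j)%N -> (c j <= c i)%N) (dominant c).
Proof.
apply: (iffP forallP) => [h i j ij|h i].
  by have /forallP/(_ j)/implyP := h i; apply.
by apply/forallP => j; apply/implyP; exact: h.
Qed.

Lemma eq_dominant c c' : c =1 c' -> dominant c = dominant c'.
Proof. by move=> e; apply: eq_forallb => i; apply: eq_forallb => j; rewrite !e. Qed.

Lemma yamanouchi_dominant s : yamanouchi s -> dominant (content s).
Proof.
case: s => [|x s] /=; last by case/andP.
by move=> _; apply/dominantP.
Qed.

Lemma big_tuple_cons (V : nmodType) (T : finType) n (P : pred (n.+1.-tuple T))
    (f : n.+1.-tuple T -> V) :
  \sum_(t | P t) f t = \sum_x \sum_(t : n.-tuple T | P [tuple of x :: t]) f [tuple of x :: t].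
Proof.
rewrite pair_big_dep /=.
rewrite (reindex (fun p : T * n.-tuple T => [tuple of p.1 :: p.2])) //=.
exists (fun t => (thead t, [tuple of behead t])) => [[x t]|t] _ /=.
  by congr (_, _); apply/val_inj.
by rewrite [in RHS](tuple_eta t).
Qed.

Variables (F : fieldType) (q : F).
Hypothesis q_neq0 : q != 0.
Hypothesis q_nroot : forall j, (0 < j)%N -> q ^+ j != 1.

(* The descent created when an entry in row r is followed by the word s. *)
Definition top_weight (r : nat) s : F :=
  if s is x :: _ then if (r <= x)%N then 1 else q ^+ size s else 1.

Definition word_sum n c r : F :=
  \sum_(s : n.-tuple 'I_m | words_of c s) top_weight r s * q ^+ word_maj s.

Lemma word_maj_cons (x : 'I_m) s : q ^+ word_maj (x :: s) = top_weight x s * q ^+ word_maj s.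
Proof.
case: s => [|y s]; first by rewrite /= expr0 mul1r.
by rewrite /= exprD [(x <= y)%N]leqNgt; case: (ltnP y x) => _ /=; rewrite ?expr0.
Qed.

(** The top weights at r and r + 1 differ only on words with first letter r, where they are 1 and
    q^(n+1). *)
Lemma word_sum_diff n c (r : 'I_m) : dominant c ->
  word_sum n.+1 c r - word_sum n.+1 c r.+1 =
  (1 - q ^+ n.+1) * \sum_(s : n.-tuple 'I_m | yamanouchi s &&
      [forall i : 'I_m, content (r :: s) i == c i]) top_weight r s * q ^+ word_maj s.
Proof.
move=> dc; rewrite /word_sum -sumrB big_tuple_cons (bigD1 r)//=.
rewrite [X in _ + X]big1 ?addr0; last first.
  move=> x xr; apply: big1 => s _.
  have -> : (r < x)%N = (r <= x)%N.
    by rewrite ltn_neqAle eq_sym (_ : (x != r :> nat)).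
  by rewrite subrr.
rewrite mulr_sumr; apply: eq_big => [s|s _].
  rewrite /words_of /=; case: forallP => [h|]; rewrite ?andbF// !andbT.
  suff -> : dominant (content (r :: s)) by [].
  by rewrite (eq_dominant (c' := c))// => i; apply/eqP/h.
by rewrite -word_maj_cons leqnn ltnn -mulrBl /= !size_tuple.
Qed.

Lemma word_sum_last n c : word_sum n.+1 c m = q ^+ n.+1 * word_sum n.+1 c 0.
Proof.
rewrite /word_sum mulr_sumr; apply: eq_bigr => s _.
rewrite (tuple_eta s) /= leqNgt ltn_ord /= mul1r; congr (_ * _).
by rewrite size_tuple.
Qed.

Lemma telescope_const (f : nat -> F) (n : nat) :
  (forall r : 'I_n, f r = f r.+1) -> forall r, (r <= n)%N -> f r = f 0.
Proof.
move=> h; elim=> [//|r IH] rn.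
by rewrite -(h (Ordinal rn)) IH// ltnW.
Qed.

Let zero := (fun=> 0)%N : 'I_m -> nat.

Lemma beta_set_succ c (r s : 'I_m) :
  s = r.+1 :> nat -> c r = c s -> beta_set c r = (beta_set c s).+1.
Proof. by move=> sr cE; rewrite /beta_set sr cE; have := ltn_ord s; lia. Qed.

(** The hypothesis says that row r cannot lose a cell: the row below is equally long, or r is the
    last row and is empty. These cases give two equal rows and a zero row. *)
Lemma strip_det_diff_stuck c (r : 'I_m) :
  (if (insub r.+1 : option 'I_m) is Some s then c r = c s else c r = 0)%N ->
  strip_det q (beta_set c) r - strip_det q (beta_set c) r.+1 = 0.
Proof.
case: insubP => [s _ sr cE|rm c0].
  by apply: (strip_det_diff_adj (s := s) _) => //; exact: beta_set_succ.
apply: strip_det_diff_last; rewrite /beta_set c0 add0n.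
by have := ltn_ord r; lia.
Qed.

Lemma strip_det_zero_neq0 : strip_det q (beta_set zero) 0 != 0.
Proof.
rewrite strip_det0// mulf_neq0 ?expf_neq0// det_qrow mulf_neq0//.
  apply/prodf_neq0 => i _; apply/prodf_neq0 => j ij.
  have -> : beta_set zero i = (j - i + beta_set zero j)%N.
    by rewrite /beta_set /zero; have := ltn_ord j; lia.
  rewrite exprD -[X in X - _]mul1r -mulrBl mulf_neq0 ?expf_neq0//.
  by rewrite subr_eq0 eq_sym q_nroot// subn_gt0.
by rewrite invr_neq0//; apply/prodf_neq0 => i _; apply: qfact_neq0.
Qed.

(** Induction on n. For n > 0 both sides have the same increments in r, by the induction hypothesis
    for the shapes with one cell fewer, so their difference f is constant in r. Both sides gain the
    factor q^n between r = 0 and r = m, so f = q^n f, and f = 0 as q^n is not 1. *)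
Lemma word_sumE n c r : dominant c -> (\sum_i c i = n)%N -> (r <= m)%N ->
  word_sum n c r =
  qfact q n * (strip_det q (beta_set c) r / strip_det q (beta_set zero) 0).
Proof.
elim: n c r => [|n IH] c r dc cn rm.
  have c0 : c =1 zero.
    by move=> i; apply/eqP; move/eqP: cn; rewrite sum_nat_eq0 => /forallP/(_ i).
  have -> : strip_det q (beta_set c) r = strip_det q (beta_set zero) 0.
    have bE : beta_set c =1 beta_set zero by move=> i; rewrite /beta_set c0.
    (* In the empty shape every row is stuck, so the value does not depend on the parameter. *)
    have -> : strip_det q (beta_set zero) 0 = strip_det q (beta_set zero) r.
      apply/esym/(telescope_const (n := m)) => // k; apply/eqP; rewrite -subr_eq0.
      by rewrite strip_det_diff_stuck//; case: insubP.
    rewrite /strip_det; congr (\det _); apply/matrixP => i j.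
    by rewrite !mxE bE.
  rewrite divff ?strip_det_zero_neq0// qfact0 mulr1 /word_sum.
  rewrite (big_pred1 [tuple])/= ?mul1r// => s.
  by rewrite tuple0 /words_of/= eqxx; apply/forallP => i; rewrite c0.
set E := fun c r => strip_det q (beta_set c) r / strip_det q (beta_set zero) 0.
pose f k := word_sum n.+1 c k - qfact q n.+1 * E c k.
have diff (k : 'I_m) : f k = f k.+1.
  apply/eqP; rewrite -subr_eq0 /f.
  rewrite (_ : _ - _ - _ = (word_sum n.+1 c k - word_sum n.+1 c k.+1) -
     qfact q n.+1 * (E c k - E c k.+1)); last by ring.
  rewrite word_sum_diff// /E -mulrBl qfactS.
  set stuck := (if (insub k.+1 : option 'I_m) is Some s then c k == c s else c k == 0)%N.
  (* If row k is stuck, no Yamanouchi word of content c starts with k, and both increments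
     vanish. *)
  have [st|nst] := boolP stuck.
    rewrite strip_det_diff_stuck; last first.
      by move: st; rewrite /stuck; case: insub => [s|] /eqP.
    rewrite mul0r mulr0 subr0 big_pred0 ?mulr0// => s; apply/negP => /andP[ys].
    move=> /forallP h.
    have /dominantP ds := yamanouchi_dominant ys.
    have := h k; rewrite /content /= eqxx add1n => /eqP hk.
    move: st; rewrite /stuck; case: insubP => [t _ tk|km] /eqP.
      rewrite -hk => ht.
      have := h t; rewrite /content /= -ht => /eqP e.
      have := ds k t; rewrite tk leqnSn => /(_ isT); rewrite /content.
      have kt : (k == t) = false by rewrite -val_eqE /= tk ltn_eqF.
      by move: e; rewrite kt add0n => ->; rewrite ltnn.
    by rewrite -hk.
  pose c' i := (c i - (i == k))%N.
  have ck : (0 < c k)%N.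
    rewrite lt0n; apply: contra nst => /eqP ck0; rewrite /stuck ck0.
    case: insubP => // t _ tk; rewrite eq_sym -leqn0 -ck0.
    by move/dominantP: dc; apply; rewrite tk.
  have cE i : c i = ((k == i) + c' i)%N.
    by rewrite /c' [i == k]eq_sym; case: eqP => [<-|_]; lia.
  have dc' : dominant c'.
    apply/dominantP => i j ij.
    have cij : (c j <= c i)%N by move/dominantP: dc; apply.
    rewrite /c'; have [ik|_] := eqVneq i k; last by lia.
    have [_|jk] := eqVneq j k; first by lia.
    rewrite subn0; subst i; suff : (c j < c k)%N by lia.
    rewrite ltn_neqAle cij andbT; apply: contra nst => /eqP cjk.
    have kj : (k < j)%N by rewrite ltn_neqAle ij eq_sym andbT.
    rewrite /stuck; case: insubP => [t _ tk|]; last by rewrite (leq_ltn_trans kj).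
    rewrite eqn_leq; apply/andP; split; last first.
      by move/dominantP: dc; apply; rewrite tk.
    by rewrite -cjk; move/dominantP: dc; apply; rewrite tk.
  have cn' : (\sum_i c' i = n)%N.
    apply/eqP; rewrite -(eqn_add2l 1) [(1 + n)%N]add1n -cn; apply/eqP.
    under [RHS]eq_bigr do rewrite cE.
    rewrite big_split /=; congr addn.
    by rewrite (bigD1 k)//= eqxx big1 ?addn0// => i; rewrite eq_sym => /negbTE ->.
  rewrite (@strip_det_diff_part _ _ _ _ (beta_set c')); last 2 first.
  - by rewrite /beta_set /c' eqxx; lia.
  - by move=> i /negbTE ik; rewrite /beta_set /c' ik subn0.
  rewrite (eq_bigl (words_of c')) => [|s]; last first.
    rewrite /words_of /=; congr (_ && _); apply: eq_forallb => i.
    by rewrite cE /content/= eqn_add2l.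
  have := IH c' k dc' cn' (ltnW (ltn_ord k)); rewrite /word_sum => ->.
  by apply/eqP; ring.
have fr : f r = f 0 by exact: (telescope_const (n := m)).
have fm : f m = f 0 by exact: (telescope_const (n := m)).
suff f0 : f 0 = 0 by apply/eqP; rewrite -subr_eq0; rewrite -/(f r) fr f0.
have fm' : f m = q ^+ n.+1 * f 0.
  rewrite /f /E word_sum_last [in LHS]strip_det_all// [in RHS](strip_det0 _ (beta_set c))//.
  (* The exponents of q at r = m and r = 0 differ by exactly the number n + 1 of cells. *)
  have -> : (\sum_i beta_set c i = n.+1 + \sum_(i < m) i)%N.
    rewrite /beta_set big_split /= cn; congr addn.
    rewrite [RHS](reindex_inj rev_ord_inj)/=.
    by apply: eq_bigr => i _; have := ltn_ord i; lia.
  by rewrite exprD; ring.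
apply/eqP; have : (1 - q ^+ n.+1) * f 0 = 0.
  by rewrite mulrBl mul1r -fm' fm subrr.
by move/eqP; rewrite mulf_eq0 subr_eq0 eq_sym (negbTE (q_nroot _)).
Qed.

Lemma word_genE n c : dominant c -> (\sum_i c i = n)%N ->
  \sum_(s : n.-tuple 'I_m | words_of c s) q ^+ word_maj s =
  qfact q n * (\det (\matrix_(i < m, j < m) qrow q j (beta_set c i)) /
    \det (\matrix_(i < m, j < m) qrow q j (beta_set zero i))).
Proof.
move=> dc cn.
have <- : word_sum n c 0 = \sum_(s : n.-tuple 'I_m | words_of c s) q ^+ word_maj s.
  by apply: eq_bigr => s _; rewrite /top_weight; case: tval => [|x s']; rewrite mul1r.
rewrite word_sumE// !strip_det0//; congr (_ * _).
by rewrite -mulf_div divff ?mul1r// expf_neq0.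
Qed.

End words.

(** * Bijection between standard tableaux and Yamanouchi words *)

Section tableau_words.
Local Open Scope set_scope.
Variable lam : intpart.
Local Notation n := (sumn lam).
Local Notation m := (size lam).

Definition row_len (i : 'I_m) : nat := nth 0%N lam i.

Definition mkcell (i : 'I_m) j (h : (j < row_len i)%N) : cell lam :=
  Tagged (fun i : 'I_m => 'I_(nth 0%N lam i)) (Ordinal h).

Lemma cell_ext (c d : cell lam) :
  tag c = tag d -> cell_col c = cell_col d -> c = d.
Proof.
case: c d => [i j] [i' j'] /= e; subst i'; rewrite /cell_col /= => e.
by congr existT; apply: val_inj.
Qed.

Lemma row_len_dominant : dominant row_len.
Proof.
apply/dominantP => i j ij; rewrite /row_len.
have /andP[srt _] := intpartP lam.
have tr : transitive geq by move=> a b c /= ab /leq_trans; exact.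
have := sorted_leq_nth tr (fun x => leqnn x) 0%N srt. by move=> h; apply: h; rewrite ?inE ?ltn_ord.
Qed.

Lemma sum_row_len : (\sum_i row_len i = n)%N.
Proof.
rewrite /row_len; elim: (lam : seq nat) => [|a s IH] /=; first by rewrite big_ord0.
by rewrite big_ord_recl /= -IH.
Qed.

Lemma card_cell : #|{: cell lam}| = n.
Proof.
rewrite card_tagged -sum_row_len sumnE big_map big_enum /=.
by apply: eq_bigr => i _; rewrite card_ord.
Qed.

Definition row_count (u : seq 'I_m) (i : 'I_m) (k : nat) : nat :=
  count_mem i (take k u).

Lemma row_count_le u i k l : (k <= l)%N -> (row_count u i k <= row_count u i l)%N.
Proof.
move=> kl; rewrite /row_count -(subnKC kl) takeD count_cat; exact: leq_addr.
Qed.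

Lemma row_countS (u : n.-tuple 'I_m) i (k : 'I_n) :
  row_count u i k.+1 = (row_count u i k + (tnth u k == i))%N.
Proof.
rewrite /row_count (take_nth (tnth u k)) ?size_tuple// -cats1 count_cat /=.
by rewrite addn0 -tnth_nth.
Qed.

Lemma yamanouchi_drop s : reflect (forall k, dominant (content (drop k s)))
  (@yamanouchi m s).
Proof.
apply: (iffP idP); elim: s => [|x s IH].
- by move=> _ k; apply/dominantP.
- move=> /[dup] /yamanouchi_dominant dx /= /andP[_ ys] [|k]; first by rewrite drop0.
  by rewrite /=; apply: IH.
- by [].
- by move=> h; rewrite /= (h 0%N) IH// => k; exact: (h k.+1).
Qed.

Lemma yamanouchi_rev (u : n.-tuple 'I_m) :
  reflect (forall k, dominant (row_count u ^~ k)) (yamanouchi (rev u)).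
Proof.
have E k i : content (drop k (rev u)) i = row_count u i (n - k).
  by rewrite /content drop_rev size_tuple count_rev.
apply: (iffP (yamanouchi_drop _)) => h k.
  have [kn|nk] := leqP k n.
    rewrite (eq_dominant (c' := content (drop (n - k) (rev u))))// => i.
    by rewrite E subKn.
  rewrite (eq_dominant (c' := content (drop 0 (rev u))))// => i.
  by rewrite E subn0 /row_count !take_oversize// size_tuple// ltnW.
by rewrite (eq_dominant (E k)).
Qed.

Lemma word_maj_rev (u : seq 'I_m) : word_maj (rev u) =
  (\sum_(1 <= i < size u | nth 0 (map val u) i.-1 < nth 0 (map val u) i) i)%N.
Proof.
elim/last_ind: u => [|u x IH]; first by rewrite big_geq.
rewrite rev_rcons /= IH size_rcons.
case: (lastP u) => [|v y]; first by rewrite !big_geq.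
rewrite rev_rcons /= size_rev !size_rcons.
rewrite [in RHS]big_mkcond [in RHS]big_nat_recr //= -big_mkcond addnC; congr addn.
  apply: congr_big_nat => // i /andP[_ ilt].
  rewrite !(map_rcons _ (rcons v y)) !(nth_rcons _ (map _ (rcons v y))).
  by rewrite size_map size_rcons ilt (leq_ltn_trans (leq_pred i)).
rewrite !(map_rcons _ (rcons v y)) !(nth_rcons _ (map _ (rcons v y))).
rewrite size_map size_rcons ltnSn ltnn eqxx.
by rewrite map_rcons nth_rcons size_map ltnn eqxx.
Qed.

Section of_tableau.
Variable T : SYT lam.

Lemma tableau_bij : exists g : 'I_n -> cell lam, cancel (val T) g /\ cancel g (val T).
Proof.
have /asboolP[] := valP T; case=> g h1 h2 _ _.
by exists g.
Qed.

Definition cell_of : 'I_n -> cell lam := sval (cid tableau_bij).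

Lemma cell_ofK : cancel cell_of (val T).
Proof. by rewrite /cell_of; case: cid => g []. Qed.

Lemma entryK : cancel (val T) cell_of.
Proof. by rewrite /cell_of; case: cid => g []. Qed.

Definition row_word : n.-tuple 'I_m := [tuple tag (cell_of k) | k < n].

Lemma tnth_row_word k : tnth row_word k = tag (cell_of k).
Proof. by rewrite tnth_mktuple. Qed.

(** Values of [T] start at 0, so a value below k is an entry at most k. Raising k by one adds the
    single cell that holds the value k. *)
Lemma row_count_card i (k : nat) : (k <= n)%N ->
  row_count row_word i k = #|[set j : 'I_(row_len i) | (val T (mkcell (ltn_ord j)) < k)%N]|.
Proof.
elim: k => [|k IH] kn.
  rewrite /row_count take0 /=; apply/esym/eqP; rewrite cards_eq0; apply/eqP/setP => j.
  by rewrite !inE ltn0.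
have := row_countS row_word i (Ordinal kn) => /= ->; rewrite IH 1?ltnW//.
rewrite tnth_row_word.
set c := cell_of _.
have Tc : val T c = Ordinal kn by rewrite cell_ofK.
have [ci|ci] := eqVneq (tag c) i; last first.
  rewrite addn0; apply: eq_card => j; rewrite !inE ltnS [RHS]leq_eqVlt.
  suff /negbTE -> : (val T (mkcell (ltn_ord j)) != k :> nat) by [].
  apply: contra ci => /eqP e.
  suff -> : c = mkcell (ltn_ord j) by [].
  by apply: (can_inj entryK); rewrite Tc; apply: val_inj; rewrite /= e.
rewrite addn1; have jlt : (cell_col c < row_len i)%N by rewrite -ci /cell_col; case: (c) => a b /=.
have cE : c = mkcell jlt by apply: cell_ext.
rewrite [RHS](cardsD1 (Ordinal jlt)) inE /=.
have mkE : mkcell (ltn_ord (Ordinal jlt)) = c by apply: cell_ext.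
rewrite mkE Tc /= ltnSn add1n; congr _.+1; apply: eq_card => j; rewrite !inE ltnS [in RHS]leq_eqVlt.
have [->|jne] /= := eqVneq j (Ordinal jlt).
  by rewrite mkE Tc /= ltnn.
suff /negbTE -> : (val T (mkcell (ltn_ord j)) != k :> nat) by [].
apply: contra jne => /eqP e; apply/eqP/val_inj => /=.
have : c = mkcell (ltn_ord j).
  by apply: (can_inj entryK); rewrite Tc; apply: val_inj; rewrite /= e.
by rewrite cE => /(congr1 (@cell_col lam)).
Qed.

Lemma row_increasing (i : 'I_m) j j' (h : (j < row_len i)%N) (h' : (j' < row_len i)%N) :
  (j < j')%N -> (val T (mkcell h) < val T (mkcell h'))%N.
Proof.
by move=> jj; have /asboolP[_ rw _] := valP T; exact: (rw (mkcell h) (mkcell h')).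
Qed.

(** Rows increase, so the values below k occupy an initial segment of row i whose length is the
    count. Hence the columns of a tableau can be recovered from its word. *)
Lemma entry_lt_row_count i j (h : (j < row_len i)%N) k : (k <= n)%N ->
  (val T (mkcell h) < k)%N = (j < row_count row_word i k)%N.
Proof.
move=> kn; rewrite row_count_card//.
set S := [set _ | _].
have Sdown (a b : 'I_(row_len i)) : (a <= b)%N -> b \in S -> a \in S.
  rewrite leq_eqVlt => /orP[/eqP/val_inj ->//|ab]; rewrite !inE; apply: ltn_trans.
  exact: row_increasing.
have jS : (val T (mkcell h) < k)%N = (Ordinal h \in S).
  by rewrite inE; congr (val T _ < k)%N; congr mkcell; exact: bool_irrelevance.
have winj a b (ab : (a <= b)%N) : injective (widen_ord ab).
  by move=> x y /(congr1 val) /= /val_inj.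
rewrite jS; apply/idP/idP => [jin|].
  have sub : [set a : 'I_(row_len i) | (a <= j)%N] \subset S.
    by apply/fintype.subsetP => a; rewrite inE => aj; apply: Sdown jin.
  have := subset_leq_card sub; apply: leq_trans.
  rewrite -[X in (X <= _)%N]card_ord -(card_imset _ (winj _ _ h)).
  apply: subset_leq_card; apply/fintype.subsetP => x /imsetP[y _ ->]; rewrite inE /=.
  by rewrite -ltnS.
apply: contraTT => jnS; rewrite -leqNgt.
have sub : S \subset [set widen_ord (ltnW h) x | x : 'I_j].
  apply/fintype.subsetP => a aS; have aj : (a < j)%N.
    by rewrite ltnNge; apply: contra jnS => ja; apply: Sdown aS.
  by apply/imsetP; exists (Ordinal aj) => //; apply: val_inj.
apply: leq_trans (subset_leq_card sub) _.
by rewrite card_imset ?card_ord//; exact: winj.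
Qed.

(** If a row has j + 1 values below k, its cell in column j holds one of them; as columns increase,
    so does the cell above it in any higher row. *)
Lemma row_word_dominant k : (k <= n)%N -> dominant (row_count row_word ^~ k).
Proof.
move=> kn; apply/dominantP => i i' ii'.
case E : (row_count row_word i' k) => [//|j].
have jlt : (j < row_len i')%N.
  have := row_count_card i' kn; rewrite E => e.
  have : (j.+1 <= #|'I_(row_len i')|)%N by rewrite e; exact: max_card.
  by rewrite card_ord.
have /dominantP/(_ i i' ii') rl := row_len_dominant.
have jlt' : (j < row_len i)%N := leq_trans jlt rl.
rewrite -(entry_lt_row_count jlt' kn).
have : (val T (mkcell jlt) < k)%N by rewrite (entry_lt_row_count jlt kn) E.
move: ii'; rewrite leq_eqVlt => /orP[/eqP/val_inj e|ii'].
  by subst i'; rewrite (bool_irrelevance jlt' jlt).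
apply: ltn_trans; have /asboolP[_ _ cl] := valP T.
exact: (cl (mkcell jlt') (mkcell jlt)).
Qed.

Lemma row_word_content i : row_count row_word i n = row_len i.
Proof.
rewrite row_count_card// -[RHS]card_ord; apply: eq_card => j.
by rewrite inE ltn_ord.
Qed.

Lemma cell_col_of k : cell_col (cell_of k) = row_count row_word (tag (cell_of k)) k.
Proof.
have kn : (k <= n)%N by exact: ltnW.
set c := cell_of k; have Tc : val T c = k by rewrite cell_ofK.
have jlt : (cell_col c < row_len (tag c))%N by rewrite /cell_col; case: (c) => a b /=.
have cE : c = mkcell jlt by apply: cell_ext.
apply/eqP; rewrite eqn_leq; apply/andP; split.
  rewrite leqNgt; apply/negP => lt.
  have lt' := ltn_trans lt jlt.
  have : (val T (mkcell lt') < k)%N.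
    have := row_increasing lt' jlt lt; rewrite -cE => /leq_trans; apply.
    by rewrite Tc.
  by rewrite (entry_lt_row_count lt' kn) ltnn.
by rewrite leqNgt -(entry_lt_row_count jlt kn) -cE Tc ltnn.
Qed.

Lemma maj_row_word : maj T = word_maj (rev row_word).
Proof.
rewrite word_maj_rev size_tuple /maj; apply: congr_big_nat => // i /andP[i0 ilt].
have ilt' : (i.-1 < n)%N by rewrite (leq_ltn_trans (leq_pred i)).
have nthE k (h : (k < n)%N) : nth 0%N (map val row_word) k = cell_row (cell_of (Ordinal h)).
  rewrite (nth_map (tag (cell_of (Ordinal h)))) ?size_tuple//.
  by rewrite -[X in nth _ _ X]/(nat_of_ord (Ordinal h)) -tnth_nth tnth_row_word.
rewrite (nthE _ ilt) (nthE _ ilt').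
apply/existsP/idP => [[c /existsP[d /and3P[/eqP ec /eqP ed]]]|lt].
  have -> : c = cell_of (Ordinal ilt').
    by apply: (can_inj entryK); rewrite cell_ofK; apply: val_inj; rewrite /= -ec.
  have -> // : d = cell_of (Ordinal ilt).
  by apply: (can_inj entryK); rewrite cell_ofK; apply: val_inj => /=; case: ed.
exists (cell_of (Ordinal ilt')); apply/existsP; exists (cell_of (Ordinal ilt)).
by rewrite lt /entry !cell_ofK /= prednK// !eqxx.
Qed.

End of_tableau.

Lemma row_word_inj : injective row_word.
Proof.
move=> T T' e; apply: val_inj; apply/ffunP => c.
have ce k : cell_of T k = cell_of T' k.
  apply: cell_ext; first by rewrite -!tnth_row_word e.
  by rewrite !cell_col_of -!tnth_row_word e.
by apply: (can_inj (cell_ofK T)); rewrite entryK ce entryK.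
Qed.

(** Put the value k into row u_k, in the first column still free there. Rows then increase by
    construction, and columns do because every prefix is dominant. *)
Lemma row_word_surj (u : n.-tuple 'I_m) :
  words_of row_len [tuple of rev u] -> exists T, row_word T = u.
Proof.
move=> /andP[/yamanouchi_rev dom /forallP cont].
have cnt i : row_count u i n = row_len i.
  have /eqP <- := cont i.
  by rewrite /content count_rev /row_count take_oversize// size_tuple.
have lt (k : 'I_n) : (row_count u (tnth u k) k < row_len (tnth u k))%N.
  rewrite -cnt; apply: leq_trans (row_count_le _ _ (ltn_ord k)).
  by rewrite row_countS eqxx addn1.
pose g k := mkcell (lt k).
have mono i k l : (row_count u i k < row_count u i l)%N -> (k < l)%N.
  by move=> h; rewrite ltnNge; apply: contraTN h => /(row_count_le u i); rewrite -leqNgt.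
have ginj : injective g.
  move=> k l e; have /(congr1 (@tag _ _)) /= t := e.
  have := congr1 (@cell_col lam) e; rewrite /cell_col /= t => ec.
  apply: val_inj; apply/eqP; rewrite eqn_leq; apply/andP; split; rewrite -ltnS.
    by apply: (mono (tnth u l)); rewrite row_countS eqxx addn1 ec.
  by apply: (mono (tnth u l)); rewrite row_countS t eqxx addn1 ec.
have [f gK fK] : bijective g by apply: inj_card_bij; rewrite ?card_cell ?card_ord.
have std : standard (finfun f : filling lam).
  split.
  - by exists g => c; rewrite ffunE.
  - move=> c d rE cE; rewrite /entry !ffunE ltnS.
    move: rE cE; rewrite -[c in X in X -> _]fK -[d in X in X -> _]fK.
    rewrite -{2}[c]fK -{2}[d]fK /cell_row /cell_col /= => /val_inj ->.
    exact: mono.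
  - move=> c d cE rlt; rewrite /entry !ffunE ltnS.
    move: cE rlt; rewrite -[c in X in X -> _]fK -[d in X in X -> _]fK.
    rewrite -{2}[c]fK -{2}[d]fK /cell_row /cell_col /= => cE rlt.
    have : (f c <= f d)%N.
      rewrite -ltnS; apply: (mono (tnth u (f c))); rewrite cE.
      have /dominantP/(_ _ _ (ltnW rlt)) := dom (f d).+1; apply: leq_trans.
      by rewrite row_countS eqxx addn1.
    rewrite leq_eqVlt => /orP[/eqP/val_inj e|//].
    by move: rlt; rewrite e ltnn.
have sT : `[< standard (finfun f : filling lam) >] by apply/asboolP.
pose T : SYT lam := exist (fun T : filling lam => is_true `[< standard T >]) _ sT.
exists T; apply: eq_from_tnth => k; rewrite tnth_row_word.
have -> : cell_of T k = g k; last by [].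
by apply: (can_inj (entryK T)); rewrite cell_ofK /= ffunE gK.
Qed.

Lemma maj_word_sum (V : nmodType) (f : nat -> V) :
  \sum_(T : SYT lam) f (maj T) =
  \sum_(s : n.-tuple 'I_m | words_of row_len s) f (word_maj s).
Proof.
rewrite [RHS](reindex_inj (h := fun u : n.-tuple 'I_m => [tuple of rev u])); last first.
  by move=> u v /(congr1 val) /= /(congr1 rev); rewrite !revK => /val_inj.
rewrite (eq_bigr (fun T => f (word_maj (rev (row_word T))))) => [|T _]; last first.
  by rewrite maj_row_word.
rewrite (eq_bigl (fun T => T \in [set: SYT lam])) => [|T]; last by rewrite inE.
rewrite -(big_imset (h := row_word) (fun u : n.-tuple 'I_m => f (word_maj (rev u))) (A := [set: SYT lam])) /=.
  apply: eq_bigl => u; apply/imsetP/idP => [[T _ ->]|/row_word_surj[T <-]]; last by exists T; rewrite ?inE.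
  apply/andP; split.
    apply/yamanouchi_rev => k; have [kn|nk] := leqP k n; first exact: row_word_dominant.
    rewrite (eq_dominant (c' := row_count (row_word T) ^~ n)); first exact: row_word_dominant.
    by move=> i; rewrite /row_count !take_oversize// size_tuple// ltnW.
  apply/forallP => i; rewrite /content count_rev -(row_word_content T).
  by rewrite /row_count take_oversize// size_tuple.
by move=> T T' _ _; exact: row_word_inj.
Qed.

End tableau_words.

(** * The q-hook length formula *)

Section hooks.

Fixpoint betas (s : seq nat) : seq nat :=
  if s is a :: s' then (a + size s')%N :: betas s' else [::].

(* The hook lengths of the row of beta-number [b] are the [h] in [1, b] such that
   [b - h] is not a smaller beta-number. *)
Definition row_hooks (b : nat) (bs : seq nat) : seq nat :=
  [seq h <- iota 1 b | (b - h)%N \notin bs].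

Fixpoint hooks (s : seq nat) : seq nat :=
  if s is a :: s' then row_hooks (a + size s') (betas s') ++ hooks s' else [::].

(** The exponent b of the hook formula: row i, counted from 0, contributes i times its length. *)
Fixpoint row_weight (s : seq nat) : nat :=
  if s is _ :: s' then (sumn s' + row_weight s')%N else 0%N.

Lemma size_betas s : size (betas s) = size s.
Proof. by elim: s => //= a s ->. Qed.

Lemma nth_betas s i : (i < size s)%N ->
  nth 0%N (betas s) i = (nth 0%N s i + ((size s).-1 - i))%N.
Proof.
elim: s i => [//|a s IH] [|i] /=; first by rewrite subn0.
by rewrite ltnS => h; rewrite IH//; congr addn; lia.
Qed.

Lemma betas_lt a s : path geq a s -> all (fun b => b < a + size s)%N (betas s).
Proof.
elim: s a => [//|c s IH] a /= /andP[ac ps].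
apply/andP; split; first by rewrite addnS ltnS leq_add2r.
apply/allP => b /(allP (IH _ ps)) bc; apply: leq_trans bc _.
by rewrite addnS leqW// leq_add2r.
Qed.

Lemma uniq_betas s : sorted geq s -> uniq (betas s).
Proof.
elim: s => [//|a s IH] /= ps; rewrite IH ?(path_sorted ps)// andbT.
by apply/negP => /(allP (betas_lt ps)); rewrite ltnn.
Qed.

Lemma perm_filter_split (T : eqType) (a : pred T) (s : seq T) :
  perm_eq s ([seq x <- s | a x] ++ [seq x <- s | ~~ a x]).
Proof. by rewrite perm_sym; exact/permPl/perm_filterC. Qed.

(** What the hooks of a row omit from 1, ..., b are the differences with the smaller beta-numbers,
    which are the exponents in the Vandermonde product. *)
Lemma row_hooks_perm (b : nat) (bs : seq nat) : uniq bs -> all (ltn^~ b) bs ->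
  perm_eq (iota 1 b) (row_hooks b bs ++ [seq (b - c)%N | c <- bs]).
Proof.
move=> ub lb.
have lbP c : c \in bs -> (c < b)%N by move=> /(allP lb).
have -> : row_hooks b bs =
    [seq h <- iota 1 b | h \notin [seq (b - c)%N | c <- bs]].
  apply: eq_in_filter => h; rewrite mem_iota add1n => /andP[h0 hb] /=.
  congr (~~ _); apply/idP/mapP => [hin|[c cin ->]].
    by exists (b - h)%N => //; lia.
  by rewrite subKn// ltnW// lbP.
apply: perm_trans (perm_filter_split (mem [seq (b - c)%N | c <- bs]) _) _.
rewrite perm_catC perm_cat2l; apply: uniq_perm.
- by rewrite filter_uniq// iota_uniq.
- by rewrite map_inj_in_uniq// => c d /lbP hc /lbP hd /=; lia.
move=> h; rewrite mem_filter /= mem_iota; apply/andP/idP => [[]//|hin]; split=> //.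
by case/mapP: hin => c /lbP hc ->; lia.
Qed.

Lemma hooks_row_perm a s : sorted geq (a :: s) ->
  perm_eq (iota 1 (a + size s))
    (row_hooks (a + size s) (betas s) ++ [seq (a + size s - c)%N | c <- betas s]).
Proof.
move=> ps; apply: row_hooks_perm; first exact: (uniq_betas (path_sorted ps)).
exact: (betas_lt ps).
Qed.

Lemma size_hooks s : sorted geq s -> size (hooks s) = sumn s.
Proof.
elim: s => [//|a s IH] ps /=; rewrite size_cat IH ?(path_sorted ps)//.
have := perm_size (hooks_row_perm ps).
by rewrite size_iota size_cat size_map size_betas => /eqP; rewrite eqn_add2r => /eqP <-.
Qed.

Lemma size_le_sumn (s : seq nat) : 0%N \notin s -> (size s <= sumn s)%N.
Proof.
elim: s => [//|[|a] s IH] //; rewrite inE /= => /IH h.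
by rewrite addSn ltnS (leq_trans h)// leq_addl.
Qed.

Lemma betas_le_sumn (s : seq nat) b : 0%N \notin s -> b \in betas s -> (b <= sumn s)%N.
Proof.
elim: s => [//|a s IH] /=; rewrite inE => /norP[_ s0] /predU1P[->|/(IH s0)].
  by rewrite leq_add2l size_le_sumn.
by move=> h; rewrite (leq_trans h)// leq_addl.
Qed.

Lemma betas_gt0 (s : seq nat) b : 0%N \notin s -> b \in betas s -> (0 < b)%N.
Proof.
elim: s => [//|a s IH] /=; rewrite inE => /norP[a0 s0] /predU1P[->|/(IH s0)//].
by rewrite addn_gt0 lt0n eq_sym a0.
Qed.

Lemma mem_row_hooks b bs h : h \in row_hooks b bs -> (0 < h <= b)%N.
Proof. by rewrite mem_filter mem_iota add1n ltnS => /andP[]. Qed.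

Lemma mem_hooks (s : seq nat) h : 0%N \notin s -> h \in hooks s -> (0 < h <= sumn s)%N.
Proof.
elim: s => [//|a s IH] /= /[dup] s0; rewrite inE => /norP[_ s0'].
rewrite mem_cat => /orP[/mem_row_hooks/andP[-> h2]|/(IH s0')/andP[-> h2]] /=.
  by apply: leq_trans h2 _; rewrite leq_add2l size_le_sumn.
by rewrite (leq_trans h2)// leq_addl.
Qed.

(** The beta-numbers are the hook lengths of the first column: h = b qualifies because b - b = 0 is
    not a beta-number when all parts are positive. *)
Lemma hooks_betas (s : seq nat) : sorted geq s -> 0%N \notin s ->
  exists r, perm_eq (hooks s) (betas s ++ r).
Proof.
elim: s => [|a s IH] ps; first by exists [::].
rewrite inE => /norP[a0 s0]; have [r hr] := IH (path_sorted ps) s0.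
have Bin : (a + size s)%N \in row_hooks (a + size s) (betas s).
  rewrite mem_filter subnn mem_iota add1n ltnS leqnn andbT.
  rewrite addn_gt0 lt0n eq_sym a0 /= andbT.
  by apply/negP => /(betas_gt0 s0).
exists (rem (a + size s)%N (row_hooks (a + size s) (betas s)) ++ r) => /=.
rewrite (perm_trans (perm_cat (perm_to_rem Bin) hr))//.
by rewrite cat_cons perm_cons perm_catCA perm_refl.
Qed.

(** D is [row_hooks] of the top row or the list of all beta-numbers. Neither list repeats a value,
    so D can be removed from 1, ..., n and leaves as many numbers as there are remaining hooks. *)
Lemma hook_split (lam : intpart) : exists D Re Mi : seq nat,
  [/\ perm_eq (hooks lam) (D ++ Re), perm_eq (iota 1 (sumn lam)) (D ++ Mi),
      size Re = aft lam & size Mi = aft lam].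
Proof.
have /andP[srt n0] := intpartP lam.
suff [D [Re [uD sD hD lD]]] : exists D Re, [/\ uniq D,
    size D = maxn (head 0 lam)%N (head 0 (conj_parts lam))%N,
    perm_eq (hooks lam) (D ++ Re) & forall d, d \in D -> (0 < d <= sumn lam)%N].
  exists D, Re, [seq j <- iota 1 (sumn lam) | j \notin D].
  have pM : perm_eq (iota 1 (sumn lam)) (D ++ [seq j <- iota 1 (sumn lam) | j \notin D]).
    apply: perm_trans (perm_filter_split (mem D) _) _; rewrite perm_cat2r.
    apply: uniq_perm => //; first by rewrite filter_uniq// iota_uniq.
    move=> h; rewrite mem_filter /= mem_iota add1n ltnS.
    by apply/andP/idP => [[]//|hin]; split=> //; exact: lD.
  split=> //; rewrite /aft -sD.
    by have := perm_size hD; rewrite size_cat size_hooks// => ->; rewrite addKn.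
  by have := perm_size pM; rewrite size_cat size_iota => /(congr1 (subn^~ (size D))); rewrite addKn => <-.
case: {+}(parts lam) srt n0 => [|a s] /=; first by move=> _ _; exists [::], [::]; split.
move=> srt n0; rewrite /conj_parts /=.
have a0 : (0 < a)%N by move: n0; rewrite inE lt0n eq_sym => /norP[].
have s0 : 0%N \notin s by move: n0; rewrite inE => /norP[].
have -> : head 0%N (mkseq (fun j => (j < a) + count (fun r => j < r)%N s)%N a) = (size s).+1.
  case: a a0 {srt n0} => //= a _; rewrite add1n; congr _.+1.
  apply/eqP; rewrite -all_count; apply/allP => r rs; rewrite lt0n.
  by apply: contraNneq s0 => <-.
have [sa|] := leqP (size s).+1 a.
  exists (row_hooks (a + size s) (betas s)), (hooks s); split=> //.
  - by rewrite filter_uniq// iota_uniq.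
  - have := perm_size (hooks_row_perm srt).
    by rewrite size_iota size_cat size_map size_betas => /eqP; rewrite eqn_add2r => /eqP <-.
  - move=> d /mem_row_hooks /andP[-> h]; rewrite (leq_trans h)//= leq_add2l.
    exact: size_le_sumn.
move=> sa.
have [r hr] := @hooks_betas (a :: s) srt n0.
exists (betas (a :: s)), r; split=> //.
- exact: (@uniq_betas (a :: s) srt).
- by rewrite size_betas.
- by move=> d db; rewrite (betas_gt0 n0 db) (betas_le_sumn n0 db).
Qed.

End hooks.

(** * From the determinant to the hook product *)

Section hook_generating_function.

(** The power of q extracted from the Vandermonde product when each factor q^c - q^b with c < b is
    written as q^c (1 - q^(b-c)). *)
Fixpoint beta_weight (s : seq nat) : nat :=
  if s is _ :: s' then (sumn (betas s') + beta_weight s')%N else 0%N.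

Lemma betas_nseq0 k b : (b \in betas (nseq k 0%N)) = (b < k)%N.
Proof.
by elim: k => [//|k IH] /=; rewrite inE IH add0n size_nseq ltnS [RHS]leq_eqVlt.
Qed.

Lemma hooks_nseq0 k : hooks (nseq k 0%N) = [::].
Proof.
elim: k => [//|k /= ->]; rewrite cats0 add0n size_nseq.
apply/eqP; rewrite -size_eq0 size_filter -leqn0 leqNgt -has_count.
apply/negP => /hasP[h]; rewrite mem_iota add1n => /andP[h0 hk].
by rewrite betas_nseq0; lia.
Qed.

Lemma sumn_betas s :
  sumn (betas s) = (sumn s + sumn (betas (nseq (size s) 0)))%N.
Proof. by elim: s => //= a s ->; rewrite add0n size_nseq; lia. Qed.

Lemma beta_weightE s :
  beta_weight s = (beta_weight (nseq (size s) 0%N) + row_weight s)%N.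
Proof. by elim: s => //= a s ->; rewrite (sumn_betas s); lia. Qed.

Variables (F : fieldType) (q : F).
Hypothesis q_neq0 : q != 0.
Hypothesis q_nroot : forall j, (0 < j)%N -> q ^+ j != 1.

Definition vander_seq (b : seq nat) : F :=
  \prod_(i < size b) \prod_(j < size b | (i < j)%N)
     (q ^+ nth 0%N b j - q ^+ nth 0%N b i).

Lemma vander_seq_cons a b : vander_seq (a :: b) =
  (\prod_(c <- b) (q ^+ c - q ^+ a)) * vander_seq b.
Proof.
rewrite /vander_seq /= big_ord_recl /=; congr (_ * _).
  rewrite big_mkcond big_ord_recl /= mul1r.
  by rewrite (big_nth 0%N) big_mkord.
apply: eq_bigr => i _; rewrite big_mkcond big_ord_recl /= mul1r [RHS]big_mkcond.
by apply: eq_bigr => j _.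
Qed.

Lemma qfact_iota n : qfact q n = \prod_(h <- iota 1 n) (1 - q ^+ h).
Proof. by rewrite /qfact /index_iota subn1. Qed.

(** Row by row: 1, ..., b splits into the hooks of the row and the differences b - c, so the hook
    factors times the Vandermonde factors of that row give [qfact b] up to a power of q. *)
Lemma vander_hooks s : sorted geq s ->
  vander_seq (betas s) * \prod_(h <- hooks s) (1 - q ^+ h) =
  q ^+ beta_weight s * \prod_(b <- betas s) qfact q b.
Proof.
elim: s => [|a s IH] ps /=.
  by rewrite /vander_seq !big_ord0 !big_nil expr0.
rewrite vander_seq_cons big_cat big_cons /= qfact_iota.
rewrite (perm_big _ (hooks_row_perm ps)) /= big_cat /= big_map [in RHS]exprD.
have /= blt := allP (betas_lt ps).
have -> : \prod_(c <- betas s) (q ^+ c - q ^+ (a + size s)) =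
    q ^+ sumn (betas s) * \prod_(c <- betas s) (1 - q ^+ (a + size s - c)).
  rewrite sumnE expr_sum -big_split /=; apply: eq_big_seq => c /blt cb.
  by rewrite mulrBr mulr1 -exprD subnKC// ltnW.
transitivity (q ^+ sumn (betas s) * (\prod_(h <- row_hooks (a + size s) (betas s)) (1 - q ^+ h) *
   \prod_(c <- betas s) (1 - q ^+ (a + size s - c))) *
   (vander_seq (betas s) * \prod_(h <- hooks s) (1 - q ^+ h))); first by ring.
by rewrite IH ?(path_sorted ps)//; ring.
Qed.

Lemma det_qrow_hooks s : sorted geq s ->
  \det (\matrix_(i < size s, j < size s) qrow q j (nth 0%N (betas s) i)) *
  \prod_(h <- hooks s) (1 - q ^+ h) = q ^+ beta_weight s.
Proof.
move=> ps; rewrite (det_qrow _ (fun i : 'I_(size s) => nth 0%N (betas s) i)).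
have nz : \prod_(b <- betas s) qfact q b != 0.
  by rewrite prodf_seq_neq0; apply/allP => b _; exact: qfact_neq0.
have -> : \prod_(i < size s) qfact q (nth 0%N (betas s) i) =
    \prod_(b <- betas s) qfact q b.
  by rewrite (big_nth 0%N) big_mkord size_betas.
have -> : \prod_(i < size s) \prod_(j < size s | (i < j)%N)
    (q ^+ nth 0%N (betas s) j - q ^+ nth 0%N (betas s) i) = vander_seq (betas s).
  by rewrite /vander_seq size_betas.
by rewrite mulrAC vander_hooks// mulfK.
Qed.

Lemma maj_hook_formula (lam : intpart) :
  (\sum_(T : SYT lam) q ^+ maj T) * \prod_(h <- hooks lam) (1 - q ^+ h) =
  q ^+ row_weight lam * \prod_(j <- iota 1 (sumn lam)) (1 - q ^+ j).
Proof.
have /andP[srt _] := intpartP lam.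
rewrite (maj_word_sum lam (fun k => q ^+ k)).
rewrite word_genE//; [|exact: row_len_dominant|exact: sum_row_len].
have d1 := det_qrow_hooks srt.
(* The denominator in [word_genE] belongs to the shape with the same number of rows, all empty. It
   has no hooks, so it is a power of q, and [beta_weightE] leaves the exponent [row_weight]. *)
have s0 : sorted geq (nseq (size lam) 0%N).
  by case: size => //= k; elim: k => //= k ->.
have := det_qrow_hooks s0; rewrite hooks_nseq0 big_nil mulr1 size_nseq => d0.
have -> : \det (\matrix_(i < size lam, j < size lam) qrow q j (beta_set (row_len (lam:=lam)) i)) =
  \det (\matrix_(i < size lam, j < size lam) qrow q j (nth 0%N (betas lam) i)).
  by congr (\det _); apply/matrixP => i j; rewrite !mxE nth_betas.
have -> : \det (\matrix_(i < size lam, j < size lam) qrow q j (beta_set (fun=> 0%N) i)) =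
  \det (\matrix_(i < size lam, j < size lam) qrow q j (nth 0%N (betas (nseq (size lam) 0)) i)).
  congr (\det _); apply/matrixP => i j; rewrite !mxE nth_betas ?size_nseq//.
  by rewrite nth_nseq ltn_ord.
rewrite qfact_iota.
transitivity (\prod_(j <- iota 1 (sumn lam)) (1 - q ^+ j) *
 ((\det (\matrix_(i < size lam, j < size lam) qrow q j (nth 0%N (betas lam) i)) *
  \prod_(h <- hooks lam) (1 - q ^+ h)) / q ^+ beta_weight (nseq (size lam) 0))).
  by rewrite -d0; ring.
rewrite d1 beta_weightE exprD [q ^+ beta_weight _ * _]mulrC mulfK ?expf_neq0//.
by rewrite mulrC.
Qed.

End hook_generating_function.

(** * The hook formula as a polynomial identity *)

Section maj_polynomial.
Variable K : numFieldType.

(** The numbers 2, 3, ... are nonzero, are not roots of unity and are infinitely many, so the hook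
    formula at these points already determines polynomials. *)
Lemma poly_eq_nat (p r : {poly K}) :
  (forall k, p.[k.+2%:R] = r.[k.+2%:R]) -> p = r.
Proof.
move=> h; apply/eqP; rewrite -subr_eq0; apply/eqP.
apply: (@roots_geq_poly_eq0 _ _ [seq k.+2%:R | k <- iota 0 (size (p - r))]).
- by apply/allP => x /mapP[k _ ->]; rewrite /root !hornerE h subrr.
- rewrite map_inj_uniq ?iota_uniq// => x y /eqP.
  by rewrite eqr_nat => /eqP [].
- by rewrite size_map size_iota.
Qed.

Definition maj_poly (lam : intpart) : {poly K} := \sum_(T : SYT lam) 'X^(maj T).

Lemma maj_poly_hooks (lam : intpart) :
  maj_poly lam * \prod_(h <- hooks lam) (1 - 'X^h) =
  'X^(row_weight lam) * \prod_(j <- iota 1 (sumn lam)) (1 - 'X^j).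
Proof.
apply: poly_eq_nat => k; rewrite !hornerM /maj_poly horner_sum !horner_prod.
have E (s : seq nat) : \prod_(h <- s) (1 - 'X^h : {poly K}).[k.+2%:R] =
    \prod_(h <- s) (1 - k.+2%:R ^+ h).
  by apply: eq_bigr => h _; rewrite !hornerE.
rewrite !E hornerXn.
rewrite (eq_bigr (fun T : SYT lam => k.+2%:R ^+ maj T)) => [|T _]; last exact: hornerXn.
apply: maj_hook_formula; first by rewrite pnatr_eq0.
move=> j j0; rewrite gt_eqF// exprn_egt1 ?lt0n_neq0//.
by rewrite ltr1n.
Qed.

Lemma one_subXn_neq0 h : (0 < h)%N -> (1 - 'X^h : {poly K}) != 0.
Proof.
move=> h0; apply/eqP => /(congr1 (fun p => p.[0])).
by rewrite !hornerE expr0n eqn0Ngt h0 subr0 => /eqP; rewrite oner_eq0.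
Qed.

Lemma maj_poly_split (lam : intpart) (D Re Mi : seq nat) :
  perm_eq (hooks lam) (D ++ Re) -> perm_eq (iota 1 (sumn lam)) (D ++ Mi) ->
  maj_poly lam * \prod_(h <- Re) (1 - 'X^h) =
  'X^(row_weight lam) * \prod_(j <- Mi) (1 - 'X^j).
Proof.
move=> pR pM; have := maj_poly_hooks lam.
rewrite (perm_big _ pR) (perm_big _ pM) !big_cat /= !(mulrCA _ (\prod_(i <- D) _)).
apply: mulfI; rewrite prodf_seq_neq0; apply/allP => h hD; apply: one_subXn_neq0.
have : h \in iota 1 (sumn lam) by rewrite (perm_mem pM) mem_cat hD.
by rewrite mem_iota => /andP[].
Qed.

Lemma one_subXn h : 1 - 'X^h = (1 - 'X) * \sum_(i < h) 'X^i :> {poly K}.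
Proof.
rewrite -[1 in LHS](expr1n _ h) subrXX; congr (_ * _).
by apply: eq_bigr => i _; rewrite expr1n mul1r.
Qed.

(** Both sides of [maj_poly_split] contain the same power of 1 - X; cancel it and evaluate at 1. *)
Lemma card_SYT_hooks (lam : intpart) (D Re Mi : seq nat) :
  perm_eq (hooks lam) (D ++ Re) -> perm_eq (iota 1 (sumn lam)) (D ++ Mi) ->
  size Re = size Mi ->
  #|{: SYT lam}|%:R * \prod_(h <- Re) h%:R = \prod_(j <- Mi) j%:R :> K.
Proof.
move=> pR pM sRM; have := maj_poly_split pR pM.
have E (s : seq nat) : \prod_(h <- s) (1 - 'X^h : {poly K}) =
    (1 - 'X) ^+ size s * \prod_(h <- s) \sum_(i < h) 'X^i.
  elim: s => [|h s IH]; first by rewrite !big_nil expr0 mulr1.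
  by rewrite !big_cons IH one_subXn /= exprS; ring.
rewrite !E sRM !(mulrCA _ ((1 - 'X) ^+ _)).
have nz : (1 - 'X : {poly K}) ^+ size Mi != 0 by rewrite expf_neq0// -[X in _ - X]expr1 one_subXn_neq0.
move=> /(mulfI nz) /(congr1 (fun p => p.[1])).
rewrite !hornerM !horner_prod hornerXn expr1n mul1r.
have e (s : seq nat) : \prod_(h <- s) (\sum_(i < h) 'X^i : {poly K}).[1] = \prod_(h <- s) h%:R.
  apply: eq_bigr => h _; rewrite horner_sum (eq_bigr (fun=> 1)) ?sumr_const ?card_ord//.
  by move=> i _; rewrite hornerXn expr1n.
rewrite !e => <-; congr (_ * _); rewrite horner_sum (eq_bigr (fun=> 1)).
  by rewrite sumr_const.
by move=> T _; rewrite hornerXn expr1n.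
Qed.

End maj_polynomial.

(** * Hook lengths against 1, ..., n: the variance *)

Section contents.
Variable R : realFieldType.

(** The shift k appears when the top row is split off and the remaining rows are renumbered. *)
Definition content_sq (k : nat) (s : seq nat) : R :=
  \sum_(i < size s) \sum_(j < nth 0%N s i) (j%:R - (i + k)%:R) ^+ 2.

Definition content_sum (s : seq nat) : R :=
  \sum_(i < size s) \sum_(j < nth 0%N s i) (j%:R - i%:R).

Lemma sumn_nth (s : seq nat) : (\sum_(i < size s) nth 0 s i = sumn s)%N.
Proof. by elim: s => [|a s IH]; rewrite ?big_ord0//= big_ord_recl /= IH. Qed.

Lemma sum_sq_iota n :
  \sum_(h <- iota 1 n) h%:R ^+ 2 = n%:R * (n%:R + 1) * (2 * n%:R + 1) / 6 :> R.
Proof.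
elim: n => [|n IH]; first by rewrite big_nil !mul0r.
by rewrite -[in LHS](addn1 n) iotaD big_cat /= IH big_seq1 add1n -natr1; field.
Qed.

Lemma sum_sq_ord n :
  \sum_(j < n) j%:R ^+ 2 = (n%:R - 1) * n%:R * (2 * n%:R - 1) / 6 :> R.
Proof.
elim: n => [|n IH]; first by rewrite big_ord0 mulr0 !mul0r.
by rewrite big_ord_recr /= IH -natr1; field.
Qed.

Lemma sum_ord n : \sum_(j < n) j%:R = n%:R * (n%:R - 1) / 2 :> R.
Proof.
elim: n => [|n IH]; first by rewrite big_ord0 !mul0r.
by rewrite big_ord_recr /= IH -natr1; field.
Qed.

Lemma content_sum_cons a s : content_sum (a :: s) =
  a%:R * (a%:R - 1) / 2 + (content_sum s - (sumn s)%:R).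
Proof.
rewrite /content_sum /= big_ord_recl /= -sum_ord; congr (_ + _).
  by apply: eq_bigr => j _; rewrite subr0.
rewrite -sumn_nth natr_sum -sumrB; apply: eq_bigr => i _.
rewrite /bump /= add1n -[X in _ - X%:R]card_ord -sumr_const -sumrB.
by apply: eq_bigr => j _; rewrite -natr1; ring.
Qed.

Lemma content_sq_cons a s : content_sq 0 (a :: s) =
  \sum_(j < a) j%:R ^+ 2 + content_sq 1 s.
Proof.
rewrite /content_sq /= big_ord_recl /=; congr (_ + _).
  by apply: eq_bigr => j _; rewrite subr0.
by apply: eq_bigr => i _; apply: eq_bigr => j _; rewrite /bump /= add1n addn0 addn1.
Qed.

Lemma content_sq1 s :
  content_sq 1 s = content_sq 0 s - 2 * content_sum s + (sumn s)%:R.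
Proof.
rewrite /content_sq /content_sum -sumn_nth natr_sum mulr_sumr -sumrB -big_split /=.
apply: eq_bigr => i _.
rewrite -[X in _ + X%:R]card_ord -sumr_const mulr_sumr -sumrB -big_split /=.
by apply: eq_bigr => j _; rewrite addn0 addn1 -natr1; ring.
Qed.

Lemma sum_betas s : \sum_(b <- betas s) b%:R =
  (sumn s)%:R + (size s)%:R * ((size s)%:R - 1) / 2 :> R.
Proof.
elim: s => [|a s IH] /=; first by rewrite big_nil !mul0r addr0.
by rewrite big_cons IH !natrD -natr1; field.
Qed.

Lemma sum_sq_betas s : \sum_(b <- betas s) b%:R ^+ 2 =
  2 * content_sum s + (sumn s)%:R + 2 * ((size s)%:R - 1) * (sumn s)%:R
  + ((size s)%:R - 1) * (size s)%:R * (2 * (size s)%:R - 1) / 6 :> R.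
Proof.
elim: s => [|a s IH] /=; first by rewrite big_nil /content_sum big_ord0; field.
by rewrite big_cons IH content_sum_cons !natrD -natr1; field.
Qed.

(** Induction on the rows. The squared hooks of the top row are 1, 4, ..., b^2 without the squares
    of the differences b - c, by [row_hooks_perm], and the first two power sums of the beta-numbers
    are known in terms of contents. *)
Lemma sum_sq_hooks s : sorted geq s ->
  \sum_(h <- hooks s) h%:R ^+ 2 = (sumn s)%:R ^+ 2 + content_sq 0 s.
Proof.
elim: s => [|a s IH] ps.
  by rewrite big_nil /content_sq big_ord0 expr0n addr0.
rewrite /= big_cat /= IH ?(path_sorted ps)//.
have := sum_sq_iota (a + size s); rewrite (perm_big _ (hooks_row_perm ps)) big_cat /=.
rewrite big_map.
have -> : \sum_(c <- betas s) (a + size s - c)%:R ^+ 2 =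
    (size s)%:R * (a + size s)%:R ^+ 2 - 2 * (a + size s)%:R * \sum_(b <- betas s) b%:R
    + \sum_(b <- betas s) b%:R ^+ 2 :> R.
  have -> : (size s)%:R * (a + size s)%:R ^+ 2 = \sum_(c <- betas s) (a + size s)%:R ^+ 2 :> R.
    by rewrite big_const_seq count_predT size_betas iter_addr_0 mulr_natl.
  rewrite mulr_sumr -sumrB -big_split /=.
  apply: eq_big_seq => c /(allP (betas_lt ps)) /ltnW cb.
  by rewrite natrB//; ring.
rewrite sum_betas sum_sq_betas content_sq_cons content_sq1 sum_sq_ord.
by rewrite !natrD => /(canRL (addrK _)) ->; field.
Qed.

Lemma content_sq_bound k s (M : nat) :
  (forall i, (i < size s)%N -> nth 0%N s i <= M)%N -> (size s + k <= M.+1)%N ->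
  content_sq k s <= (sumn s)%:R * M%:R ^+ 2.
Proof.
move=> hs sk; rewrite -sumn_nth natr_sum mulr_suml; apply: ler_sum => i _.
rewrite -[X in _ <= X%:R * _]card_ord -sumr_const mulr_suml; apply: ler_sum => j _.
rewrite mul1r -[leLHS]real_normK ?num_real// lerXn2r ?nnegrE//.
rewrite ler_norml; apply/andP; split.
  rewrite lerBrDr (le_trans (_ : _ <= 0))//.
  by rewrite addrC subr_le0 ler_nat; have := ltn_ord i; lia.
rewrite lerBlDr -natrD ler_nat.
by have := ltn_ord j; have := hs i (ltn_ord i); lia.
Qed.

(** For a long first column: its cells count with their exact contents, every other cell with at
    most M^2. *)
Lemma content_sq_bound_col (s : seq nat) (M : nat) : 0%N \notin s ->
  (forall i, (i < size s)%N ->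
     (nth 0 s i <= M.+1)%N /\ ((1 < nth 0 s i)%N -> (i <= M)%N)) ->
  content_sq 0 s <= \sum_(j < size s) j%:R ^+ 2 + (sumn s - size s)%:R * M%:R ^+ 2.
Proof.
move=> s0 hs.
have pos (i : 'I_(size s)) : (0 < nth 0 s i)%N.
  by rewrite lt0n; apply: contraNneq s0 => <-; exact: mem_nth.
have -> : (sumn s - size s)%:R = \sum_(i < size s) (nth 0%N s i).-1%:R :> R.
  rewrite -natr_sum; congr (_%:R); rewrite -sumn_nth -[X in (_ - X)%N]card_ord -sum1_card.
  by rewrite -sumnB//; apply: eq_bigr => i _; rewrite subn1.
rewrite mulr_suml -big_split /=; apply: ler_sum => i _.
have [h1 h2] := hs i (ltn_ord i).
move: (pos i) h1 h2; case: (nth 0%N s i) => // c _ h1 h2.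
rewrite big_ord_recl /= addn0 sub0r sqrrN lerD2l.
rewrite -[X in _ <= X%:R * _]card_ord -sumr_const mulr_suml; apply: ler_sum => j _.
rewrite mul1r -[leLHS]real_normK ?num_real// lerXn2r ?nnegrE//.
have jc := ltn_ord j.
have iM : (i <= M)%N by apply: h2; lia.
rewrite /bump /= add1n ler_norml; apply/andP; split.
  rewrite lerBrDr addrC (le_trans (_ : _ <= 0))//.
  by rewrite subr_le0 ler_nat.
by rewrite lerBlDr -natrD ler_nat; lia.
Qed.

Lemma sorted_ge_nth (s : seq nat) i j : sorted geq s -> (i <= j)%N -> (nth 0 s j <= nth 0 s i)%N.
Proof.
move=> srt ij; have [js|js] := ltnP j (size s); last by rewrite [X in (X <= _)%N]nth_default.
have tr : transitive geq by move=> a b c /= ab /leq_trans; exact.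
by apply: (sorted_leq_nth tr (fun x => leqnn x) 0%N srt) => //; rewrite inE// (leq_ltn_trans ij).
Qed.

Lemma nth_gt1_bound (s : seq nat) i : 0%N \notin s -> sorted geq s ->
  (1 < nth 0 s i)%N -> (i < sumn s - size s)%N.
Proof.
elim: s i => [|a s IH] i; first by rewrite nth_nil.
rewrite inE => /norP[a0 s0] /[dup] ps /path_sorted ss.
have le := size_le_sumn s0.
case: i => [|i] /= h; first by lia.
have := IH i s0 ss h.
have := @sorted_ge_nth (a :: s) 0 i.+1 ps isT => /=; lia.
Qed.

Lemma nth_le_bound (s : seq nat) i : 0%N \notin s -> (i < size s)%N ->
  (nth 0 s i <= (sumn s - size s).+1)%N.
Proof.
elim: s i => [//|a s IH] i; rewrite inE => /norP[a0 s0].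
have le := size_le_sumn s0.
by case: i => [_|i] /=; [lia|rewrite ltnS => /(IH i s0); lia].
Qed.

(** The longer of the first row and the first column has n - k cells, whose contents are 0, ..., n -
    k - 1 in absolute value. The other k cells have contents at most min(k, n - k) in absolute
    value. *)
Lemma content_sq_le (lam : intpart) (n := sumn lam) (k := aft lam) :
  content_sq 0 lam <= \sum_(j < (n - k)%N) j%:R ^+ 2 + k%:R * (minn k (n - k))%:R ^+ 2.
Proof.
rewrite /n /k /aft; have /andP[srt n0] := intpartP lam.
case: {+}(parts lam) srt n0 => [|a s].
  by rewrite /content_sq /= !big_ord0 mul0r addr0.
move=> srt n0; rewrite /conj_parts /= .
have a0 : (0 < a)%N by move: n0; rewrite inE lt0n eq_sym => /norP[].
have s0 : 0%N \notin s by move: n0; rewrite inE => /norP[].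
have -> : head 0%N (mkseq (fun j => (j < a) + count (fun r => j < r)%N s)%N a) = (size s).+1.
  case: a a0 {srt n0} => //= a _; rewrite add1n; congr _.+1.
  apply/eqP; rewrite -all_count; apply/allP => r rs; rewrite lt0n.
  by apply: contraNneq s0 => <-.
have szs := size_le_sumn s0.
have [sa|sa] := leqP (size s).+1 a.
  rewrite addKn addnK content_sq_cons lerD2l content_sq_bound//.
    move=> i ilt; rewrite leq_min; apply/andP; split.
      by rewrite -sumn_nth (bigD1 (Ordinal ilt))//= leq_addr.
    exact: (@sorted_ge_nth (a :: s) 0 i.+1 srt isT).
  by rewrite addn1 ltnS leq_min szs ltnW.
have -> : (a + sumn s - (a + sumn s - (size s).+1) = (size s).+1)%N by lia.
apply: content_sq_bound_col => // i ilt; split.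
  have h1 := nth_le_bound n0 ilt.
  have h2 := @sorted_ge_nth (a :: s) 0 i srt isT.
  move: h1 h2 => /=; lia.
move=> /(nth_gt1_bound n0 srt) /= h; move: ilt => /=; lia.
Qed.

(* [12 Var(maj) = sum_Mi j^2 - sum_Re h^2]. *)
Definition sq_excess (Re Mi : seq nat) : R :=
  \sum_(j <- Mi) j%:R ^+ 2 - \sum_(h <- Re) h%:R ^+ 2.

(** Restoring D on both sides compares 1, ..., n with all hooks. The n^2 in [sum_sq_hooks] lowers
    the sum of squares up to n to the one up to n - 1, and [content_sq_le] does the rest. *)
Lemma sq_excess_ge (lam : intpart) (D Re Mi : seq nat) (n := sumn lam) (k := aft lam) :
  perm_eq (hooks lam) (D ++ Re) -> perm_eq (iota 1 n) (D ++ Mi) ->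
  (n%:R - 1) * n%:R * (2 * n%:R - 1) / 6
  - ((n - k)%:R - 1) * (n - k)%:R * (2 * (n - k)%:R - 1) / 6
  - k%:R * (minn k (n - k))%:R ^+ 2 <= sq_excess Re Mi.
Proof.
move=> pR pM; have /andP[srt _] := intpartP lam.
have -> : sq_excess Re Mi = \sum_(h <- iota 1 n) h%:R ^+ 2 - \sum_(h <- hooks lam) h%:R ^+ 2.
  by rewrite (perm_big _ pR) (perm_big _ pM) !big_cat /= /sq_excess; ring.
rewrite sum_sq_hooks// sum_sq_iota -/n.
have := content_sq_le lam; cbv zeta; rewrite sum_sq_ord -/n -/k => h.
have -> : n%:R * (n%:R + 1) * (2 * n%:R + 1) / 6 - (n%:R ^+ 2 + content_sq 0 lam) =
  (n%:R - 1) * n%:R * (2 * n%:R - 1) / 6 - content_sq 0 lam by field.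
by rewrite -addrA lerD2l -opprD lerN2.
Qed.

(** The two cases are the two values of the minimum. A factor k splits off in each, and n >= 4 lets
    the quadratic terms absorb the linear ones. The 16 here and the 12 of the variance make up the
    constant 192. *)
Lemma sq_excess_ge_quad (lam : intpart) (D Re Mi : seq nat) (n := sumn lam) (k := aft lam) :
  perm_eq (hooks lam) (D ++ Re) -> perm_eq (iota 1 n) (D ++ Mi) -> (4 <= n)%N ->
  k%:R * n%:R ^+ 2 / 16 <= sq_excess Re Mi.
Proof.
move=> pR pM n4; apply: le_trans (sq_excess_ge pR pM); rewrite -/n -/k.
have kn : (k <= n)%N by rewrite /k /aft leq_subr.
have -> : n%:R = (n - k)%:R + k%:R :> R by rewrite -natrD subnK.
have : 4 <= (n - k)%:R + k%:R :> R by rewrite -natrD subnK// ler_nat.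
have := ler0n R k; have := ler0n R (n - k).
have [ge|lt] := leqP k (n - k).
  have : k%:R <= (n - k)%:R :> R by rewrite ler_nat.
  move: k%:R (n - k)%:R => y d yd d0 y0 h4.
  rewrite -subr_ge0.
  have -> : (d + y - 1) * (d + y) * (2 * (d + y) - 1) / 6 - (d - 1) * d * (2 * d - 1) / 6
     - y * y ^+ 2 - y * (d + y) ^+ 2 / 16 =
     y * ((2 * ((d + y) ^+ 2 + (d + y) * d + d ^+ 2) - 3 * (d + y + d) + 1) / 6 - y ^+ 2 - (d + y) ^+ 2 / 16).
    by field.
  apply: mulr_ge0 => //; nra.
have : (n - k)%:R <= k%:R :> R by rewrite ler_nat ltnW.
move: k%:R (n - k)%:R => y d yd d0 y0 h4.
rewrite -subr_ge0.
have -> : (d + y - 1) * (d + y) * (2 * (d + y) - 1) / 6 - (d - 1) * d * (2 * d - 1) / 6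
   - y * d ^+ 2 - y * (d + y) ^+ 2 / 16 =
   y * ((2 * ((d + y) ^+ 2 + (d + y) * d + d ^+ 2) - 3 * (d + y + d) + 1) / 6 - d ^+ 2 - (d + y) ^+ 2 / 16).
  by field.
apply: mulr_ge0 => //; nra.
Qed.

(** For fixed k the leading term k n^2 is the exact one; this precision is what confines the
    elements of [Mi] to the vicinity of n. *)
Lemma sq_excess_ge_lin (lam : intpart) (D Re Mi : seq nat) (n := sumn lam) (k := aft lam) :
  perm_eq (hooks lam) (D ++ Re) -> perm_eq (iota 1 n) (D ++ Mi) -> (k.*2 <= n)%N ->
  k%:R * n%:R * (n%:R - 2 * k%:R) <= sq_excess Re Mi.
Proof.
move=> pR pM k2; apply: le_trans (sq_excess_ge pR pM); rewrite -/n -/k.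
have kn : (k <= n - k)%N by lia.
rewrite (minn_idPl kn).
have -> : n%:R = (n - k)%:R + k%:R :> R by rewrite -natrD subnK//; lia.
have [->|k0] := posnP k; first by rewrite subn0 addr0 !mul0r subr0 subrr.
have : 1 <= k%:R :> R by rewrite ler1n.
have : k%:R <= (n - k)%:R :> R by rewrite ler_nat.
move: k%:R (n - k)%:R => y d yd y1.
rewrite -subr_ge0.
have -> : (d + y - 1) * (d + y) * (2 * (d + y) - 1) / 6 - (d - 1) * d * (2 * d - 1) / 6
   - y * y ^+ 2 - y * (d + y) * (d + y - 2 * y) =
   y * ((2 * ((d + y) ^+ 2 + (d + y) * d + d ^+ 2) - 3 * (d + y + d) + 1) / 6 - y ^+ 2
     - (d + y) * (d - y)).
  by field.
apply: mulr_ge0; [lra|nra].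
Qed.

End contents.

(** * The characteristic function of maj *)

Section char_complex.
Variable R : realType.
Import complex.
Local Open Scope complex_scope.

Definition cis (t : R) : R[i] := cos t +i* sin t.

Lemma cisD a b : cis (a + b) = cis a * cis b.
Proof. by rewrite /cis cosD sinD; simpc; rewrite [X in _ +i* X]addrC. Qed.

Lemma cisX t n : cis t ^+ n = cis (n%:R * t).
Proof.
elim: n => [|n IH]; first by rewrite mul0r /cis cos0 sin0.
by rewrite exprS IH -cisD -natr1 mulrDl mul1r addrC.
Qed.

Lemma cis_neq0 t : cis t != 0.
Proof.
apply/eqP => e; have := cisD t (- t).
by rewrite e mul0r subrr /cis cos0 sin0 => /eqP; rewrite eq_complex /= oner_eq0.
Qed.

Lemma one_sub_cis t : 1 - cis t = cis (t / 2) * (- 2 * 'i * (sin (t / 2))%:C).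
Proof.
have e : cis t = cis (t / 2) * cis (t / 2) by rewrite -cisD -splitr.
have h := cos2Dsin2 (t / 2).
rewrite e /cis; simpc; move: (cos (t / 2)) (sin (t / 2)) h => c s /(canRL (addrK _)) h.
by congr (_ +i* _); ring: h.
Qed.

Lemma prod_one_sub_cis t (s : seq nat) :
  \prod_(h <- s) (1 - cis t ^+ h) =
  cis (t * (\sum_(h <- s) h%:R) / 2) * (- 2 * 'i) ^+ size s *
  (\prod_(h <- s) sin (h%:R * t / 2))%:C.
Proof.
elim: s => [|h s IH].
  by rewrite !big_nil mulr0 mul0r /cis cos0 sin0 expr0 !mulr1.
rewrite !big_cons IH cisX one_sub_cis /= exprS mulrDr mulrDl cisD rmorphM /=.
by rewrite [t * h%:R]mulrC; ring.
Qed.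

Lemma cis_sum (I : finType) (f : I -> R) :
  \sum_i cis (f i) = (\sum_i cos (f i)) +i* (\sum_i sin (f i)).
Proof.
apply/eqP; rewrite eq_complex /=; apply/andP; split; apply/eqP.
  by rewrite (raddf_sum (@complex.Re R)).
by rewrite (raddf_sum (@complex.Im R)).
Qed.

(** The phase that remains when every 1 - e^(iht) has given up its factor e^(iht/2). By [maj_mean]
    it is the mean. *)
Definition maj_center (lam : intpart) (Re Mi : seq nat) : R :=
  (row_weight lam)%:R + (\sum_(j <- Mi) j%:R - \sum_(h <- Re) h%:R) / 2.

(** At q = e^it the half-angle phases and, the sizes being equal, the powers of -2i cancel. The
    right side is then real, and the real and imaginary parts give the two equations. *)
Lemma maj_trig_identity (lam : intpart) (D Re Mi : seq nat) (t : R) :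
  perm_eq (hooks lam) (D ++ Re) -> perm_eq (iota 1 (sumn lam)) (D ++ Mi) ->
  size Re = size Mi ->
  (\sum_(T : SYT lam) cos (((maj T)%:R - maj_center lam Re Mi) * t)) *
    \prod_(h <- Re) sin (h%:R * t / 2) = \prod_(j <- Mi) sin (j%:R * t / 2) /\
  (\sum_(T : SYT lam) sin (((maj T)%:R - maj_center lam Re Mi) * t)) *
    \prod_(h <- Re) sin (h%:R * t / 2) = 0.
Proof.
move=> pR pM sRM.
have := congr1 (fun p => (map_poly (real_complex R) p).[cis t]) (maj_poly_split R pR pM).
have mp (s : seq nat) : (map_poly (real_complex R) (\prod_(h <- s) (1 - 'X^h))).[cis t] =
    \prod_(h <- s) (1 - cis t ^+ h).
  rewrite rmorph_prod horner_prod; apply: eq_bigr => h _.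
  by rewrite rmorphB rmorph1 /= map_polyXn !hornerE.
have mX n : (map_poly (real_complex R) 'X^n).[cis t] = cis (n%:R * t).
  by rewrite map_polyXn hornerXn cisX.
have mM : (map_poly (real_complex R) (maj_poly R lam)).[cis t] =
    \sum_(T : SYT lam) cis (maj_center lam Re Mi * t) *
    cis (((maj T)%:R - maj_center lam Re Mi) * t).
  rewrite /maj_poly rmorph_sum horner_sum; apply: eq_bigr => T _.
  by rewrite mX -cisD; congr cis; ring.
rewrite !rmorphM !hornerM !mp mX mM !prod_one_sub_cis sRM.
rewrite -mulr_sumr => e.
have nz : (- 2 * 'i : R[i]) ^+ size Mi != 0.
  rewrite expf_neq0// mulf_neq0 ?oppr_eq0 ?pnatr_eq0//.
  by rewrite eq_complex /= oner_eq0 andbF.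
have : cis (maj_center lam Re Mi * t) * cis (t * (\sum_(h <- Re) h%:R) / 2) *
   (- 2 * 'i) ^+ size Mi *
   ((\sum_(T : SYT lam) cis (((maj T)%:R - maj_center lam Re Mi) * t)) *
    (\prod_(h <- Re) sin (h%:R * t / 2))%:C) =
   cis (maj_center lam Re Mi * t) * cis (t * (\sum_(h <- Re) h%:R) / 2) *
   (- 2 * 'i) ^+ size Mi * (\prod_(j <- Mi) sin (j%:R * t / 2))%:C.
  have -> : cis (maj_center lam Re Mi * t) * cis (t * (\sum_(h <- Re) h%:R) / 2) =
      cis ((row_weight lam)%:R * t) * cis (t * (\sum_(h <- Mi) h%:R) / 2).
    by rewrite -!cisD; congr cis; rewrite /maj_center; field.
  rewrite -[RHS]mulrA -[RHS]mulrA (mulrA (cis (t * _ / 2))) -e.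
  have -> : cis ((row_weight lam)%:R * t) * cis (t * (\sum_(h <- Mi) h%:R) / 2) =
     cis (maj_center lam Re Mi * t) * cis (t * (\sum_(h <- Re) h%:R) / 2).
    by rewrite -!cisD; congr cis; rewrite /maj_center; field.
  by ring.
move=> /mulfI; rewrite !mulf_neq0 ?cis_neq0// => /(_ isT).
rewrite cis_sum => /eqP; rewrite eq_complex /= !mulr0 ?mul0r ?subr0 ?add0r ?addr0.
by move=> /andP[/eqP -> /eqP ->].
Qed.

End char_complex.

(** * Derivatives of explicit functions *)

Section pointwise_derivatives.
Variable R : realType.
Implicit Types (f g : R -> R) (x a b c : R).

(* Not a class, so that unification never tries to infer the derivative. *)
Definition has_deriv x f a := is_derive x (1 : R) f a.

Lemma der_eq f x a b : has_deriv x f a -> a = b -> has_deriv x f b.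
Proof. by move=> h <-. Qed.

Lemma der_cst x c : has_deriv x (fun=> c) 0.
Proof. exact: is_derive_cst. Qed.

Lemma der_id x : has_deriv x (fun y => y) 1.
Proof. exact: is_derive_id. Qed.

Lemma der_add f g x a b : has_deriv x f a -> has_deriv x g b ->
  has_deriv x (fun y => f y + g y) (a + b).
Proof. exact: is_deriveD. Qed.

Lemma der_opp f x a : has_deriv x f a ->
  has_deriv x (fun y => - f y) (- a).
Proof. exact: is_deriveN. Qed.

Lemma der_mul f g x a b : has_deriv x f a -> has_deriv x g b ->
  has_deriv x (fun y => f y * g y) (f x * b + g x * a).
Proof. exact: is_deriveM. Qed.

Lemma der_exp f n x a : has_deriv x f a ->
  has_deriv x (fun y => f y ^+ n) (n%:R * f x ^+ n.-1 * a).
Proof.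
move=> h; have := @is_deriveX R R f n x 1 a h; rewrite /has_deriv.
by congr (is_derive _ _ _ _); apply/funext => y; rewrite exprfctE.
Qed.

Lemma der_comp f g x a b : has_deriv (g x) f a -> has_deriv x g b ->
  has_deriv x (fun y => f (g y)) (a * b).
Proof. exact: is_derive1_comp. Qed.

End pointwise_derivatives.

Ltac pderive := repeat first
  [ exact: der_id | exact: der_cst | exact: is_derive_sin | exact: is_derive_cos
  | exact: is_derive_expR
  | apply: der_add | apply: der_opp | apply: der_exp | apply: der_mul
  | apply: (@der_comp _ sin) | apply: (@der_comp _ cos) | apply: (@der_comp _ expR) ].

(** * Taylor bounds for sine, cosine and sinc *)

Section trig_bounds.
Variable R : realType.
Implicit Types x t : R.

(** Applied repeatedly from cos <= 1 on, this produces the alternating Taylor bounds one degree at a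
    time. *)
Lemma ge0_from_derive (f df : R -> R) : (forall x, has_deriv x f (df x)) ->
  f 0 = 0 -> (forall x, 0 <= x -> 0 <= df x) -> forall x, 0 <= x -> 0 <= f x.
Proof.
move=> fdf f0 df0 x x0.
have cf : {within `[0, x], continuous f}.
  by apply: derivable_within_continuous => y _; have := fdf y; case.
have [y] := @MVT_segment R f df 0 x x0 (fun y _ => fdf y) cf.
rewrite in_itv /= => /andP[y0 _]; rewrite f0 !subr0 => ->.
by rewrite mulr_ge0// df0.
Qed.

Lemma sin_le_id x : 0 <= x -> sin x <= x.
Proof.
move=> x0; rewrite -subr_ge0.
apply: (@ge0_from_derive (fun x => x - sin x) (fun x => 1 - cos x)) => //.
- by move=> y; apply: der_eq; [pderive|].
- by rewrite sin0 subr0.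
Qed.

Lemma cos_ge_quad x : 0 <= x -> 1 - x ^+ 2 / 2 <= cos x.
Proof.
move=> x0; rewrite -subr_ge0.
apply: (@ge0_from_derive (fun x => cos x - (1 - x ^+ 2 / 2)) (fun x => x - sin x)) => //.
- by move=> y; apply: der_eq; [pderive|rewrite /=; field].
- by rewrite cos0; field.
by move=> y y0; rewrite subr_ge0 sin_le_id.
Qed.

Lemma sin_ge_cubic x : 0 <= x -> x - x ^+ 3 / 6 <= sin x.
Proof.
move=> x0; rewrite -subr_ge0.
apply: (@ge0_from_derive (fun x => sin x - (x - x ^+ 3 / 6))
  (fun x => cos x - (1 - x ^+ 2 / 2))) => //.
- by move=> y; apply: der_eq; [pderive|rewrite /=; field].
- by rewrite sin0; field.
by move=> y y0; rewrite subr_ge0 cos_ge_quad.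
Qed.

Lemma cos_le_quart x : 0 <= x -> cos x <= 1 - x ^+ 2 / 2 + x ^+ 4 / 24.
Proof.
move=> x0; rewrite -subr_ge0.
apply: (@ge0_from_derive (fun x => 1 - x ^+ 2 / 2 + x ^+ 4 / 24 - cos x)
  (fun x => sin x - (x - x ^+ 3 / 6))) => //.
- by move=> y; apply: der_eq; [pderive|rewrite /=; field].
- by rewrite cos0; field.
by move=> y y0; rewrite subr_ge0 sin_ge_cubic.
Qed.

Lemma sin_le_quint x : 0 <= x -> sin x <= x - x ^+ 3 / 6 + x ^+ 5 / 120.
Proof.
move=> x0; rewrite -subr_ge0.
apply: (@ge0_from_derive (fun x => x - x ^+ 3 / 6 + x ^+ 5 / 120 - sin x)
  (fun x => 1 - x ^+ 2 / 2 + x ^+ 4 / 24 - cos x)) => //.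
- by move=> y; apply: der_eq; [pderive|rewrite /=; field].
- by rewrite sin0; field.
by move=> y y0; rewrite subr_ge0 cos_le_quart.
Qed.

Lemma cos_approx x : `|cos x - (1 - x ^+ 2 / 2)| <= x ^+ 4.
Proof.
wlog x0 : x / 0 <= x.
  move=> h; have [|/ltW x0] := leP 0 x; first exact: h.
  have e4 : (- x) ^+ 4 = x ^+ 4 by ring.
  by have := h (- x); rewrite cosN sqrrN e4 oppr_ge0; apply.
have h1 := cos_ge_quad x0; have h2 := cos_le_quart x0.
have : 0 <= x ^+ 4 by rewrite exprn_even_ge0.
by move=> h; rewrite ler_norml; apply/andP; split; lra.
Qed.

Lemma sin_approx x : `|sin x - x| <= `|x| ^+ 3.
Proof.
wlog x0 : x / 0 <= x.
  move=> h; have [|/ltW x0] := leP 0 x; first exact: h.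
  by have := h (- x); rewrite sinN normrN -opprD normrN oppr_ge0; apply.
have h1 := sin_ge_cubic x0; have h2 := sin_le_id x0.
rewrite (ger0_norm x0).
have : 0 <= x ^+ 3 by rewrite exprn_ge0.
by move=> h; rewrite ler_norml; apply/andP; split; lra.
Qed.

Definition sinc x : R := if x == 0 then 1 else sin (x / 2) / (x / 2).

Lemma sinc0 : sinc 0 = 1. Proof. by rewrite /sinc eqxx. Qed.

Lemma sincM x : sin (x / 2) = sinc x * (x / 2).
Proof.
rewrite /sinc; case: eqVneq => [->|x0]; first by rewrite !mul0r sin0 mulr0.
by rewrite divfK// mulf_neq0// invr_neq0.
Qed.

Lemma sincN x : sinc (- x) = sinc x.
Proof.
by rewrite /sinc oppr_eq0; case: eqP => // _; rewrite mulNr sinN invrN mulrNN.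
Qed.

(** Taylor bounds of sine at x/2, divided by x/2: 24 = 4 * 6 and 1920 = 16 * 120. *)
Lemma sinc_approx x : 1 - x ^+ 2 / 24 <= sinc x <= 1 - x ^+ 2 / 24 + x ^+ 4 / 1920.
Proof.
wlog x0 : x / 0 <= x.
  move=> h; have [|/ltW x0] := leP 0 x; first exact: h.
  have e4 : (- x) ^+ 4 = x ^+ 4 by ring.
  by have := h (- x); rewrite sincN sqrrN e4 oppr_ge0; apply.
move: x0; rewrite le_eqVlt => /predU1P[<-|x0].
  by rewrite sinc0 !expr0n /= !mul0r subr0 addr0 lexx.
have u0 : 0 < x / 2 by rewrite divr_gt0.
rewrite /sinc gt_eqF// ler_pdivlMr// ler_pdivrMr//.
have := sin_ge_cubic (ltW u0); have := sin_le_quint (ltW u0).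
have -> : (1 - x ^+ 2 / 24) * (x / 2) = x / 2 - (x / 2) ^+ 3 / 6 by field.
have -> : (1 - x ^+ 2 / 24 + x ^+ 4 / 1920) * (x / 2) =
  x / 2 - (x / 2) ^+ 3 / 6 + (x / 2) ^+ 5 / 120 by field.
by move=> -> ->.
Qed.

Lemma sinc_exp_bounds x : `|x| <= 1 ->
  expR (- (x ^+ 2 / 24) - x ^+ 4) <= sinc x <= expR (- (x ^+ 2 / 24) + x ^+ 4).
Proof.
move=> x1; have /andP[lo hi] := sinc_approx x.
have x2 : x ^+ 2 <= 1 by rewrite -[x ^+ 2]real_normK ?num_real// expr_le1.
have x20 := sqr_ge0 x.
have x4 : x ^+ 4 = (x ^+ 2) ^+ 2 by rewrite -exprM.
apply/andP; split.
  apply: le_trans lo.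
  (* With y = x^2/24 + x^4, e^(-y) <= 1/(1 + y), and (1 - x^2/24)(1 + y) >= 1 because x^4 outweighs
     the square of x^2/24. *)
  rewrite -opprD expRN -[leRHS]invrK lef_pV2 ?posrE ?expR_gt0 ?invr_gt0//; last by lra.
  apply: (@le_trans _ _ (1 + (x ^+ 2 / 24 + x ^+ 4))); last exact: expR_ge1Dx.
  rewrite -div1r ler_pdivrMr; last by lra.
  by rewrite x4; move: (x ^+ 2) x2 x20 => y *; nra.
apply: le_trans hi _; apply: le_trans (expR_ge1Dx _).
have : 0 <= x ^+ 4 by rewrite x4 sqr_ge0.
by move=> h; lra.
Qed.

Lemma sinc_gt0_small x : `|x| <= 1 -> 0 < sinc x.
Proof. by move=> /sinc_exp_bounds/andP[+ _]; apply: lt_le_trans; exact: expR_gt0. Qed.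

Lemma sinc_le1 x : sinc x <= 1.
Proof.
wlog x0 : x / 0 <= x.
  move=> h; have [|/ltW x0] := leP 0 x; first exact: h.
  by have := h (- x); rewrite sincN oppr_ge0; apply.
move: x0; rewrite le_eqVlt => /predU1P[<-|x0]; first by rewrite sinc0.
have u0 : 0 < x / 2 by rewrite divr_gt0.
by rewrite /sinc gt_eqF// ler_pdivrMr// mul1r sin_le_id// ltW.
Qed.

Lemma sinc_continuous : continuous sinc.
Proof.
move=> x; have [->|x0] := eqVneq x 0.
  rewrite /continuous_at sinc0; apply/cvgrPdist_le => e e0; near=> y.
  have /andP[lo hi] := sinc_approx y.
  have ye : `|y| <= e by near: y; exact: cvgr0_norm_le.
  have y1 : `|y| <= 1 by near: y; exact: cvgr0_norm_le.
  have y2 : y ^+ 2 <= e.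
    rewrite -[y ^+ 2]real_normK ?num_real// expr2 (le_trans _ ye)//.
    by rewrite ler_piMr.
  rewrite ger0_norm ?subr_ge0 ?sinc_le1//.
  have := sqr_ge0 y; lra.
have lin : (fun y : R => y / 2) y @[y --> x] --> x / 2.
  by apply: cvgM; [exact: cvg_id|exact: cvg_cst].
have h : (fun y : R => sin (y / 2) / (y / 2)) y @[y --> x] --> sin (x / 2) / (x / 2).
  apply: cvgM; last by apply: cvgV; rewrite ?mulf_neq0 ?invr_neq0.
  by apply: continuous_cvg lin; exact: continuous_sin.
rewrite /continuous_at.
have -> : sinc x = sin (x / 2) / (x / 2) by rewrite /sinc (negbTE x0).
apply: cvg_trans h; apply: near_eq_cvg; near=> y.
rewrite /sinc ifF//; apply/negbTE; near: y.
exact: (@cvgr_neq0 _ _ _ (nbhs x) _ id x).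
Unshelve. all: by end_near. Qed.

End trig_bounds.

(** * Mean and variance of maj *)

Section maj_moments.
Variable R : realType.

Definition maj_avg (lam : intpart) (f : R -> R) : R :=
  (\sum_(T : SYT lam) f (maj T)%:R) / #|{: SYT lam}|%:R.

Lemma card_SYT_neq0 lam : #|{: SYT lam}|%:R != 0 :> R.
Proof. by rewrite pnatr_eq0 -lt0n card_SYT_gt0. Qed.

Lemma maj_avg_cst lam c : maj_avg lam (fun=> c) = c.
Proof. by rewrite /maj_avg sumr_const -[c *+ _]mulr_natr mulfK// card_SYT_neq0. Qed.

Lemma maj_avgD lam f g : maj_avg lam (fun x => f x + g x) = maj_avg lam f + maj_avg lam g.
Proof. by rewrite /maj_avg big_split mulrDl. Qed.

Lemma maj_avgZ lam c f : maj_avg lam (fun x => c * f x) = c * maj_avg lam f.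
Proof. by rewrite /maj_avg -mulr_sumr mulrA. Qed.

Lemma le_maj_avg lam f g : (forall x, f x <= g x) -> maj_avg lam f <= maj_avg lam g.
Proof.
by move=> fg; rewrite ler_pM2r ?invr_gt0 ?ltr0n ?card_SYT_gt0//; exact: ler_sum.
Qed.

Lemma ler_norm_maj_avg lam f g : (forall x, `|f x| <= g x) -> `|maj_avg lam f| <= maj_avg lam g.
Proof.
move=> fg; rewrite ler_norml -mulN1r -maj_avgZ; apply/andP; split; apply: le_maj_avg => x.
  by rewrite mulN1r lerNl (le_trans (ler_norm _))// normrN.
exact: le_trans (ler_norm _) (fg x).
Qed.

Lemma prod_sin_half (s : seq nat) (t : R) :
  \prod_(h <- s) sin (h%:R * t / 2) =
  \prod_(h <- s) sinc (h%:R * t) * \prod_(h <- s) h%:R * (t / 2) ^+ size s.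
Proof.
elim: s => [|h s IH]; first by rewrite !big_nil expr0 !mulr1.
by rewrite !big_cons IH sincM /= exprS; ring.
Qed.

Section split.
Variables (lam : intpart) (D Re Mi : seq nat).
Hypothesis pR : perm_eq (hooks lam) (D ++ Re).
Hypothesis pM : perm_eq (iota 1 (sumn lam)) (D ++ Mi).
Hypothesis sRM : size Re = size Mi.
Local Notation c := (maj_center R lam Re Mi).

Lemma mem_Re h : h \in Re -> (0 < h <= sumn lam)%N.
Proof.
move=> hR; have /andP[_ n0] := intpartP lam; apply: mem_hooks => //.
by rewrite (perm_mem pR) mem_cat hR orbT.
Qed.

Lemma mem_Mi j : j \in Mi -> (0 < j <= sumn lam)%N.
Proof.
move=> jM; have : j \in iota 1 (sumn lam) by rewrite (perm_mem pM) mem_cat jM orbT.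
by rewrite mem_iota add1n ltnS.
Qed.

Lemma prod_Re_neq0 : \prod_(h <- Re) h%:R != 0 :> R.
Proof.
rewrite prodf_seq_neq0; apply/allP => h /mem_Re /andP[h0 _].
by rewrite pnatr_eq0 -lt0n.
Qed.

Lemma maj_avg_cos t :
  maj_avg lam (fun x => cos ((x - c) * t)) * \prod_(h <- Re) sinc (h%:R * t) =
  \prod_(j <- Mi) sinc (j%:R * t).
Proof.
(* The powers of t/2 on both sides can be cancelled only for t nonzero. *)
have [->|t0] := eqVneq t 0.
  rewrite /maj_avg (eq_bigr (fun _ : SYT lam => 1)) => [|T _]; last by rewrite /= mulr0 cos0.
  rewrite sumr_const divff ?card_SYT_neq0// mul1r.
  by rewrite !big1_seq// => h _; rewrite mulr0 sinc0.
have [+ _] := maj_trig_identity t pR pM sRM.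
rewrite !prod_sin_half sRM -(card_SYT_hooks R pR pM sRM) => e.
have nz : #|{: SYT lam}|%:R * \prod_(h <- Re) h%:R * (t / 2) ^+ size Mi != 0 :> R.
  apply: mulf_neq0; first by rewrite mulf_neq0 ?card_SYT_neq0 ?prod_Re_neq0.
  by rewrite expf_neq0// mulf_neq0// invr_neq0.
apply: (mulIf nz); rewrite /maj_avg.
transitivity ((\sum_(T : SYT lam) cos (((maj T)%:R - c) * t)) *
   (\prod_(h <- Re) sinc (h%:R * t) * \prod_(h <- Re) h%:R * (t / 2) ^+ size Mi)).
  by field; rewrite card_SYT_neq0.
by rewrite e; ring.
Qed.

Lemma maj_avg_sin t : 
  maj_avg lam (fun x => sin ((x - c) * t)) * \prod_(h <- Re) sinc (h%:R * t) = 0.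
Proof.
have [->|t0] := eqVneq t 0.
  rewrite /maj_avg (eq_bigr (fun _ : SYT lam => 0)) => [|T _]; last by rewrite /= mulr0 sin0.
  by rewrite sumr_const mul0rn !mul0r.
have [_] := maj_trig_identity t pR pM sRM.
rewrite prod_sin_half => e.
have nz : \prod_(h <- Re) h%:R * (t / 2) ^+ size Re != 0 :> R.
  by apply: mulf_neq0; [exact: prod_Re_neq0|rewrite expf_neq0// mulf_neq0// invr_neq0].
apply: (mulIf nz); rewrite mul0r /maj_avg.
have E (S n P H K : R) : S / n * P * (H * K) = S * (P * H * K) / n by ring.
by rewrite E e mul0r.
Qed.

Lemma prod_sinc_gt0 (s : seq nat) (t : R) :
  {in s, forall h, `|h%:R * t| <= 1} -> 0 < \prod_(h <- s) sinc (h%:R * t).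
Proof.
move=> hs; rewrite big_seq; apply: prodr_gt0 => h /hs; exact: sinc_gt0_small.
Qed.

(** For these t no factor sinc(h t) vanishes, so the identities can be divided by the product over
    [Re]. *)
Lemma small_Re (t : R) : 0 <= t -> t <= (sumn lam).+1%:R^-1 ->
  {in Re, forall h, `|h%:R * t| <= 1}.
Proof.
move=> t0 ts h /mem_Re /andP[_ hn].
rewrite ger0_norm ?mulr_ge0//.
apply: (@le_trans _ _ (h%:R * (sumn lam).+1%:R^-1)); first by rewrite ler_wpM2l.
by rewrite ler_pdivrMr ?ltr0Sn// mul1r ler_nat leqW.
Qed.

Lemma small_power_eq0 (a C d : R) n : 0 < d -> 
  (forall t, 0 < t <= d -> `|a| * t ^+ n <= C * t ^+ n.+1) -> a = 0.
Proof.
move=> d0 h; apply/eqP; rewrite -normr_eq0; apply/eqP/le_anti.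
rewrite normr_ge0 andbT leNgt; apply/negP => a0.
(* Small enough for C t < |a|, against the hypothesis divided by t^n. *)
pose t := Num.min d (`|a| / (2 * (`|C| + 1))).
have C0 : 0 < 2 * (`|C| + 1) by rewrite mulr_gt0// ltr_wpDl.
have t0 : 0 < t by rewrite lt_min d0 divr_gt0.
have := h t; rewrite t0 ge_min lexx => /(_ isT).
rewrite exprSr [t ^+ n * t]mulrC mulrA ler_pM2r ?exprn_gt0// leNgt => /negP; apply.
apply: (@le_lt_trans _ _ (`|C| * t)); first by rewrite ler_wpM2r ?ler_norm// ltW.
apply: (@le_lt_trans _ _ (`|C| * (`|a| / (2 * (`|C| + 1))))).
  by rewrite ler_wpM2l// ge_min lexx orbT.
rewrite mulrA ltr_pdivrMr// mulrC ltr_pM2l//.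
by have := normr_ge0 C; lra.
Qed.

Let d : R := (sumn lam).+1%:R^-1.

Let d_gt0 : 0 < d. Proof. by rewrite invr_gt0 ltr0Sn. Qed.

Let d_le1 : d <= 1. Proof. by rewrite invf_le1 ?ltr0Sn// ler1n. Qed.

(** For small t the average of sin((maj - c) t) is 0. As sin x = x + O(x^3), t times the average of
    maj - c is O(t^3), so that average is 0. *)
Lemma maj_mean : maj_avg lam id = c.
Proof.
have aE : maj_avg lam id - c = maj_avg lam (fun x => x - c).
  rewrite -[in LHS](maj_avg_cst lam c) -mulN1r -maj_avgZ -maj_avgD.
  by congr maj_avg; apply/funext => x; rewrite mulN1r.
apply/eqP; rewrite -subr_eq0 aE; apply/eqP.
apply: (@small_power_eq0 _ (maj_avg lam (fun x => `|x - c| ^+ 3)) d 1) => // t /andP[t0 td].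
have s0 : maj_avg lam (fun x => sin ((x - c) * t)) = 0.
  have := maj_avg_sin t => /eqP; rewrite mulf_eq0 [X in _ || X]gt_eqF ?orbF => [/eqP //|].
  by apply: prod_sinc_gt0; apply: small_Re => //; exact: ltW.
have -> : `|maj_avg lam (fun x => x - c)| * t ^+ 1 =
   `|maj_avg lam (fun x => (x - c) * t - sin ((x - c) * t))|.
  have -> : maj_avg lam (fun x => (x - c) * t - sin ((x - c) * t)) =
      t * maj_avg lam (fun x => x - c) + (-1) * maj_avg lam (fun x => sin ((x - c) * t)).
    rewrite -!maj_avgZ -maj_avgD; congr maj_avg; apply/funext => x; ring.
  by rewrite s0 mulr0 addr0 [RHS]normrM (gtr0_norm t0) mulrC expr1.
apply: (@le_trans _ _ (maj_avg lam (fun x => t ^+ 3 * `|x - c| ^+ 3))).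
  apply: ler_norm_maj_avg => x; rewrite distrC (le_trans (sin_approx _))//.
  by rewrite normrM exprMn mulrC (gtr0_norm t0).
rewrite maj_avgZ mulrC ler_wpM2l//.
  by rewrite -(maj_avg_cst lam 0) le_maj_avg// => x; rewrite exprn_ge0.
by apply: ler_wiXn2l => //; [exact: ltW|exact: le_trans td d_le1].
Qed.

(** Second-order expansions at 0 without derivatives: they multiply, and they determine a. *)
Definition quadratic_at0 (f : R -> R) (a : R) := exists C, forall t, 0 < t <= d ->
  `|f t - (1 - a * t ^+ 2)| <= C * t ^+ 3.

Lemma quadratic_at0M f g a b : quadratic_at0 f a -> quadratic_at0 g b ->
  quadratic_at0 (fun t => f t * g t) (a + b).
Proof.
move=> [C hf] [E hg].
exists ((1 + `|a| + `|C|) * `|E| + `|C| * (1 + `|b|) + `|a| * `|b|) => t /[dup] tt /andP[t0 td].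
have t1 : t <= 1 by exact: le_trans td d_le1.
have -> : f t * g t - (1 - (a + b) * t ^+ 2) = f t * (g t - (1 - b * t ^+ 2)) +
    (f t - (1 - a * t ^+ 2)) * (1 - b * t ^+ 2) + a * b * t ^+ 4 by ring.
have P (x : R) : `|x| <= C * t ^+ 3 -> `|x| <= `|C| * t ^+ 3.
  by move/le_trans; apply; rewrite ler_wpM2r ?ler_norm// exprn_ge0// ltW.
have Q (x : R) : `|x| <= E * t ^+ 3 -> `|x| <= `|E| * t ^+ 3.
  by move/le_trans; apply; rewrite ler_wpM2r ?ler_norm// exprn_ge0// ltW.
have {}hf := P _ (hf t tt); have {}hg := Q _ (hg t tt).
have tn k : t ^+ k <= 1 by rewrite exprn_ile1// ltW.
have tn0 k : 0 <= t ^+ k by rewrite exprn_ge0// ltW.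
have lin (e : R) : `|1 - e * t ^+ 2| <= 1 + `|e|.
  rewrite (le_trans (ler_normB _ _))// normr1 lerD2l normrM (ger0_norm (tn0 _)).
  by rewrite ler_piMr.
have ft : `|f t| <= 1 + `|a| + `|C|.
  have -> : f t = (f t - (1 - a * t ^+ 2)) + (1 - a * t ^+ 2) by ring.
  rewrite (le_trans (ler_normD _ _))// addrC lerD// (le_trans hf)//.
  by rewrite ler_piMr.
rewrite (le_trans (ler_normD _ _))// [leRHS]mulrDl lerD//; last first.
  rewrite 2!normrM (ger0_norm (tn0 _)) ler_wpM2l ?mulr_ge0//.
  by rewrite ler_wiXn2l// ltW.
rewrite (le_trans (ler_normD _ _))// [leRHS]mulrDl lerD//.
  by rewrite normrM -mulrA ler_pM.
by rewrite normrM mulrAC ler_pM// ?mulr_ge0.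
Qed.

Lemma quadratic_at0_sinc (s : seq nat) : quadratic_at0
  (fun t => \prod_(h <- s) sinc (h%:R * t)) ((\sum_(h <- s) h%:R ^+ 2) / 24).
Proof.
elim: s => [|h s IH].
  by exists 0 => t _; rewrite !big_nil !mul0r subr0 subrr normr0.
have H : quadratic_at0 (fun t => sinc (h%:R * t)) (h%:R ^+ 2 / 24).
  exists (h%:R ^+ 4) => t /andP[t0 td].
  have /andP[lo hi] := sinc_approx (h%:R * t).
  have e4 : (h%:R * t) ^+ 4 <= h%:R ^+ 4 * t ^+ 3.
    rewrite exprMn ler_wpM2l ?exprn_ge0// ler_wiXn2l//; first exact: ltW.
    exact: le_trans td d_le1.
  have p4 : 0 <= (h%:R * t) ^+ 4 by rewrite exprn_even_ge0.
  rewrite (_ : h%:R ^+ 2 / 24 * t ^+ 2 = (h%:R * t) ^+ 2 / 24); last by field.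
  by rewrite ler_norml; apply/andP; split; lra.
have := quadratic_at0M H IH.
rewrite -mulrDl -[_ + _](big_cons _ _ _ _ xpredT).
by congr quadratic_at0; apply/funext => t; rewrite big_cons.
Qed.

Lemma quadratic_at0_unique f a b : quadratic_at0 f a -> quadratic_at0 f b -> a = b.
Proof.
move=> [C hC] [E hE]; apply/eqP; rewrite -subr_eq0; apply/eqP.
apply: (@small_power_eq0 _ (C + E) d 2) => // t /[dup] tt /andP[t0 td].
have -> : `|a - b| * t ^+ 2 = `|(a - b) * t ^+ 2|.
  by rewrite normrM (ger0_norm (exprn_ge0 _ (ltW t0))).
rewrite [leRHS]mulrDl.
rewrite (le_trans _ (lerD (hC t tt) (hE t tt)))//.
rewrite (_ : (a - b) * _ = (f t - (1 - b * t ^+ 2)) * -1 + (f t - (1 - a * t ^+ 2))); last by ring.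
by rewrite (le_trans (ler_normD _ _))// mulrN1 normrN addrC.
Qed.

(** Compare the coefficients of t^2 in [maj_avg_cos]: v/2 + A/24 = B/24, with A and B the sums of
    squares over [Re] and [Mi]. *)
Lemma maj_variance : maj_avg lam (fun x => (x - c) ^+ 2) = sq_excess R Re Mi / 12.
Proof.
have Q1 : quadratic_at0 (fun t => maj_avg lam (fun x => cos ((x - c) * t)))
    (maj_avg lam (fun x => (x - c) ^+ 2) / 2).
  exists (maj_avg lam (fun x => (x - c) ^+ 4)) => t /andP[t0 td].
  have -> : maj_avg lam (fun x => cos ((x - c) * t)) -
      (1 - maj_avg lam (fun x => (x - c) ^+ 2) / 2 * t ^+ 2) =
      maj_avg lam (fun x => cos ((x - c) * t) - (1 - ((x - c) * t) ^+ 2 / 2)).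
    rewrite (_ : (fun x => cos ((x - c) * t) - (1 - ((x - c) * t) ^+ 2 / 2)) =
      (fun x => cos ((x - c) * t) + (-1 + (t ^+ 2 / 2) * (x - c) ^+ 2))); last first.
      by apply/funext => x; field.
    by rewrite !maj_avgD maj_avgZ maj_avg_cst; field.
  apply: (@le_trans _ _ (maj_avg lam (fun x => t ^+ 4 * (x - c) ^+ 4))).
    apply: ler_norm_maj_avg => x; rewrite (le_trans (cos_approx _))//.
    by rewrite exprMn mulrC.
  rewrite maj_avgZ mulrC ler_wpM2l//.
    by rewrite -(maj_avg_cst lam 0) le_maj_avg// => x; rewrite exprn_even_ge0.
  by apply: ler_wiXn2l => //; [exact: ltW|exact: le_trans td d_le1].
have := quadratic_at0M Q1 (quadratic_at0_sinc Re).
under eq_fun do rewrite maj_avg_cos.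
move=> /quadratic_at0_unique /(_ (quadratic_at0_sinc Mi)) e.
rewrite /sq_excess; move: e; set v := maj_avg _ _; set A := \sum_(h <- Re) _; set B := \sum_(j <- Mi) _.
by move=> e; lra.
Qed.

End split.
End maj_moments.

(** * Convergence in distribution from cosine integrals *)

Section bounded_integrals.
Context d (T : measurableType d) (R : realType).
Implicit Types (mu : probability T R) (f g : T -> R).

Definition bounded_mfun f :=
  measurable_fun setT f /\ exists M, forall x, `|f x| <= M.

Lemma bounded_mfun_cst c : bounded_mfun (fun=> c).
Proof. by split; [exact: measurable_cst|exists `|c|]. Qed.

Lemma bounded_mfunD f g : bounded_mfun f -> bounded_mfun g ->
  bounded_mfun (fun x => f x + g x).
Proof.
move=> [mf [M fM]] [mg [N gN]]; split; first exact: measurable_funD.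
by exists (M + N) => x; rewrite (le_trans (ler_normD _ _))// lerD.
Qed.

Lemma bounded_mfunM f g : bounded_mfun f -> bounded_mfun g ->
  bounded_mfun (fun x => f x * g x).
Proof.
move=> [mf [M fM]] [mg [N gN]]; split; first exact: measurable_funM.
by exists (M * N) => x; rewrite normrM ler_pM.
Qed.

Lemma bounded_mfun_indic (A : set T) : measurable A -> bounded_mfun (\1_A : T -> R).
Proof.
move=> mA; split; first exact: measurable_indic.
by exists 1 => x; rewrite indicE; case: (_ \in _); rewrite ?normr1 ?normr0.
Qed.

Lemma bounded_integrable mu f : bounded_mfun f -> mu.-integrable setT (EFin \o f).
Proof.
move=> [mf [M fM]]; apply: (measurable_bounded_integrable measurableT _ mf).
  by rewrite (le_lt_trans (probability_le1 _ _))// ltry.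
by exists M; split; rewrite ?num_real// => y My x _; exact: le_trans (fM x) (ltW My).
Qed.

Lemma integral_boundedD mu f g : bounded_mfun f -> bounded_mfun g ->
  \int[mu]_x (f x + g x) = \int[mu]_x f x + \int[mu]_x g x.
Proof. by move=> hf hg; rewrite RintegralD//; exact: bounded_integrable. Qed.

Lemma integral_boundedZ mu c f : bounded_mfun f ->
  \int[mu]_x (c * f x) = c * \int[mu]_x f x.
Proof. by move=> hf; rewrite RintegralZl//; exact: bounded_integrable. Qed.

Lemma le_integral_bounded mu f g : bounded_mfun f -> bounded_mfun g ->
  (forall x, f x <= g x) -> \int[mu]_x f x <= \int[mu]_x g x.
Proof. by move=> hf hg fg; apply: le_Rintegral => //; exact: bounded_integrable. Qed.

Lemma integral_bounded_cst mu c : \int[mu]_x (fun=> c) x = c.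
Proof. rewrite Rintegral_cst//; have e : mu setT = 1%E by exact: probability_setT.
by rewrite [X in fine X](_ : _ = 1%E) ?mulr1//.
Qed.

Lemma integral_bounded_indic mu (A : set T) : measurable A ->
  \int[mu]_x \1_A x = fine (mu A).
Proof. by move=> mA; rewrite /Rintegral integral_indic// setIT. Qed.

End bounded_integrals.

(** * Trigonometric polynomials close to a step *)

Section trig_polynomials.
Variable R : realType.
Implicit Types (f g : R -> R).

Inductive trig_poly : (R -> R) -> Prop :=
| trig_poly_cos a b : trig_poly (fun x => cos (a * x + b))
| trig_polyD f g : trig_poly f -> trig_poly g -> trig_poly (fun x => f x + g x)
| trig_polyZ c f : trig_poly f -> trig_poly (fun x => c * f x).

Lemma trig_poly_cst c : trig_poly (fun=> c).
Proof.
have := trig_polyZ c (trig_poly_cos 0 0).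
by congr trig_poly; apply/funext => x; rewrite mul0r addr0 cos0 mulr1.
Qed.

Lemma trig_polyM f g : trig_poly f -> trig_poly g -> trig_poly (fun x => f x * g x).
Proof.
move=> hf hg; elim: hf => [a b|f1 f2 _ h1 _ h2|c f1 _ h1].
- elim: hg => [a' b'|g1 g2 _ h1 _ h2|c g1 _ h1].
  + have := trig_polyD (trig_polyZ 2^-1 (trig_poly_cos (a + a') (b + b')))
      (trig_polyZ 2^-1 (trig_poly_cos (a - a') (b - b'))).
    congr trig_poly; apply/funext => x.
    have -> : (a + a') * x + (b + b') = (a * x + b) + (a' * x + b') by ring.
    have -> : (a - a') * x + (b - b') = (a * x + b) - (a' * x + b') by ring.
    by rewrite cosD cosB; field.
  + have := trig_polyD h1 h2.
    by congr trig_poly; apply/funext => x; rewrite mulrDr.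
  + have := trig_polyZ c h1.
    by congr trig_poly; apply/funext => x; rewrite mulrCA.
- have := trig_polyD h1 h2.
  by congr trig_poly; apply/funext => x; rewrite mulrDl.
- have := trig_polyZ c h1.
  by congr trig_poly; apply/funext => x; rewrite mulrA.
Qed.

Lemma trig_polyX f n : trig_poly f -> trig_poly (fun x => f x ^+ n).
Proof.
move=> hf; elim: n => [|n IH]; first exact: (trig_poly_cst 1).
by under eq_fun do rewrite exprS; exact: trig_polyM.
Qed.

Lemma bounded_mfun_cos (a b : R) : bounded_mfun (fun x : R => cos (a * x + b)).
Proof.
split; last by exists 1 => x; exact: cos_max.
apply: continuous_measurable_fun => x.
have lin : (fun y : R => a * y + b) y @[y --> (x : R)] --> a * x + b.
  by apply: cvgD; [apply: cvgM; [exact: cvg_cst|exact: cvg_id]|exact: cvg_cst].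
by apply: continuous_cvg lin; exact: continuous_cos.
Qed.

Lemma bounded_mfun_trig f : trig_poly f -> bounded_mfun f.
Proof.
elim=> [a b|g h _ bg _ bh|c g _ bg]; first exact: bounded_mfun_cos.
  exact: bounded_mfunD.
by apply: bounded_mfunM => //; exact: bounded_mfun_cst.
Qed.

(** Bernoulli's inequality (1 - v)^k >= 1 - k v with v = u^n and k = 2^n. *)
Lemma step_lower (u : R) n : 0 <= u <= 1 -> 1 - (2 * u) ^+ n <= (1 - u ^+ n) ^+ (2 ^ n).
Proof.
move=> /andP[u0 u1]; have v1 : u ^+ n <= 1 by rewrite exprn_ile1.
have v0 : 0 <= u ^+ n by rewrite exprn_ge0.
rewrite exprMn -natrX; move: (u ^+ n) v0 v1 (2 ^ n)%N => v v0 v1.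
elim=> [|k IH]; first by rewrite mul0r subr0 expr0.
rewrite exprS -natr1.
have := ler_wpM2l (_ : 0 <= 1 - v) IH; rewrite subr_ge0 => /(_ v1); apply: le_trans.
have : 0 <= k%:R * v * v by rewrite !mulr_ge0.
by move=> h; nra.
Qed.

(** With v = u^n and k = 2^n, combine (1 - v)^k (1 + v)^k <= 1 with (1 + v)^k >= 1 + k v >= k v. *)
Lemma step_upper (u : R) n : 0 < u <= 1 -> (1 - u ^+ n) ^+ (2 ^ n) <= ((2 * u) ^+ n)^-1.
Proof.
move=> /andP[u0 u1]; have v1 : u ^+ n <= 1 by rewrite exprn_ile1// ltW.
have v0 : 0 < u ^+ n by rewrite exprn_gt0.
rewrite exprMn -natrX; move: (u ^+ n) v0 v1 => v v0 v1.
have k0 : (0 < 2 ^ n)%N by rewrite expn_gt0.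
move: (2 ^ n)%N k0 => k k0.
rewrite -div1r ler_pdivlMr ?mulr_gt0 ?ltr0n//.
have bern : 1 + k%:R * v <= (1 + v) ^+ k.
  elim: k {k0} => [|k IH]; first by rewrite mul0r addr0 expr0.
  rewrite exprS -natr1.
  have := ler_wpM2l (_ : 0 <= 1 + v) IH; rewrite addr_ge0 ?(ltW v0)// => /(_ isT); apply: le_trans.
  have : 0 <= k%:R * v * v by rewrite !mulr_ge0// ltW.
  by move=> h; nra.
apply: (@le_trans _ _ ((1 - v) ^+ k * (1 + v) ^+ k)).
  rewrite ler_wpM2l ?exprn_ge0 ?subr_ge0// (le_trans _ bern)// lerDr//.
rewrite -exprMn exprn_ile1//.
  by rewrite mulr_ge0 ?subr_ge0// addr_ge0// ltW.
have vv : 0 <= v * v by rewrite mulr_ge0// ltW.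
by nra.
Qed.

(* With u = (1 + sin (w (x - x0))) / 2, the polynomial (1 - u^n)^(2^n) in u tends
   to 1 for u < 1/2 and to 0 for u > 1/2. *)
Lemma trig_step (x0 del A e : R) : 0 < del -> 0 < A -> 0 < e ->
  exists p, [/\ trig_poly p, forall x, 0 <= p x <= 1,
    forall x, x0 - A <= x <= x0 - del -> 1 - e <= p x &
    forall x, x0 + del <= x <= x0 + A -> p x <= e].
Proof.
move=> d0 A0 e0.
(* At this frequency w del and w A add up to pi, so sin(w y) >= s > 0 for all y in [del, A]. *)
pose w := pi / (A + del).
have Ad0 : 0 < A + del by rewrite addr_gt0.
have w0 : 0 < w by rewrite divr_gt0// pi_gt0.
have wA : w * A + w * del = pi by rewrite -mulrDr divfK// gt_eqF.
pose s := sin (w * Num.min del A).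
have m0 : 0 < Num.min del A by rewrite lt_min d0 A0.
have sin_ge y : w * Num.min del A <= y -> y <= pi - w * Num.min del A -> s <= sin y.
  move=> y1 y2; have q0 : 0 < w * Num.min del A by rewrite mulr_gt0.
  have qpi : w * Num.min del A <= pi / 2 by lra.
  have [yp|yp] := leP y (pi / 2).
    by rewrite /s leNgt ltr_sin ?in_itv/= -?leNgt//; apply/andP; split; lra.
  have -> : sin y = sin (pi - y) by rewrite sinB sinpi cospi mul0r mulN1r sub0r opprK.
  by rewrite /s leNgt ltr_sin ?in_itv/= -?leNgt//; try (apply/andP; split); lra.
have mdel : w * Num.min del A <= w * del by rewrite (ler_pM2l w0) ge_min lexx.
have mA : w * Num.min del A <= w * A by rewrite (ler_pM2l w0) ge_min lexx orbT.
have s0 : 0 < s by rewrite sin_gt0_pi//; apply/andP; split; [rewrite mulr_gt0|have := pi_gt0 R; lra].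
have s1 : s <= 1 by exact: sin_le1.
pose u x := (1 + sin (w * (x - x0))) / 2.
have u01 x : 0 <= u x <= 1.
  by have := sin_geN1 (w * (x - x0)); have := sin_le1 (w * (x - x0)); rewrite /u => *; apply/andP; split; lra.
have ev (z : R) : `|z| < 1 -> \forall n \near \oo, `|z ^+ n| < e.
  by move=> /cvg_expr /cvgr0Pnorm_lt /(_ _ e0).
have ev1 : \forall n \near \oo, `|(1 - s) ^+ n| < e.
  by apply: ev; rewrite ger0_norm; lra.
have ev2 : \forall n \near \oo, `|((1 + s)^-1) ^+ n| < e.
  apply: ev; rewrite ger0_norm ?invr_ge0; last by lra.
  by rewrite invf_lt1; lra.
near \oo => n.
have hn1 : `|(1 - s) ^+ n| < e by near: n.
have hn2 : `|((1 + s)^-1) ^+ n| < e by near: n.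
exists (fun x => (1 - u x ^+ n) ^+ (2 ^ n)); split.
- apply: trig_polyX; apply: trig_polyD; first exact: trig_poly_cst.
  under eq_fun do rewrite -mulN1r.
  apply: trig_polyZ; apply: trig_polyX.
  have := trig_polyD (trig_poly_cst 2^-1) (trig_polyZ 2^-1 (trig_poly_cos w (- (w * x0) - pi / 2))).
  congr trig_poly; apply/funext => x; rewrite /u.
  have -> : w * x + (- (w * x0) - pi / 2) = w * (x - x0) - pi / 2 by ring.
  by rewrite cosBpihalf; field.
- move=> x; have /andP[h0 h1] := u01 x.
  have v1 : u x ^+ n <= 1 by rewrite exprn_ile1.
  have v0 : 0 <= u x ^+ n by rewrite exprn_ge0.
  by rewrite exprn_ge0 ?subr_ge0//= exprn_ile1 ?subr_ge0// lerBlDr lerDl.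
- move=> x /andP[xl xu]; apply: le_trans (step_lower n (u01 x)).
  have : s <= sin (w * (x0 - x)).
    apply: sin_ge.
      by rewrite (le_trans mdel)// ler_pM2l//; lra.
    have : w * (x0 - x) <= w * A by rewrite ler_pM2l//; lra.
    by lra.
  have -> : w * (x0 - x) = - (w * (x - x0)) by ring.
  rewrite sinN => hs.
  have /andP[h0 h1] := u01 x.
  have : (2 * u x) ^+ n <= (1 - s) ^+ n.
    by rewrite lerXn2r ?nnegrE ?mulr_ge0//; rewrite /u; lra.
  have := ler_norm ((1 - s) ^+ n); lra.
- move=> x /andP[xl xu].
  have hs : s <= sin (w * (x - x0)).
    apply: sin_ge.
      by rewrite (le_trans mdel)// ler_pM2l//; lra.
    have : w * (x - x0) <= w * A by rewrite ler_pM2l//; lra.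
    by lra.
  have /andP[h0 h1] := u01 x.
  have u0 : 0 < u x by rewrite /u; lra.
  apply: (le_trans (@step_upper (u x) n _)); first by rewrite u0.
  apply: (@le_trans _ _ (((1 + s)^-1) ^+ n)); last by have := ler_norm (((1 + s)^-1) ^+ n); lra.
  have u2 : 0 < 2 * u x by rewrite mulr_gt0.
  have s2 : 0 < 1 + s by rewrite addr_gt0.
  rewrite exprVn lef_pV2 ?posrE ?exprn_gt0//.
  by rewrite lerXn2r ?nnegrE ?mulr_ge0//; rewrite /u; lra.
Unshelve. all: end_near. Qed.

End trig_polynomials.

(** * Distribution functions and uniqueness of limits *)

Section distribution_functions.
Variable R : realType.
Implicit Types (mu nu : probability R R) (x y : R).

Definition dist_fun mu x : R := fine (law_cdf mu x).

Lemma measurable_le_set x : measurable [set` `]-oo, x]].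
Proof. exact: measurable_itv. Qed.

Lemma dist_funK mu x : (dist_fun mu x)%:E = law_cdf mu x.
Proof. by rewrite /dist_fun fineK// fin_num_measure. Qed.

Lemma dist_fun_mono mu x y : x <= y -> dist_fun mu x <= dist_fun mu y.
Proof.
move=> xy; rewrite -lee_fin !dist_funK; apply: le_measure; rewrite ?inE//.
by apply: subset_itvl; rewrite bnd_simp.
Qed.

Lemma dist_fun_right mu x e : 0 < e -> exists2 d, 0 < d & dist_fun mu (x + d) <= dist_fun mu x + e.
Proof.
move=> e0; pose F n : set R := [set` `]-oo, x + n.+1%:R^-1]].
have E : \bigcap_n F n = [set` `]-oo, x]].
  apply/seteqP; split => y /=; rewrite in_itv /=.
    move=> h; rewrite leNgt; apply/negP => xy.
    have d0 : 0 < y - x by rewrite subr_gt0.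
    have [n _ hn] := near_infty_natSinv_lt (PosNum d0).
    have := hn n (leqnn _) => /=; have := h n I; rewrite /F /= in_itv /= => h1.
    by rewrite ltrBrDl => /(le_lt_trans h1); rewrite ltxx.
  by move=> yx n _; rewrite /F /= in_itv /= (le_trans yx)// lerDl invr_ge0.
have cF : mu \o F @ \oo --> mu (\bigcap_n F n).
  apply: nonincreasing_cvg_mu; last 2 first.
  - by rewrite E.
  - apply/nonincreasing_seqP => n; apply/subsetPset; apply: subset_itvl.
    by rewrite bnd_simp lerD2l lef_pV2 ?posrE// ler_nat.
  - by rewrite -ge0_fin_numE ?fin_num_measure//; exact: measurable_itv.
  - by move=> n; exact: measurable_itv.
have {}cF : mu \o F @ \oo --> (dist_fun mu x)%:E by rewrite dist_funK /law_cdf -E.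
have /fine_cvgP[_ /cvgrPdist_lt /(_ _ e0)[n _ hn]] := cF.
exists n.+1%:R^-1 => //.
have := hn n (leqnn _); rewrite /= -/(dist_fun mu (x + n.+1%:R^-1)) => h.
have := ler_norm (dist_fun mu (x + n.+1%:R^-1) - dist_fun mu x).
by rewrite distrC; lra.
Qed.

Lemma dist_fun_left mu x e : mu [set x] = 0%E -> 0 < e ->
  exists2 d, 0 < d & dist_fun mu x - e <= dist_fun mu (x - d).
Proof.
move=> x0 e0; pose F n : set R := [set` `]x - n.+1%:R^-1, x]].
have E : \bigcap_n F n = [set x].
  apply/seteqP; split => y /=.
    move=> h; have := h 0%N I; rewrite /F /= in_itv /= => /andP[_ yx].
    apply/eqP; rewrite eq_le yx /= leNgt; apply/negP => xy.
    have d0 : 0 < x - y by rewrite subr_gt0.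
    have [n _ hn] := near_infty_natSinv_lt (PosNum d0).
    have := hn n (leqnn _) => /=; have := h n I; rewrite /F /= in_itv /= => /andP[h1 _].
    by rewrite ltrBrDr -ltrBrDl => /lt_trans => /(_ _ h1); rewrite ltxx.
  by move=> -> n _; rewrite /F /= in_itv /= lexx ltrBlDr ltrDl invr_gt0 ltr0Sn.
have cF : mu \o F @ \oo --> mu (\bigcap_n F n).
  apply: nonincreasing_cvg_mu; last 2 first.
  - by rewrite E.
  - apply/nonincreasing_seqP => n; apply/subsetPset; apply: subset_itvr.
    by rewrite bnd_simp lerD2l lerN2 lef_pV2 ?posrE// ler_nat.
  - by rewrite -ge0_fin_numE ?fin_num_measure//; exact: measurable_itv.
  - by move=> n; exact: measurable_itv.
have {}cF : mu \o F @ \oo --> (0 : R)%:E by move: cF; rewrite E x0.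
have /fine_cvgP[_ /cvgrPdist_lt /(_ _ e0)[n _ hn]] := cF.
exists n.+1%:R^-1 => //.
have := hn n (leqnn _); rewrite /= sub0r normrN => h.
have FE : dist_fun mu x = dist_fun mu (x - n.+1%:R^-1) + fine (mu (F n)).
  apply: EFin_inj; rewrite EFinD !dist_funK fineK ?fin_num_measure//; last exact: measurable_itv.
  rewrite /law_cdf.
  have dis : [set` `]-oo, x - n.+1%:R^-1]] `&` F n = set0.
    apply/seteqP; split => y //=; rewrite /F /= !in_itv /= => -[h1 /andP[h2 _]].
    by move: h2; rewrite ltNge h1.
  have mF : measurable (F n) by exact: measurable_itv.
  rewrite -(measureU _ _ mF dis)//.
  congr (mu _); apply/seteqP; split => y; rewrite /F /= !in_itv /=.
    by move=> yx; have [|] := leP y (x - n.+1%:R^-1); [left|right; apply/andP].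
  by case=> [yx|/andP[_ //]]; rewrite (le_trans yx)// gerBl// invr_ge0.
by have := ler_norm (fine (mu (F n))); rewrite FE; lra.
Qed.

Lemma law_cdf_continuous mu x : mu [set x] = 0%E -> {for x, continuous (law_cdf mu)}.
Proof.
move=> x0; suff : law_cdf mu y @[y --> x] --> (dist_fun mu x)%:E by rewrite dist_funK.
apply/fine_cvgP; split.
  by apply: nearW => y; exact: fin_num_measure.
apply/cvgrPdist_le => e e0.
have [d d0 hd] := dist_fun_right mu x e0; have [d' d'0 hd'] := dist_fun_left x0 e0.
near=> y; rewrite /= -/(dist_fun mu y).
have : `|x - y| < d by near: y; exact: cvgr_dist_lt.
have : `|x - y| < d' by near: y; exact: cvgr_dist_lt.
rewrite !ltr_norml => /andP[y1 y2] /andP[y3 y4].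
have h1 : dist_fun mu y <= dist_fun mu (x + d) by apply: dist_fun_mono; lra.
have h2 : dist_fun mu (x - d') <= dist_fun mu y by apply: dist_fun_mono; lra.
by rewrite ler_norml; apply/andP; split; lra.
Unshelve. all: end_near. Qed.

Definition real_id : R -> R := idfun.

HB.instance Definition _ :=
  isMeasurableFun.Build _ _ _ _ real_id (@measurable_id _ _ setT).

Lemma countable_atoms mu : countable [set x | mu [set x] != 0%E].
Proof.
have := pmf_gt0_countable (real_id : {RV mu >-> R}).
congr countable; apply/seteqP; split => x /=; rewrite /pmf /= (_ : real_id @^-1` [set x] = [set x])//.
  by move=> h; apply: contraTneq h => ->; rewrite ltxx.
by move=> h; rewrite fine_gt0// lt0e h measure_ge0 -ge0_fin_numE// fin_num_measure.
Qed.

(** The atoms of two laws are countable, hence Lebesgue null, and cannot fill an interval. *)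
Lemma common_continuity_point mu nu x d : 0 < d ->
  exists y, [/\ x < y < x + d, mu [set y] = 0%E & nu [set y] = 0%E].
Proof.
move=> d0; apply: contrapT => h.
have sub : [set` `]x, x + d[] `<=` [set y | mu [set y] != 0%E] `|` [set y | nu [set y] != 0%E].
  move=> y; rewrite /= in_itv /= => xy.
  have [m0|m0] := eqVneq (mu [set y]) 0%E; last by left.
  have [n0|n0] := eqVneq (nu [set y]) 0%E; last by right.
  by exfalso; apply: h; exists y.
have cnt : countable [set` `]x, x + d[].
  apply: (sub_countable (subset_card_le sub)).
  rewrite -bigcup2E; apply: bigcup_countable => // -[|[|i]] _ //=.
  - exact: countable_atoms.
  - exact: countable_atoms.
have := countable_lebesgue_measure0 cnt.
rewrite lebesgue_measure_itv /= lte_fin ltrDl d0 -EFinD => /eqP.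
by rewrite eqe => /eqP ?; lra.
Qed.

Lemma cvg_in_distribution_dist_fun (mu_ : nat -> probability R R) mu x :
  cvg_in_distribution mu_ mu -> mu [set x] = 0%E ->
  dist_fun (mu_ N) x @[N --> \oo] --> dist_fun mu x.
Proof.
move=> h x0; have := h x (law_cdf_continuous x0).
by rewrite -dist_funK => /fine_cvgP[_].
Qed.

(** The two functions agree wherever neither law has an atom; such points lie arbitrarily close to
    the right of x, and right continuity finishes. *)
Lemma cvg_in_distribution_unique (mu_ : nat -> probability R R) mu nu :
  cvg_in_distribution mu_ mu -> cvg_in_distribution mu_ nu ->
  forall x, dist_fun mu x = dist_fun nu x.
Proof.
move=> hm hn x; apply/eqP; rewrite -subr_eq0 -normr_le0; apply/ler_addgt0Pl => e e0.
rewrite addr0; have e20 : 0 < e / 2 by rewrite divr_gt0.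
have [d d0 hd] := dist_fun_right mu x e20; have [d' d'0 hd'] := dist_fun_right nu x e20.
have m0 : 0 < Num.min d d' by rewrite lt_min d0 d'0.
have [y [/andP[y1 y2] my ny]] := common_continuity_point mu nu x m0.
have E : dist_fun mu y = dist_fun nu y.
  have c1 := cvg_in_distribution_dist_fun hm my.
  have c2 := cvg_in_distribution_dist_fun hn ny.
  exact: (cvg_unique _ c1 c2).
have md : Num.min d d' <= d by rewrite ge_min lexx.
have md' : Num.min d d' <= d' by rewrite ge_min lexx orbT.
have h1 : dist_fun mu y <= dist_fun mu (x + d) by apply: dist_fun_mono; lra.
have h2 : dist_fun nu y <= dist_fun nu (x + d') by apply: dist_fun_mono; lra.
have h3 : dist_fun mu x <= dist_fun mu y by apply: dist_fun_mono; lra.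
have h4 : dist_fun nu x <= dist_fun nu y by apply: dist_fun_mono; lra.
by rewrite ler_norml; apply/andP; split; lra.
Qed.

Lemma prob_ocitv mu a b : a <= b ->
  mu [set` `]a, b]] = (dist_fun mu b - dist_fun mu a)%:E.
Proof.
move=> ab; rewrite EFinB !dist_funK /law_cdf.
have -> : [set` `]-oo, b]] = [set` `]-oo, a]] `|` [set` `]a, b]] :> set R.
  apply/seteqP; split => y; rewrite /= !in_itv /=.
    by move=> yb; have [|] := leP y a; [left|right; apply/andP].
  by case=> [ya|/andP[_ //]]; rewrite (le_trans ya).
rewrite measureU//; last first.
  apply/seteqP; split => y //=; rewrite !in_itv /= => -[h1 /andP[h2 _]].
  by move: h2; rewrite ltNge h1.
by rewrite addeAC subee ?add0e// fin_num_measure.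
Qed.

Lemma dist_fun_same_law mu nu : (forall x, dist_fun mu x = dist_fun nu x) -> same_law mu nu.
Proof.
move=> h; apply: (@measure_unique _ R R (@ocitv R) (fun n => [set` `](- n%:R), n%:R]])).
- by [].
- exact: ocitvI.
- by move=> i; exact: is_ocitv.
- apply/seteqP; split => // x _; exists (Num.trunc `|x|).+1 => //=.
  have := truncnS_gt `|x|; rewrite in_itv /= ltr_norml => /andP[-> /ltW ->//].
- move=> A [[a b] _ <-] /=; have [ab|ba] := leP a b; first by rewrite !prob_ocitv// !h.
  by rewrite set_itv_ge ?measure0// bnd_simp -leNgt ltW.
by move=> k; rewrite -ge0_fin_numE// fin_num_measure.
Qed.

Lemma same_law_integral mu nu (f : R -> R) : same_law mu nu ->
  \int[mu]_x f x = \int[nu]_x f x.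
Proof.
move=> h; rewrite /Rintegral; congr fine; apply: eq_measure_integral => A mA _.
exact: h.
Qed.

Lemma cvg_in_distribution_same_law (mu_ : nat -> probability R R) mu nu :
  cvg_in_distribution mu_ mu -> cvg_in_distribution mu_ nu -> same_law mu nu.
Proof. by move=> h1 h2; apply: dist_fun_same_law; exact: cvg_in_distribution_unique h1 h2. Qed.

End distribution_functions.

(** * The continuity theorem for cosine integrals *)

Section levy.
Variable R : realType.
Implicit Types (mu nu : probability R R).

(** Pointwise convergence of characteristic functions in real form; the phase b covers the sine
    part. *)
Definition cos_cvg (mu_ : nat -> probability R R) mu := forall a b : R,
  \int[mu_ N]_x cos (a * x + b) @[N --> \oo] --> \int[mu]_x cos (a * x + b).

Lemma cos_cvg_trig (mu_ : nat -> probability R R) mu (p : R -> R) :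
  cos_cvg mu_ mu -> trig_poly p -> \int[mu_ N]_x p x @[N --> \oo] --> \int[mu]_x p x.
Proof.
move=> h; elim=> [a b|f g hf cf hg cg|c f hf cf]; first exact: h.
  have E nu : \int[nu]_x (f x + g x) = \int[nu]_x f x + \int[nu]_x g x.
    by apply: integral_boundedD; exact: bounded_mfun_trig.
  by rewrite E; under eq_fun do rewrite E; exact: cvgD.
have E nu : \int[nu]_x (c * f x) = c * \int[nu]_x f x.
  by apply: integral_boundedZ; exact: bounded_mfun_trig.
by rewrite E; under eq_fun do rewrite E; apply: cvgM => //; exact: cvg_cst.
Qed.

Definition tail_set (B : R) : set R := [set x | B < `|x|].

Lemma measurable_tail_set B : measurable (tail_set B).
Proof.
have -> : tail_set B = ~` [set` `[(- B), B]].
  apply/seteqP; split => x; rewrite /tail_set /= in_itv /= -ler_norml.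
    by rewrite ltNge => /negP.
  by move/negP; rewrite -ltNge.
by apply: measurableC; exact: measurable_itv.
Qed.

Lemma prob_tail mu (e : R) : 0 < e -> exists B, fine (mu (tail_set B)) <= e.
Proof.
move=> e0; pose F (n : nat) : set R := tail_set n%:R.
have E : \bigcap_n F n = set0.
  rewrite -subset0 => x h; have := h (Num.trunc `|x|).+1 I.
  by rewrite /F /tail_set /= ltNge ltW// truncnS_gt.
have cF : mu \o F @ \oo --> mu (\bigcap_n F n).
  apply: nonincreasing_cvg_mu; last 2 first.
  - by rewrite E.
  - apply/nonincreasing_seqP => n; apply/subsetPset => x; rewrite /F /tail_set /=.
    by apply: le_lt_trans; rewrite ler_nat.
  - by rewrite -ge0_fin_numE ?fin_num_measure//; exact: measurable_tail_set.
  - by move=> n; exact: measurable_tail_set.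
rewrite E measure0 in cF.
have /fine_cvgP[_ /cvgrPdist_lt /(_ _ e0)[n _ hn]] := cF.
exists n%:R; have := hn n (leqnn _); rewrite /= sub0r normrN => /ltW; apply: le_trans.
exact: ler_norm.
Qed.

(** Up to e, p lies between the indicators of the half-lines ending at x0 - del and x0 + del. This
    can fail only at distance more than A from x0, and such points belong to the tail. *)
Lemma step_integral_bounds mu (p : R -> R) (x0 del A B e : R) : trig_poly p ->
  (forall x, 0 <= p x <= 1) ->
  (forall x, x0 - A <= x <= x0 - del -> 1 - e <= p x) ->
  (forall x, x0 + del <= x <= x0 + A -> p x <= e) ->
  B + `|x0| <= A -> 0 <= e <= 1 ->
  dist_fun mu (x0 - del) - e - fine (mu (tail_set B)) <= \int[mu]_x p x
  <= dist_fun mu (x0 + del) + e + fine (mu (tail_set B)).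
Proof.
move=> tp p01 pl pr AB /andP[e0 e1].
have tail_out x : ~~ (`|x - x0| <= A) -> tail_set B x.
  by rewrite -ltNge /tail_set /= => h; have := ler_normB x x0; lra.
pose I1 y := (\1_([set` `]-oo, y]] : set R) : R -> R).
pose I2 := (\1_(tail_set B) : R -> R).
have b1 y : bounded_mfun (I1 y) by apply: bounded_mfun_indic; exact: measurable_itv.
have b2 : bounded_mfun I2 by apply: bounded_mfun_indic; exact: measurable_tail_set.
have bc c : bounded_mfun (fun=> c : R) by exact: bounded_mfun_cst.
have i1 y : \int[mu]_x I1 y x = dist_fun mu y by rewrite integral_bounded_indic//; exact: measurable_itv.
have i2 : \int[mu]_x I2 x = fine (mu (tail_set B)).
  by rewrite integral_bounded_indic//; exact: measurable_tail_set.
have I1E y x : I1 y x = if x <= y then 1 else 0.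
  rewrite /I1 indicE; case: ifPn => xy; first by rewrite mem_set//= in_itv.
  by rewrite memNset//= in_itv /=; exact/negP.
have I2_ge0 x : 0 <= I2 x by rewrite /I2 indicE.
have I2_1 x : ~~ (`|x - x0| <= A) -> I2 x = 1.
  by move=> /tail_out tx; rewrite /I2 indicE mem_set.
have bp := bounded_mfun_trig tp.
apply/andP; split.
  have -> : dist_fun mu (x0 - del) - e - fine (mu (tail_set B)) =
      \int[mu]_x (I1 (x0 - del) x + ((- e) + (-1) * I2 x)).
    rewrite integral_boundedD//; last first.
      by apply: bounded_mfunD => //; exact: bounded_mfunM.
    rewrite integral_boundedD//; last exact: bounded_mfunM.
    by rewrite integral_boundedZ// i1 i2 integral_bounded_cst; ring.
  apply: le_integral_bounded => //.
    by do 2 apply: bounded_mfunD => //; exact: bounded_mfunM.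
  move=> x; have /andP[p0 p1] := p01 x; have := I2_ge0 x; rewrite I1E.
  have [xl|xl] := leP x (x0 - del); last by move=> /= ?; lra.
  have [xA|xA] := boolP (`|x - x0| <= A); last by rewrite (I2_1 _ xA) /= => ?; lra.
  have := pl x; rewrite xl andbT => h ?.
  have : 1 - e <= p x by apply: h; move: xA; rewrite ler_norml => /andP[? ?]; lra.
  by move=> ?; rewrite /=; lra.
have -> : dist_fun mu (x0 + del) + e + fine (mu (tail_set B)) =
    \int[mu]_x (I1 (x0 + del) x + (e + I2 x)).
  rewrite integral_boundedD//; last exact: bounded_mfunD.
  by rewrite integral_boundedD// i1 i2 integral_bounded_cst; ring.
apply: le_integral_bounded => //; first by do 2 apply: bounded_mfunD => //.
move=> x; have /andP[p0 p1] := p01 x; have := I2_ge0 x; rewrite I1E.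
have [xl|xl] := leP x (x0 + del); first by move=> /= ?; lra.
have [xA|xA] := boolP (`|x - x0| <= A); last by rewrite (I2_1 _ xA) /= => ?; lra.
have := pr x; rewrite (ltW xl) /= => h ?.
have : p x <= e by apply: h; move: xA; rewrite ler_norml => /andP[? ?]; lra.
by move=> ?; lra.
Qed.

Lemma levy_cos (mu_ : nat -> probability R R) mu : cos_cvg mu_ mu ->
  (forall e, 0 < e -> exists B, forall N, fine (mu_ N (tail_set B)) <= e) ->
  cvg_in_distribution mu_ mu.
Proof.
move=> hc tight y cy.
rewrite -dist_funK; apply/fine_cvgP; split.
  by apply: nearW => N; rewrite fin_num_measure//; exact: measurable_itv.
apply/cvgrPdist_le => eps eps0.
(* Six errors add up: one from the integrals, two from each of the two step estimates, and one from
   the continuity of the limit. The bound 1 is for [step_integral_bounds]. *)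
pose e := Num.min (eps / 6) 1.
have e0 : 0 < e by rewrite lt_min ltr01 divr_gt0.
have e1 : 0 <= e <= 1 by rewrite (ltW e0) ge_min lexx orbT.
have ee : e <= eps / 6 by rewrite ge_min lexx.
have [B1 hB1] := tight e e0; have [B2 hB2] := prob_tail mu e0.
pose B := Num.max B1 B2.
have tailS b : b <= B -> forall nu, fine (nu (tail_set B)) <= fine (nu (tail_set b)).
  move=> bB nu; rewrite fine_le ?fin_num_measure//; try exact: measurable_tail_set.
  apply: le_measure; rewrite ?inE; try exact: measurable_tail_set.
  by move=> x; rewrite /tail_set /=; apply: le_lt_trans.
have tN N : fine (mu_ N (tail_set B)) <= e.
  by apply: le_trans (hB1 N); apply: tailS; rewrite le_max lexx.
have tmu : fine (mu (tail_set B)) <= e.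
  by apply: le_trans hB2; apply: tailS; rewrite le_max lexx orbT.
have [d d0 hd] : exists2 d, 0 < d & forall x, `|x - y| <= d -> `|dist_fun mu x - dist_fun mu y| <= e.
  have : law_cdf mu x @[x --> y] --> (dist_fun mu y)%:E by rewrite dist_funK.
  move=> /fine_cvgP[_ /cvgrPdist_le /(_ _ e0)].
  move=> [d /= d0 hd]; exists (d / 2); first by rewrite divr_gt0.
  move=> x xy; rewrite distrC; apply: hd => /=; rewrite distrC.
  by rewrite (le_lt_trans xy)// ltr_pdivrMr// ltr_pMr// ltr1n.
pose del := d / 2.
have del0 : 0 < del by rewrite divr_gt0.
have step x0 : x0 = y - del \/ x0 = y + del -> exists p, trig_poly p /\ forall nu,
   fine (nu (tail_set B)) <= e ->
   dist_fun nu (x0 - del) - e - e <= \int[nu]_x p x <= dist_fun nu (x0 + del) + e + e.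
  move=> _; pose A := Num.max 1 (B + `|x0|).
  have A0 : 0 < A by rewrite lt_max ltr01.
  have AB : B + `|x0| <= A by rewrite le_max lexx orbT.
  have [p [tp p01 pl pr]] := trig_step x0 del0 A0 e0.
  exists p; split=> // nu hnu.
  have /andP[h1 h2] := step_integral_bounds nu tp p01 pl pr AB e1.
  by apply/andP; split; lra.
(* The steps are centred beside y, so that y is the right end of the first transition and the left
   end of the second. *)
have [p [tp hp]] := step (y - del) (or_introl erefl).
have [q [tq hq]] := step (y + del) (or_intror erefl).
have cp := cos_cvg_trig hc tp; have cq := cos_cvg_trig hc tq.
near=> N.
change (`|dist_fun mu y - dist_fun (mu_ N) y| <= eps).
have hp1 : `|\int[mu]_x p x - \int[mu_ N]_x p x| <= e.
  by near: N; move/cvgrPdist_le : cp; apply.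
have hq1 : `|\int[mu]_x q x - \int[mu_ N]_x q x| <= e.
  by near: N; move/cvgrPdist_le : cq; apply.
have /andP[_ a1] := hp _ (tN N); have /andP[a2 _] := hp _ tmu.
have /andP[b1 _] := hq _ (tN N); have /andP[_ b2] := hq _ tmu.
move: a1 a2 b1 b2 hp1 hq1; rewrite subrK addrK.
have d2 : d = del + del by rewrite -splitr.
have m1 : `|dist_fun mu (y - del - del) - dist_fun mu y| <= e.
  by apply: hd; rewrite (_ : _ - y = - d) ?normrN ?gtr0_norm//; rewrite d2; ring.
have m2 : `|dist_fun mu (y + del + del) - dist_fun mu y| <= e.
  by apply: hd; rewrite (_ : _ - y = d) ?gtr0_norm//; rewrite d2; ring.
move: m1 m2; rewrite !ler_norml.
move: (\int[mu]_x p x) (\int[mu_ N]_x p x) (\int[mu]_x q x) (\int[mu_ N]_x q x) => P PN Q QN.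
move: (dist_fun _ _) (dist_fun _ _) (dist_fun _ _) (dist_fun _ _) => F1 F2 F3 F4.
move=> /andP[? ?] /andP[? ?] ? ? ? ? /andP[? ?] /andP[? ?].
by apply/andP; split; lra.
Unshelve. all: end_near. Qed.

End levy.

(** * Cosine integrals of the limit laws *)

Section normal_char.
Variable R : realType.
Local Notation leb := (@lebesgue_measure R).
Local Notation g := (@normal_pdf R 0 1).

Lemma integral_normal_prob (f : measurableTypeR R -> \bar R) :
  (normal_prob 0 1 : probability (measurableTypeR R) R).-integrable setT f ->
  (\int[normal_prob 0 1]_x f x = \int[leb]_x (f x * (g x)%:E))%E.
Proof.
move=> fi; have dom := @normal_prob_dominates R 0 1.
have mf := measurable_int _ fi.
rewrite -(Radon_Nikodym_change_of_variables dom measurableT fi).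
apply: ae_eq_integral => //.
- by apply: emeasurable_funM.
- by apply: emeasurable_funM => //; apply/measurable_EFinP; exact: measurable_normal_pdf.
- apply: ae_eqe_mul2l => /=.
  rewrite Radon_NikodymE; case: cid => /= h [h1 h2 h3].
  apply: integral_ae_eq => //=.
    by apply/measurable_EFinP; exact: measurable_normal_pdf.
  by move=> E _ mE; rewrite -h3.
Qed.

Lemma g_E x : g x = normal_peak 1 * expR (- (x ^+ 2 / 2)).
Proof.
rewrite normal_pdfE ?oner_neq0// /normal_fun subr0 expr1n mulNr.
by congr (_ * expR (- (_ / _))).
Qed.

Lemma measurable_g : measurable_fun setT g.
Proof. exact: measurable_normal_pdf. Qed.

Lemma integrable_g_bounded (f : R -> R) : bounded_mfun f ->
  leb.-integrable setT (fun x => (f x * g x)%:E).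
Proof.
move=> [mf [M fM]].
have := @integrable_normal_pdf R 0 1.
move=> /(integrableZl measurableT M) /(le_integrable measurableT _); apply.
  by apply/measurable_EFinP/measurable_funM => //; exact: measurable_g.
move=> x _; rewrite /= lee_fin !normrM ler_wpM2r//.
by rewrite (le_trans (fM x))// ler_norm.
Qed.

Lemma integrable_id_g : leb.-integrable setT (fun x => (x * g x)%:E).
Proof.
(* Since |x| <= 2 e^(x^2/4), the function |x| g(x) is dominated by a multiple of the normal density
   of variance 2. *)
pose s : R := Num.sqrt 2.
have s2 : s ^+ 2 = 2 by rewrite sqr_sqrtr.
have s0 : s != 0 by rewrite gt_eqF// sqrtr_gt0.
pose M := normal_peak 1 * 2 / normal_peak s.
have := @integrable_normal_pdf R 0 s.
move=> /(integrableZl measurableT M) /(le_integrable measurableT _); apply.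
  by apply/measurable_EFinP/measurable_funM => //; exact: measurable_g.
move=> x _; rewrite /= lee_fin [leLHS]normrM [leRHS]normrM.
rewrite [X in _ <= _ * X]ger0_norm ?normal_pdf_ge0// [X in _ * X <= _]ger0_norm ?normal_pdf_ge0//.
have p0 := normal_peak_gt0 s0.
have p1 : 0 < @normal_peak R 1 by rewrite normal_peak_gt0// oner_neq0.
have M0 : 0 <= M by rewrite /M divr_ge0 ?mulr_ge0// ltW.
rewrite (ger0_norm M0).
rewrite g_E normal_pdfE// /normal_fun subr0 s2 /M.
rewrite [leRHS](_ : _ = normal_peak 1 * (2 * expR (- (x ^+ 2) / (2 *+ 2)))); last first.
  by field; rewrite gt_eqF.
rewrite mulrCA ler_pM2l//.
have -> : - (x ^+ 2 / 2) = - x ^+ 2 / (2 *+ 2) + - x ^+ 2 / (2 *+ 2) by field.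
rewrite expRD mulrA ler_pM2r ?expR_gt0//.
have -> : - x ^+ 2 / (2 *+ 2) = - (x ^+ 2 / 4) by field.
rewrite expRN ler_pdivrMr ?expR_gt0//.
have h := expR_ge1Dx (x ^+ 2 / 4).
have : `|x| <= 2 * (1 + x ^+ 2 / 4).
  by rewrite ler_norml; apply/andP; split; nra.
by move=> h2; lra.
Qed.

Lemma has_deriv_g x : has_deriv x g (- (x * g x)).
Proof.
have -> : g = fun x => normal_peak 1 * expR (- (x ^+ 2 / 2)) by apply/funext => y; exact: g_E.
by apply: der_eq; [pderive|rewrite /=; field].
Qed.

Lemma cvg_g_nat : g n%:R @[n --> \oo] --> 0.
Proof.
have p1 : 0 < @normal_peak R 1 by rewrite normal_peak_gt0// oner_neq0.
apply/cvgrPdist_le => e e0; near=> n.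
rewrite sub0r normrN ger0_norm ?normal_pdf_ge0// g_E expRN.
rewrite ler_pdivrMr ?expR_gt0//.
have n0 : normal_peak 1 / e * 2 <= n%:R.
  by near: n; exact: nbhs_infty_ger.
have n1 : 1 <= n%:R :> R by near: n; exact: nbhs_infty_ger.
have := expR_ge1Dx (n%:R ^+ 2 / 2 : R) => h.
rewrite mulrC -ler_pdivrMr// (le_trans _ h)//.
have : n%:R <= n%:R ^+ 2 :> R by rewrite expr2 ler_peMl.
by move=> h2; lra.
Unshelve. all: end_near. Qed.

Lemma has_deriv_continuous (f : R -> R) x a : has_deriv x f a -> {for x, continuous f}.
Proof.
by move=> h; apply: differentiable_continuous; apply/derivable1_diffP; case: h.
Qed.

Variables a b : R.

Let H x : R := sin (a * x + b) * g x.
Let h x : R := a * cos (a * x + b) * g x - x * sin (a * x + b) * g x.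

Lemma bounded_mfun_sin (c d : R) : bounded_mfun (fun x : R => sin (c * x + d)).
Proof.
have := bounded_mfun_cos c (d - pi / 2); congr bounded_mfun.
by apply/funext => x; rewrite addrA cosBpihalf.
Qed.

Lemma integrable_bounded_id_g (f : R -> R) : bounded_mfun f ->
  leb.-integrable setT (fun x => (x * f x * g x)%:E).
Proof.
move=> [mf [M fM]].
have := integrable_id_g => /(integrableZl measurableT M) /(le_integrable measurableT _); apply.
  apply/measurable_EFinP/measurable_funM; last exact: measurable_g.
  exact: measurable_funM.
move=> x _; rewrite /= lee_fin mulrAC normrM [leRHS]normrM [leRHS]mulrC.
by rewrite ler_wpM2l// (le_trans (fM x))// ler_norm.
Qed.

Let integrable_h : leb.-integrable setT (EFin \o h).
Proof.
have -> : EFin \o h = (fun x => ((a * cos (a * x + b)) * g x)%:E -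
   (x * sin (a * x + b) * g x)%:E)%E by apply/funext.
apply: integrableB => //; last exact/integrable_bounded_id_g/bounded_mfun_sin.
apply: integrable_g_bounded; apply: bounded_mfunM; first exact: bounded_mfun_cst.
exact: bounded_mfun_cos.
Qed.

Let deriv_H x : has_deriv x H (h x).
Proof.
rewrite /H; apply: der_eq.
  by apply: der_mul; [pderive|exact: has_deriv_g].
by rewrite /= /h; ring.
Qed.

Let cont_h : continuous h.
Proof.
move=> x; apply: has_deriv_continuous; rewrite /h.
apply: der_add; first by apply: der_mul; [pderive|exact: has_deriv_g].
by apply: der_opp; apply: der_mul; [pderive|exact: has_deriv_g].
Qed.

Let D n : set R := [set` `[(- n.+1%:R), n.+1%:R]].

Let int_h_segment (n : nat) :
  (\int[leb]_(x in D n) (h x)%:E)%E = (H n.+1%:R - H (- n.+1%:R))%:E.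
Proof.
rewrite EFinB; apply: continuous_FTC2.
- by rewrite gtrN// ltr0Sn.
- exact: continuous_subspaceT.
- split; first by move=> x _; have := deriv_H x; case.
    apply: cvg_at_right_filter; exact: has_deriv_continuous (deriv_H _).
  apply: cvg_at_left_filter; exact: has_deriv_continuous (deriv_H _).
- by move=> x _; rewrite derive1E; have [_ ->] := deriv_H x.
Qed.

(** h is the derivative of H, which tends to 0 at both ends: integrate over growing segments and
    pass to the limit by dominated convergence. *)
Lemma integral_by_parts_g : \int[leb]_x h x = 0.
Proof.
have mh : measurable_fun setT (EFin \o h) by exact: (measurable_int _ integrable_h).
have mhD n : measurable_fun setT ((EFin \o h) \_ (D n)).
  apply: (iffLR (measurable_restrictT (EFin \o h) (measurable_itv _))).
  exact: measurable_funTS mh.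
have cv : (\int[leb]_x ((EFin \o h) \_ (D n)) x @[n --> \oo] --> \int[leb]_x (EFin \o h) x)%E.
  apply: (@dominated_cvg _ _ _ leb _ measurableT _ _ (fun x => `|(h x)%:E|)%E mhD).
  - move=> x _; apply: cvg_near_cst; near=> n; rewrite patchE mem_set//.
    rewrite /D /= in_itv /= -ler_norml (le_trans _ (_ : n%:R <= _))//; last by rewrite ler_nat.
    by near: n; exact: nbhs_infty_ger.
  - by [].
  - exact: integrable_abse.
  - move=> n x _; rewrite patchE; case: ifP => //; rewrite abse0 lee_fin normr_ge0//.
have cv0 : (\int[leb]_x ((EFin \o h) \_ (D n)) x @[n --> \oo] --> (0%R : R)%:E)%E.
  under eq_fun do rewrite -integral_mkcond int_h_segment.
  apply: cvg_EFin; first exact: nearW.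
  rewrite -[X in _ --> X]addr0.
  have c1 : g n.+1%:R @[n --> \oo] --> 0 by have := cvg_g_nat; rewrite -(cvg_shiftS (fun n => g n%:R)).
  apply/cvgrPdist_le => e e0; near=> n.
  rewrite addr0 sub0r normrN; change (`|H n.+1%:R - H (- n.+1%:R)| <= e).
  have ge : `|g n.+1%:R| <= e / 2.
    near: n; move/cvgr0Pnorm_le : c1; apply; rewrite divr_gt0//.
  have gN : g (- n.+1%:R) = g n.+1%:R by rewrite !g_E sqrrN.
  rewrite /H gN -mulrBl normrM.
  have s1 := sin_max (a * n.+1%:R + b); have s2 := sin_max (a * - n.+1%:R + b).
  have := ler_normB (sin (a * n.+1%:R + b)) (sin (a * - n.+1%:R + b)).
  have := normr_ge0 (g n.+1%:R); have := normr_ge0 (sin (a * n.+1%:R + b) - sin (a * - n.+1%:R + b)).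
  move: ge s1 s2; move: `|g _| `|_ - _| `|sin _| `|sin _| => *; nra.
by rewrite /Rintegral (cvg_unique _ cv cv0).
Unshelve. all: end_near. Qed.

End normal_char.

Section normal_cos.
Variable R : realType.
Local Notation leb := (@lebesgue_measure R).
Local Notation g := (@normal_pdf R 0 1).

(** Differentiation under the integral, dominated by |x| g(x), yields minus the integral of x sin(a
    x + b) g(x), and integration by parts turns this into the right side. *)
Lemma deriv_normal_cos (b a : R) :
  has_deriv a (fun a => \int[leb]_x (cos (a * x + b) * g x))
    (- a * \int[leb]_x (cos (a * x + b) * g x)).
Proof.
pose f (a : R) (x : R) := cos (a * x + b) * g x.
have df y x : has_deriv y (f^~ x) (- (x * sin (y * x + b) * g x)).
  by rewrite /f; apply: der_eq; [pderive|rewrite /=; ring].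
have aI : [set` `]a - 1, a + 1[] a by rewrite /= in_itv /=; apply/andP; split; lra.
have intf y : [set` `]a - 1, a + 1[] y -> leb.-integrable setT (EFin \o f y).
  by move=> _; apply: integrable_g_bounded; exact: bounded_mfun_cos.
have der y x : [set` `]a - 1, a + 1[] y -> [set: R] x -> derivable (f^~ x) y 1.
  by move=> _ _; have := df y x; case.
have dE y x : partial1of2 f y x = - (x * sin (y * x + b) * g x).
  by rewrite partial1of2E; have [_ ->] := df y x.
pose G (x : R) := `|x * g x|.
have G0 x : 0 <= G x by exact: normr_ge0.
have iG : leb.-integrable setT (EFin \o G).
  have := integrable_abse (integrable_id_g R).
  by congr (_.-integrable _ _); apply/funext => x.
have Gub y x : [set` `]a - 1, a + 1[] y -> [set: R] x -> `|partial1of2 f y x| <= G x.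
  move=> _ _; rewrite dE normrN /G mulrAC normrM ler_piMr//; exact: sin_max.
have d1 := derivable_under_integral measurableT aI intf der G0 iG Gub.
have d2 := differentiation_under_integral measurableT aI intf der G0 iG Gub.
have -> : - a * \int[leb]_x (cos (a * x + b) * g x) = \int[leb]_x partial1of2 f a x.
  have hi := integral_by_parts_g a b.
  have i1 : leb.-integrable setT (EFin \o (fun x => cos (a * x + b) * g x)).
    by apply: integrable_g_bounded; exact: bounded_mfun_cos.
  have i2 : leb.-integrable setT (EFin \o (fun x => x * sin (a * x + b) * g x)).
    by apply: integrable_bounded_id_g; exact: bounded_mfun_sin.
  have i3 : leb.-integrable setT (EFin \o (fun x => a * (cos (a * x + b) * g x))).
    have -> : EFin \o (fun x => a * (cos (a * x + b) * g x)) =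
        (fun x => a%:E * (cos (a * x + b) * g x)%:E)%E by apply/funext => x.
    exact: integrableZl.
  have e1 : \int[leb]_x (a * (cos (a * x + b) * g x)) - \int[leb]_x (x * sin (a * x + b) * g x) = 0.
    rewrite -[RHS]hi -RintegralB//; apply: eq_Rintegral => x _; ring.
  have e2 : \int[leb]_x partial1of2 f a x = - \int[leb]_x (x * sin (a * x + b) * g x).
    rewrite -mulN1r -RintegralZl//; apply: eq_Rintegral => x _; rewrite dE; ring.
  by rewrite e2 mulNr -RintegralZl// -(subr0_eq e1).
apply: DeriveDef; first exact: d1.
by rewrite -derive1E d2.
Qed.

Lemma normal_cos (a b : R) :
  \int[leb]_x (cos (a * x + b) * g x) = expR (- (a ^+ 2 / 2)) * cos b.
Proof.
pose psi (a : R) := expR (a ^+ 2 / 2) * \int[leb]_x (cos (a * x + b) * g x).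
have d0 x : is_derive x (1 : R) psi 0.
  rewrite -/(has_deriv x psi 0) /psi; apply: der_eq.
    by apply: der_mul; [pderive|exact: deriv_normal_cos].
  by rewrite /=; field.
have p0 : psi 0 = cos b.
  rewrite /psi expr0n /= mul0r expR0 mul1r.
  have -> : \int[leb]_x (cos (0 * x + b) * g x) = \int[leb]_x (cos b * g x).
    by apply: eq_Rintegral => x _; rewrite mul0r add0r.
  rewrite RintegralZl//; last exact: integrable_normal_pdf.
  by rewrite /Rintegral integral_normal_pdf /= mulr1.
by rewrite expRN -p0 -(is_derive_0_is_cst a 0 d0) /psi mulKf// gt_eqF// expR_gt0.
Qed.

Lemma normal_law_cos (a b : R) :
  \int[normal_law (0 : R) 1]_x cos (a * x + b) = expR (- (a ^+ 2 / 2)) * cos b.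
Proof.
have bc := bounded_mfun_cos a b.
rewrite -normal_cos /Rintegral; congr fine.
rewrite /normal_law integral_distribution; last 2 first.
- by apply/measurable_EFinP; have [] := bc.
- by apply: bounded_integrable; have [m e] := bc; split.
rewrite integral_normal_prob; last by apply: bounded_integrable; have [m e] := bc; split.
by apply: eq_integral => x _; rewrite /= EFinM.
Qed.

End normal_cos.

(** * Moments and cosine integrals of the Irwin-Hall law *)

Section irwin_hall_char.
Variable R : realType.
Local Notation leb := (@lebesgue_measure R).
Local Notation S := (@irwin_hall R _).

Lemma measurable_ih M : measurable_fun setT (@irwin_hall R M).
Proof. exact: measurable_funPT. Qed.

Lemma irwin_hall_cons n (x : R) (u : n.-tuple R) :
  irwin_hall [tuple of x :: u] = x + irwin_hall u.
Proof.
rewrite /irwin_hall big_ord_recl /= tnth0; congr (_ + _).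
by apply: eq_bigr => i _; rewrite tnthS.
Qed.

Lemma integral_unif01 (f : R -> \bar R) : measurable_fun setT f ->
  (forall x, 0 <= f x)%E ->
  (\int[unif01_law R]_x f x = \int[leb]_(x in `[0%R, 1%R]) f x)%E.
Proof.
move=> mf f0; rewrite /unif01_law ge0_integral_distribution//.
by rewrite integral_uniform// subr0 invr1 mul1e.
Qed.

(** Tonelli's theorem asks for nonnegative integrands; hence [cube_cos] treats 1 + cos, and the mean
    is obtained from squares. *)
Lemma integral_cube_step n (f : R -> R) : measurable_fun setT f -> (forall x, 0 <= f x) ->
  (\int[unif_cube R n.+1]_u (f (irwin_hall u))%:E =
   \int[leb]_(x in `[0%R, 1%R]) \int[unif_cube R n]_u (f (x + irwin_hall u))%:E)%E.
Proof.
move=> mf f0 /=.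
have mF : measurable_fun setT (fun p : R * n.-tuple R => (f (p.1 + irwin_hall p.2))%:E).
  apply/measurable_EFinP; apply: measurableT_comp => //.
  apply: measurable_funD; first exact: measurable_fst.
  exact: (measurableT_comp (@measurable_ih n) measurable_snd).
rewrite ge0_integral_distribution//=; last 2 first.
- by apply/measurable_EFinP; exact: (measurableT_comp mf (@measurable_ih n.+1)).
- by move=> u; rewrite lee_fin; exact: f0.
under eq_integral do rewrite irwin_hall_cons.
have pF (p : R * n.-tuple R) : (0 <= (f (p.1 + irwin_hall p.2))%:E)%E.
  by rewrite lee_fin; exact: f0.
rewrite (fubini_tonelli1 _ mF pF) integral_unif01//.
- exact: (measurable_fun_fubini_tonelli_F _ mF pF).
- by move=> x; apply: integral_ge0 => u _; exact: (pF (x, u)).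
Qed.

Lemma integral_cube_rec n (f F G : R -> R) : measurable_fun setT f -> (forall x, 0 <= f x) ->
  (forall x, (\int[unif_cube R n]_u (f (x + irwin_hall u))%:E = (F x)%:E)%E) ->
  continuous F -> (forall x, has_deriv x G (F x)) ->
  (\int[unif_cube R n.+1]_u (f (irwin_hall u))%:E = (G 1 - G 0)%:E)%E.
Proof.
move=> mf f0 hF cF dG; rewrite integral_cube_step//.
under eq_integral do rewrite hF.
rewrite EFinB; apply: continuous_FTC2 => //.
- exact: continuous_subspaceT.
- split; first by move=> x _; have := dG x; case.
    apply: cvg_at_right_filter; exact: has_deriv_continuous (dG _).
  apply: cvg_at_left_filter; exact: has_deriv_continuous (dG _).
- by move=> x _; rewrite derive1E; have [_ ->] := dG x.
Qed.

Lemma integral_cube0 (f : R -> R) : measurable_fun setT f -> (forall x, 0 <= f x) ->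
  (\int[unif_cube R 0]_u (f (irwin_hall u))%:E = (f 0)%:E)%E.
Proof.
move=> mf f0; rewrite integral_dirac//; last first.
  by apply/measurable_EFinP; exact: (measurableT_comp mf (@measurable_ih 0)).
by rewrite diracT mul1e /irwin_hall big_ord0.
Qed.

Lemma cube_sq M (b : R) :
  (\int[unif_cube R M]_u ((irwin_hall u + b) ^+ 2)%:E =
   (M%:R / 12 + (M%:R / 2 + b) ^+ 2)%:E)%E.
Proof.
have mf (c : R) : measurable_fun setT (fun x : R => (x + c) ^+ 2).
  by apply: measurable_funX; apply: measurable_funD.
elim: M b => [|M IH] b.
  rewrite (integral_cube0 (mf b)) => [|x]; last exact: sqr_ge0.
  by congr EFin; rewrite !mul0r !add0r.
pose F (x : R) := M%:R / 12 + (M%:R / 2 + (x + b)) ^+ 2.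
pose G (x : R) := M%:R / 12 * x + (M%:R / 2 + (x + b)) ^+ 3 / 3.
rewrite (@integral_cube_rec M _ F G (mf b)).
- by congr EFin; rewrite /G -natr1; field.
- by move=> x; exact: sqr_ge0.
- move=> x; rewrite /F -IH; apply: eq_integral => u _; congr EFin; ring.
- by move=> x; apply: has_deriv_continuous; rewrite /F; pderive.
- by move=> x; rewrite /G; apply: der_eq; [pderive|rewrite /= /F; field].
Qed.

Lemma sinc_le_norm (x : R) : `|sinc x| <= 1.
Proof.
rewrite ler_norml sinc_le1 andbT.
wlog x0 : x / 0 <= x.
  move=> h; have [|/ltW x0] := leP 0 x; first exact: h.
  by have := h (- x); rewrite sincN oppr_ge0; apply.
move: x0; rewrite le_eqVlt => /predU1P[<-|x0]; first by rewrite sinc0; lra.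
have u0 : 0 < x / 2 by rewrite divr_gt0.
rewrite /sinc gt_eqF// ler_pdivlMr// mulN1r.
have [u1|u1] := leP (x / 2) 1; last by have := sin_geN1 (x / 2); lra.
rewrite (le_trans (_ : _ <= 0)) ?oppr_le0 ?(ltW u0)//.
by apply: sin_ge0_pi; rewrite (ltW u0) /=; have := pi_ge2 R; lra.
Qed.

Lemma cube_cos M (t b : R) :
  (\int[unif_cube R M]_u (1 + cos (t * irwin_hall u + b))%:E =
   (1 + sinc t ^+ M * cos (t * M%:R / 2 + b))%:E)%E.
Proof.
have mf (c : R) : measurable_fun setT (fun x : R => 1 + cos (t * x + c)).
  by apply: measurable_funD => //; have [] := bounded_mfun_cos t c.
have pos (x : R) : 0 <= 1 + cos x by have := cos_geN1 x; lra.
elim: M b => [|M IH] b.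
  rewrite (integral_cube0 (mf b)) => [|x]; last exact: pos.
  by rewrite expr0 mul1r !mulr0 mul0r.
pose F (x : R) := 1 + sinc t ^+ M * cos (t * M%:R / 2 + (t * x + b)).
have hF x : (\int[unif_cube R M]_u (1 + cos (t * (x + irwin_hall u) + b))%:E = (F x)%:E)%E.
  rewrite /F -IH; apply: eq_integral => u _; congr (1 + cos _)%:E; ring.
have cF : continuous F by move=> x; apply: has_deriv_continuous; rewrite /F; pderive.
(* The primitive used for t nonzero divides by t. *)
have [t0|t0] := eqVneq t 0.
  pose G (x : R) := (1 + sinc t ^+ M * cos b) * x.
  rewrite (@integral_cube_rec M _ F G (mf b) (fun x => pos _) hF cF).
    by rewrite /G t0 sinc0 !expr1n !mul0r !add0r mulr1 mulr0 subr0.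
  by move=> x; rewrite /G; apply: der_eq; [pderive|rewrite /= /F t0 !mul0r !add0r; ring].
pose G (x : R) := x + sinc t ^+ M * sin (t * M%:R / 2 + (t * x + b)) / t.
rewrite (@integral_cube_rec M _ F G (mf b) (fun x => pos _) hF cF).
  rewrite /G; congr EFin.
  pose z := t * M.+1%:R / 2 + b.
  have e1 : t * M%:R / 2 + (t * 1 + b) = z + t / 2 by rewrite /z -natr1; field.
  have e2 : t * M%:R / 2 + (t * 0 + b) = z - t / 2 by rewrite /z -natr1; field.
  rewrite e1 e2 -/z sinD sinB exprSr.
  have -> : sinc t ^+ M * sinc t * cos z = sinc t ^+ M * (sinc t * (t / 2)) * cos z * 2 / t by field.
  by rewrite -sincM; field.
by move=> x; rewrite /G; apply: der_eq; [pderive|rewrite /= /F; field].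
Qed.

Lemma integral_cube_cos M (t b : R) :
  \int[unif_cube R M]_u cos (t * irwin_hall u + b) = sinc t ^+ M * cos (t * M%:R / 2 + b).
Proof.
have bc : bounded_mfun (fun u : M.-tuple R => cos (t * irwin_hall u + b)).
  split; last by exists 1 => u; exact: cos_max.
  have [mc _] := bounded_mfun_cos t b.
  exact: (measurableT_comp mc (@measurable_ih M)).
have := congr1 fine (cube_cos M t b).
rewrite -/(Rintegral (unif_cube R M) setT (fun u => 1 + cos (t * irwin_hall u + b))).
rewrite integral_boundedD//; last exact: bounded_mfun_cst.
by rewrite integral_bounded_cst => /addrI.
Qed.

Lemma cube_sq_integrable M (b : R) :
  (unif_cube R M).-integrable setT (fun u => ((irwin_hall u + b) ^+ 2)%:E).
Proof.
apply/integrableP; split.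
  have mf : measurable_fun setT (fun x : R => (x + b) ^+ 2).
    by apply: measurable_funX; apply: measurable_funD.
  by apply/measurable_EFinP; exact: (measurableT_comp mf (@measurable_ih M)).
under eq_integral do rewrite gee0_abs ?lee_fin ?sqr_ge0//.
by rewrite cube_sq ltry.
Qed.

(** From x = ((x + 1)^2 - x^2 - 1) / 2 and the second moments about -1 and 0. *)
Lemma cube_mean M : \int[unif_cube R M]_u irwin_hall u = M%:R / 2.
Proof.
have i1 := @cube_sq_integrable M 1; have i0 := @cube_sq_integrable M 0.
have e1 := congr1 fine (cube_sq M 1); have e0 := congr1 fine (cube_sq M 0).
have ic : (unif_cube R M).-integrable setT (EFin \o (fun=> 1 : R)).
  by apply: bounded_integrable; exact: bounded_mfun_cst.
have iB : (unif_cube R M).-integrable setT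
    (EFin \o (fun u => (irwin_hall u + 1) ^+ 2 - (irwin_hall u + 0) ^+ 2)).
  rewrite (_ : _ \o _ = (fun u => ((irwin_hall u + 1) ^+ 2)%:E - ((irwin_hall u + 0) ^+ 2)%:E)%E)//.
  exact: integrableB.
have iBB : (unif_cube R M).-integrable setT
    (EFin \o (fun u => (irwin_hall u + 1) ^+ 2 - (irwin_hall u + 0) ^+ 2 - 1)).
  rewrite (_ : _ \o _ = (fun u => ((irwin_hall u + 1) ^+ 2 - (irwin_hall u + 0) ^+ 2)%:E - 1%:E)%E)//.
  exact: integrableB.
have -> : \int[unif_cube R M]_u irwin_hall u =
    \int[unif_cube R M]_u (2^-1 * ((irwin_hall u + 1) ^+ 2 - (irwin_hall u + 0) ^+ 2 - 1)).
  by apply: eq_Rintegral => u _; field.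
rewrite RintegralZl// RintegralB// RintegralB//.
by rewrite integral_bounded_cst /Rintegral e1 e0 /=; field.
Qed.

Lemma expectation_irwin_hall M :
  fine 'E_(unif_cube R M)[@irwin_hall R M] = M%:R / 2.
Proof. by rewrite unlock -[LHS]/(Rintegral _ _ _) cube_mean. Qed.

Lemma variance_irwin_hall M :
  fine 'V_(unif_cube R M)[@irwin_hall R M] = M%:R / 12.
Proof.
rewrite /variance unlock expectation_irwin_hall unlock.
have := cube_sq M (- (M%:R / 2)); rewrite subrr expr0n addr0 => /(congr1 fine) /= <-.
by congr fine; apply: eq_integral => u _; rewrite /= expr2.
Qed.

Lemma irwin_hall_law_cos M (a b : R) :
  \int[normalized_irwin_hall_law R M]_x cos (a * x + b) =
  sinc (a / Num.sqrt (M%:R / 12)) ^+ M * cos b.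
Proof.
have bc := bounded_mfun_cos a b.
have -> : \int[normalized_irwin_hall_law R M]_x cos (a * x + b) =
    \int[unif_cube R M]_u cos ((a / Num.sqrt (M%:R / 12)) * irwin_hall u +
       (b - (a / Num.sqrt (M%:R / 12)) * M%:R / 2)).
  rewrite /Rintegral; congr fine.
  rewrite /normalized_irwin_hall_law /normalized_law integral_distribution; last 2 first.
  - by apply/measurable_EFinP; have [] := bc.
  - apply: bounded_integrable; have [m [K hK]] := bc; split; last by exists K => u; exact: hK.
    exact: (measurableT_comp m (measurable_funPT (normalized (@irwin_hall R M : {RV unif_cube R M >-> R})))).
  apply: eq_integral => u _; rewrite /= /normalized expectation_irwin_hall variance_irwin_hall.
  have E (s k m : R) : a * ((s - m / 2) * k) + b = a * k * s + (b - a * k * m / 2) by field.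
  by congr (cos _)%:E; exact: E.
by rewrite integral_cube_cos; congr (_ * cos _); ring.
Qed.

End irwin_hall_char.

(** * Limits of the normalized laws *)

Section maj_law.
Variable R : realType.
Variable lam : intpart.
Local Notation P := (unif_SYT lam : probability (SYT lam) R).

Lemma bounded_mfun_SYT (f : SYT lam -> R) : bounded_mfun f.
Proof.
split; first by [].
exists (\sum_(T : SYT lam) `|f T|) => T; rewrite (bigD1 T)//= lerDl.
exact: sumr_ge0.
Qed.

Lemma unif_SYT_set1 (T : SYT lam) : P [set T] = (#|{: SYT lam}|%:R^-1)%:E.
Proof.
rewrite /= /unif_SYT (bigD1 T)//= big1 ?adde0 => [|T' TT'].
  by rewrite diracE mem_set// mule1.
by rewrite diracE memNset ?mule0//= => e; rewrite e eqxx in TT'.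
Qed.

Lemma integral_unif_SYT (f : SYT lam -> R) :
  \int[P]_T f T = (\sum_(T : SYT lam) f T) / #|{: SYT lam}|%:R.
Proof.
have fE : f = fun T => \sum_(T' : SYT lam) f T' * \1_[set T'] T.
  apply/funext => T; rewrite (bigD1 T)//= big1 ?addr0 => [|T' TT'].
    by rewrite indicE mem_set// mulr1.
  by rewrite indicE memNset ?mulr0//= => e; rewrite e eqxx in TT'.
rewrite [in LHS]fE mulr_suml.
elim: (index_enum _) => [|T s IH].
  rewrite big_nil; under eq_Rintegral do rewrite big_nil.
  exact: integral_bounded_cst.
rewrite big_cons; under eq_Rintegral do rewrite big_cons.
rewrite integral_boundedD; [|exact: bounded_mfun_SYT..].
rewrite IH integral_boundedZ; last exact: bounded_mfun_SYT.
rewrite integral_bounded_indic//; congr (_ * _ + _).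
by have /(congr1 fine) := unif_SYT_set1 T.
Qed.

Lemma integral_maj (f : R -> R) : \int[P]_T f (majRV lam T) = maj_avg lam f.
Proof. by rewrite integral_unif_SYT /maj_avg. Qed.

Lemma expectation_maj : fine 'E_P[majRV lam] = maj_avg lam id.
Proof. by rewrite unlock -[LHS]/(Rintegral _ _ _) (integral_maj id). Qed.

Lemma variance_maj :
  fine 'V_P[majRV lam] = maj_avg lam (fun x => (x - maj_avg lam id) ^+ 2).
Proof.
rewrite /variance unlock expectation_maj unlock -[LHS]/(Rintegral _ _ _).
rewrite -(integral_maj (fun x => (x - maj_avg lam id) ^+ 2)).
by apply: eq_Rintegral => T _; rewrite /= expr2.
Qed.

Definition maj_sd : R := Num.sqrt (maj_avg lam (fun x => (x - maj_avg lam id) ^+ 2)).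

Lemma normalized_majE (T : SYT lam) :
  normalized (majRV lam : {RV P >-> R}) T = ((maj T)%:R - maj_avg lam id) / maj_sd.
Proof. by rewrite /normalized expectation_maj variance_maj. Qed.

Lemma integral_maj_law (f : R -> R) : bounded_mfun f ->
  \int[normalized_maj_law R lam]_x f x =
  maj_avg lam (fun x => f ((x - maj_avg lam id) / maj_sd)).
Proof.
move=> [mf [K hK]].
rewrite -integral_maj /Rintegral; congr fine.
rewrite /normalized_maj_law /normalized_law integral_distribution.
- by apply: eq_integral => T _; rewrite /= normalized_majE.
- exact/measurable_EFinP.
- by apply: bounded_integrable; exact: bounded_mfun_SYT.
Qed.

(** Chebyshev's inequality; the bound does not depend on [lam], which gives tightness. *)
Lemma maj_law_tail (B : R) : 0 < B ->
  fine (normalized_maj_law R lam (tail_set B)) <= (B ^+ 2)^-1.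
Proof.
move=> B0; rewrite -integral_bounded_indic; last exact: measurable_tail_set.
rewrite integral_maj_law; last by apply: bounded_mfun_indic; exact: measurable_tail_set.
set c := maj_avg lam id; set v := maj_avg lam (fun x => (x - c) ^+ 2).
have v0 : 0 <= v by rewrite -(maj_avg_cst lam 0); apply: le_maj_avg => x; exact: sqr_ge0.
have B2 : 0 < (B ^+ 2)^-1 by rewrite invr_gt0 exprn_gt0.
apply: (@le_trans _ _ (maj_avg lam (fun x => (B ^+ 2)^-1 * v^-1 * (x - c) ^+ 2))).
  apply: le_maj_avg => x; rewrite indicE; have [/set_mem xB|_] := boolP (_ \in _); last first.
    apply: mulr_ge0; last exact: sqr_ge0.
    by apply: mulr_ge0; [exact: ltW B2|rewrite invr_ge0].
  have e : ((x - c) / maj_sd) ^+ 2 = v^-1 * (x - c) ^+ 2.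
    by rewrite exprMn exprVn sqr_sqrtr// mulrC.
  rewrite -mulrA -e mulrC ler_pdivlMr ?exprn_gt0// mul1r.
  rewrite -[leRHS]real_normK ?num_real// lerXn2r ?nnegrE ?(ltW B0)//.
  exact: ltW.
rewrite maj_avgZ -/v; have [->|vn] := eqVneq v 0; first by rewrite mulr0 ltW.
by rewrite -mulrA mulVf// mulr1.
Qed.

Lemma maj_law_cos (a b : R) : \int[normalized_maj_law R lam]_x cos (a * x + b) =
  maj_avg lam (fun x => cos ((x - maj_avg lam id) * (a / maj_sd))) * cos b -
  maj_avg lam (fun x => sin ((x - maj_avg lam id) * (a / maj_sd))) * sin b.
Proof.
rewrite integral_maj_law; last exact: bounded_mfun_cos.
set A := maj_avg lam _; set B := maj_avg lam _; set C := maj_avg lam _.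
have -> : B * cos b - C * sin b = cos b * B + - sin b * C by ring.
rewrite /B /C -(maj_avgZ lam (cos b)) -(maj_avgZ lam (- sin b)) -maj_avgD /A.
congr maj_avg; apply/funext => x.
have -> : a * ((x - maj_avg lam id) / maj_sd) = (x - maj_avg lam id) * (a / maj_sd).
  by rewrite mulrCA.
rewrite cosD; ring.
Qed.

End maj_law.

Lemma cos_2pi_nat (R : realType) (n : nat) : cos (2 * pi * n%:R : R) = 1.
Proof.
by rewrite mulr_natr mulr_natl -[_ *+ n]add0r (periodicn (@cosD2pi R)) cos0.
Qed.

Lemma sin_2pi_nat (R : realType) (n : nat) : sin (2 * pi * n%:R : R) = 0.
Proof.
by rewrite mulr_natr mulr_natl -[_ *+ n]add0r (periodicn (@sinD2pi R)) sin0.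
Qed.

(* The values of [maj - mean] are half-integers. *)
Lemma maj_law_lattice (R : realType) (lam : intpart) :
  exists2 t : R, 0 < t & \int[normalized_maj_law R lam]_x cos (t * x + 0) = 1.
Proof.
have [D [Re [Mi [pR pM sR sM]]]] := hook_split lam.
have sRM : size Re = size Mi by rewrite sR sM.
have mean := maj_mean R pR pM sRM.
have sd0 : 0 <= maj_sd R lam by exact: sqrtr_ge0.
have bc (t : R) := bounded_mfun_cos t 0.
have [s0|s0] := eqVneq (maj_sd R lam) 0.
  exists 1 => //; rewrite integral_maj_law// -[RHS](maj_avg_cst lam 1).
  by congr maj_avg; apply/funext => x; rewrite s0 invr0 mulr0 mulr0 addr0 cos0.
have sdp : 0 < maj_sd R lam by rewrite lt0r s0.
(* Twice the centred value of maj is the integer p - r, so this t gives the phase 2 pi (p - r). *)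
exists (4 * pi * maj_sd R lam); first by rewrite !mulr_gt0// pi_gt0.
rewrite integral_maj_law// mean -[RHS](maj_avg_cst lam 1) [LHS]/maj_avg [RHS]/maj_avg.
congr (_ / _); apply: eq_bigr => T _; rewrite /maj_center.
pose p := ((maj T).*2 + sumn Re)%N; pose r := ((row_weight lam).*2 + sumn Mi)%N.
have -> : 4 * pi * maj_sd R lam * (((maj T)%:R - ((row_weight lam)%:R +
   (\sum_(j <- Mi) j%:R - \sum_(h <- Re) h%:R) / 2)) / maj_sd R lam) + 0 =
   2 * pi * p%:R - 2 * pi * r%:R.
  rewrite /p /r !natrD -!mul2n !natrM !sumnE !natr_sum; field.
  exact: s0.
by rewrite cosB !cos_2pi_nat !sin_2pi_nat mulr1 mulr0 addr0.
Qed.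

Section sinc_values.
Variable R : realType.

(** Up to x = 2 the Taylor bounds suffice; beyond it the denominator x/2 exceeds 1. *)
Lemma sinc_lt1 (x : R) : x != 0 -> `|sinc x| < 1.
Proof.
wlog x0 : x / 0 <= x.
  move=> h xn; have [x0|/ltW x0] := leP 0 x; first exact: h.
  by have := h (- x); rewrite sincN oppr_ge0 oppr_eq0; apply.
move=> xn; have {x0 xn}x0 : 0 < x by rewrite lt0r xn.
have [x2|x2] := leP x 2.
  have /andP[lo hi] := sinc_approx x.
  have x20 : 0 < x ^+ 2 by rewrite exprn_gt0.
  have x24 : x ^+ 2 <= 4 by rewrite expr2; nra.
  have x4 : x ^+ 4 = x ^+ 2 * x ^+ 2 by ring.
  by rewrite ltr_norml; apply/andP; split; rewrite ?x4 in hi *; nra.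
have u0 : 1 < x / 2 by rewrite ltr_pdivlMr// mul1r.
rewrite /sinc gt_eqF// normrM normrV ?unitfE ?mulf_neq0 ?invr_neq0 ?gt_eqF//.
rewrite (gtr0_norm (lt_trans ltr01 u0)) ltr_pdivrMr ?(lt_trans ltr01 u0)// mul1r.
by rewrite (le_lt_trans (sin_max _)).
Qed.

Lemma sinc_2pi : sinc (2 * pi : R) = 0.
Proof.
rewrite /sinc gt_eqF ?mulr_gt0 ?pi_gt0//.
by rewrite mulrAC divff// mul1r sinpi mul0r.
Qed.

Lemma sinc_gt0 (x : R) : 0 < x < 2 * pi -> 0 < sinc x.
Proof.
move=> /andP[x0 xpi]; rewrite /sinc gt_eqF// divr_gt0 ?divr_gt0//.
by rewrite sin_gt0_pi// divr_gt0//= ltr_pdivrMr// mulrC.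
Qed.

End sinc_values.

Section product_estimates.
Variable R : realType.

Lemma prod_sinc_exp (s : seq nat) (t d : R) :
  {in s, forall h, `|h%:R * t| <= 1 /\ (h%:R * t) ^+ 4 <= d} ->
  expR (- (t ^+ 2 / 24 * \sum_(h <- s) h%:R ^+ 2) - (size s)%:R * d)
    <= \prod_(h <- s) sinc (h%:R * t)
    <= expR (- (t ^+ 2 / 24 * \sum_(h <- s) h%:R ^+ 2) + (size s)%:R * d).
Proof.
elim: s => [|h s IH] hs.
  by rewrite !big_nil /= mulr0 mul0r oppr0 !addr0 expR0 lexx.
have /andP[lo hi] : expR (- (t ^+ 2 / 24 * \sum_(h <- s) h%:R ^+ 2) - (size s)%:R * d)
    <= \prod_(h <- s) sinc (h%:R * t)
    <= expR (- (t ^+ 2 / 24 * \sum_(h <- s) h%:R ^+ 2) + (size s)%:R * d).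
  by apply: IH => j js; apply: hs; rewrite inE js orbT.
have [h1 hd] := hs h (mem_head _ _).
have /andP[lo1 hi1] := sinc_exp_bounds h1.
rewrite !big_cons /= -[(size s).+1]addn1 natrD.
apply/andP; split.
- apply: le_trans (ler_pM (expR_ge0 _) (expR_ge0 _) lo1 lo).
  rewrite -expRD ler_expR exprMn; rewrite exprMn in hd; lra.
- apply: le_trans (ler_pM _ _ hi1 hi) _.
  + by apply: ltW; exact: sinc_gt0_small.
  + by apply: le_trans lo; exact: expR_ge0.
  rewrite -expRD ler_expR exprMn; rewrite exprMn in hd; lra.
Qed.

Lemma prod_near_exp (s : seq nat) (f : nat -> R) (z e : R) : `|z| <= 1 ->
  {in s, forall j, `|f j| <= 1 /\ `|f j - z| <= e} ->
  `|\prod_(j <- s) f j - z ^+ size s| <= (size s)%:R * e.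
Proof.
move=> z1; elim: s => [|j s IH] hs; first by rewrite big_nil expr0 subrr normr0 mul0r.
have {IH}IH : `|\prod_(j <- s) f j - z ^+ size s| <= (size s)%:R * e.
  by apply: IH => i si; apply: hs; rewrite inE si orbT.
have [f1 fe] := hs j (mem_head _ _).
rewrite big_cons /= exprS -[(size s).+1]addn1 natrD mulrDl mul1r.
set p := \prod_(_ <- _) _ in IH *; set zs := z ^+ size s in IH *.
have -> : f j * p - z * zs = f j * (p - zs) + (f j - z) * zs by ring.
apply: (le_trans (ler_normD _ _)); rewrite !normrM; apply: lerD.
  rewrite -[leRHS]mul1r; exact: ler_pM.
by rewrite -[leRHS]mulr1 ler_pM// normrX exprn_ile1.
Qed.

Lemma norm_sq_dist (u v : R) : (`|u| - `|v|) ^+ 2 <= `|u ^+ 2 - v ^+ 2|.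
Proof.
rewrite -[u ^+ 2]real_normK ?num_real// -[v ^+ 2]real_normK ?num_real//.
have := normr_ge0 u; have := normr_ge0 v; move: `|u| `|v| => x y y0 x0.
rewrite subr_sqr normrM -[leLHS]real_normK ?num_real// expr2 ler_wpM2l//.
by rewrite [leRHS]ger0_norm ?addr_ge0// ler_norml; apply/andP; split; lra.
Qed.

Lemma sinc_norm (x : R) : sinc `|x| = sinc x.
Proof. by case: (ger0P x) => _; rewrite ?sincN. Qed.

End product_estimates.

(** * Cosine integrals when aft grows *)

Section maj_law_cos_limits.
Variables (R : realType) (lam : intpart).
Local Notation n := (sumn lam).
Local Notation k := (aft lam).

Lemma maj_sd_sq (D Re Mi : seq nat) : perm_eq (hooks lam) (D ++ Re) ->
  perm_eq (iota 1 n) (D ++ Mi) -> size Re = size Mi ->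
  maj_sd R lam = Num.sqrt (sq_excess R Re Mi / 12).
Proof.
by move=> pR pM sRM; rewrite /maj_sd (maj_mean R pR pM sRM) (maj_variance R pR pM sRM).
Qed.

(** The product over [Re] is positive here, so the sine average vanishes and the phase b contributes
    only the factor cos b. *)
Lemma maj_law_cos_even (D Re Mi : seq nat) (a b : R) : perm_eq (hooks lam) (D ++ Re) ->
  perm_eq (iota 1 n) (D ++ Mi) -> size Re = size Mi ->
  {in Re, forall h, `|h%:R * (a / maj_sd R lam)| <= 1} ->
  exists p, [/\ \int[normalized_maj_law R lam]_x cos (a * x + b) = p * cos b, `|p| <= 1
    & p * \prod_(h <- Re) sinc (h%:R * (a / maj_sd R lam)) =
      \prod_(j <- Mi) sinc (j%:R * (a / maj_sd R lam))].
Proof.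
move=> pR pM sRM hR; set t := a / _ in hR *.
exists (maj_avg lam (fun x => cos ((x - maj_avg lam id) * t))); split.
- rewrite maj_law_cos -/t (maj_mean R pR pM sRM).
  have /eqP := maj_avg_sin pR pM sRM t.
  rewrite mulf_eq0 (gt_eqF (prod_sinc_gt0 hR)) orbF => /eqP ->.
  by rewrite mul0r subr0.
- rewrite -[leRHS](maj_avg_cst lam 1); apply: ler_norm_maj_avg => x.
  by rewrite ler_norml cos_geN1 cos_le1.
- by rewrite (maj_mean R pR pM sRM); exact: (maj_avg_cos pR pM sRM).
Qed.

(** With t = a / sd, the variance bound k n^2 / 192 gives (h t)^2 <= 192 a^2 / k for all h <= n, and
    the last hypothesis makes this at most 1. The quadratic terms add up to exactly a^2 / 2; each of
    the 2 k factors leaves an error of at most (192 a^2 / k)^2 in the exponent. *)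
Lemma maj_law_cos_normal (a b : R) : (4 <= n)%N -> (0 < k)%N ->
  192 * a ^+ 2 <= k%:R ->
  exists2 p, \int[normalized_maj_law R lam]_x cos (a * x + b) = p * cos b
  & expR (- (a ^+ 2 / 2) - 2 * (192 * a ^+ 2) ^+ 2 / k%:R) <= p
    <= expR (- (a ^+ 2 / 2) + 2 * (192 * a ^+ 2) ^+ 2 / k%:R).
Proof.
move=> n4 k0 ak; have [D [Re [Mi [pR pM sR sM]]]] := hook_split lam.
have sRM : size Re = size Mi by rewrite sR sM.
have sdE := maj_sd_sq pR pM sRM; have := sq_excess_ge_quad R pR pM n4.
cbv zeta; set Q := sq_excess R Re Mi in sdE * => Qn.
have kp : 0 < k%:R :> R by rewrite ltr0n.
have np : 0 < n%:R :> R by rewrite ltr0n; exact: leq_trans n4.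
have Qp : 0 < Q by apply: lt_le_trans Qn; rewrite divr_gt0// mulr_gt0// exprn_gt0.
set t := a / maj_sd R lam.
have t2 : t ^+ 2 = 12 * a ^+ 2 / Q.
  rewrite /t exprMn exprVn sdE sqr_sqrtr ?divr_ge0 ?ltW//; field.
  by rewrite gt_eqF.
have nt : n%:R ^+ 2 * t ^+ 2 <= 192 * a ^+ 2 / k%:R.
  rewrite t2 ler_pdivlMr// mulrA mulrAC ler_pdivrMr//.
  have := sqr_ge0 a; nra.
have ht (h : nat) : (h <= n)%N -> (h%:R * t) ^+ 2 <= 192 * a ^+ 2 / k%:R.
  move=> hn; apply: le_trans nt; rewrite exprMn ler_wpM2r ?sqr_ge0//.
  by rewrite lerXn2r ?nnegrE// ler_nat.
have r1 : 192 * a ^+ 2 / k%:R <= 1 by rewrite ler_pdivrMr// mul1r.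
have h1 (h : nat) : (h <= n)%N -> `|h%:R * t| <= 1.
  move=> /ht hn; rewrite -[leRHS]/(1%R) -(@ler_pXn2r _ 2)// ?nnegrE//.
  by rewrite expr1n real_normK ?num_real// (le_trans hn).
pose d := (192 * a ^+ 2 / k%:R) ^+ 2.
have hd (h : nat) : (h <= n)%N -> `|h%:R * t| <= 1 /\ (h%:R * t) ^+ 4 <= d.
  move=> hn; split; first exact: h1.
  rewrite (_ : 4 = 2 * 2)%N// exprM lerXn2r ?nnegrE ?sqr_ge0 ?ht//.
  by rewrite divr_ge0// mulr_ge0// sqr_ge0.
have Rb : {in Re, forall h, `|h%:R * t| <= 1 /\ (h%:R * t) ^+ 4 <= d}.
  by move=> h /(mem_Re pR)/andP[_]; exact: hd.
have Mb : {in Mi, forall h, `|h%:R * t| <= 1 /\ (h%:R * t) ^+ 4 <= d}.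
  by move=> h /(mem_Mi pM)/andP[_]; exact: hd.
have [p [pE _ pP]] := maj_law_cos_even b pR pM sRM (fun h hR => (Rb h hR).1).
exists p => //; rewrite -/t in pP.
have /andP[Rlo Rhi] := prod_sinc_exp Rb; have /andP[Mlo Mhi] := prod_sinc_exp Mb.
set PR := \prod_(h <- Re) _ in pP Rlo Rhi; set PM := \prod_(h <- Mi) _ in pP Mlo Mhi.
have PRp : 0 < PR by apply: lt_le_trans Rlo; exact: expR_gt0.
have {pP}-> : p = PM / PR by rewrite -pP mulfK// gt_eqF.
have dE : 2 * (192 * a ^+ 2) ^+ 2 / k%:R = 2 * k%:R * d.
  by rewrite /d; field; rewrite gt_eqF.
have aE : a ^+ 2 / 2 = t ^+ 2 / 24 * \sum_(j <- Mi) j%:R ^+ 2 -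
    t ^+ 2 / 24 * \sum_(h <- Re) h%:R ^+ 2.
  by rewrite -mulrBr -/(sq_excess R Re Mi) -/Q t2; field; rewrite gt_eqF.
rewrite ler_pdivlMr// ler_pdivrMr// dE aE.
apply/andP; split.
- apply: le_trans (ler_wpM2l (expR_ge0 _) Rhi) _; apply: le_trans Mlo.
  by rewrite -expRD ler_expR sR sM; lra.
- apply: le_trans (Mhi) _; apply: le_trans (ler_wpM2l (expR_ge0 _) Rlo).
  by rewrite -expRD ler_expR sR sM; lra.
Qed.

End maj_law_cos_limits.

Lemma natr_ge_eventually (R : realType) (x : R) : exists n0, forall n, (n0 <= n)%N -> x <= n%:R.
Proof.
exists (Num.truncn x).+1 => m hm.
by apply: le_trans (ltW (truncnS_gt x)) _; rewrite ler_nat.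
Qed.

(** * Cosine integrals when aft is fixed and the size grows *)

Section maj_law_cos_irwin_hall.
Variable R : realType.

(** Only the squares of the arguments are under control, through the variance; as sinc is even, this
    suffices. *)
Lemma sinc_cts_sq (z e : R) : 0 < e ->
  exists2 d : R, 0 < d & forall x : R, `|x ^+ 2 - z ^+ 2| <= d -> `|sinc x - sinc z| <= e.
Proof.
move=> e0; have /cvgrPdist_le/(_ _ e0)/nbhs_ballP[d /= d0 hd] := @sinc_continuous R `|z|.
exists ((d / 2) ^+ 2) => [|x xz]; first by rewrite exprn_gt0// divr_gt0.
rewrite distrC -(sinc_norm x) -(sinc_norm z); apply: hd; rewrite /ball/= distrC.
apply: (@le_lt_trans _ _ (d / 2)); last by rewrite ltr_pdivrMr// ltr_pMr// ltr1n.
rewrite -(@ler_pXn2r _ 2)// ?nnegrE ?divr_ge0 ?(ltW d0)//.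
rewrite real_normK ?num_real//; exact: le_trans (norm_sq_dist _ _) xz.
Qed.

Lemma sum_le_mem (s : seq nat) (F : nat -> R) (j : nat) (b : R) : j \in s ->
  {in s, forall i, F i <= b} ->
  \sum_(i <- s) F i <= F j + (size s)%:R * b - b.
Proof.
elim: s j => [//|i s IH] j; rewrite inE => js hb.
have hs : {in s, forall i, F i <= b} by move=> k ks; apply: hb; rewrite inE ks orbT.
have sb : \sum_(i <- s) F i <= (size s)%:R * b.
  elim: s hs {IH js hb} => [|k s IH] hs; first by rewrite big_nil mul0r.
  rewrite big_cons /= -[(size s).+1]addn1 natrD mulrDl mul1r addrC lerD//.
    by apply: IH => k' ks; apply: hs; rewrite inE ks orbT.
  by apply: hs; rewrite mem_head.
rewrite big_cons /= -[(size s).+1]addn1 natrD mulrDl mul1r.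
case/orP: js => [/eqP ->|js]; first by rewrite addrA addrK lerD2l.
have := IH _ js hs; have := hb i (mem_head _ _); lra.
Qed.

(** The sum of squares over [Mi] is at most k n^2, while the excess is at least k n^2 - 2 k^2 n. So
    all squared hooks in [Re] together are at most 2 k^2 n, and no single j^2 can fall short of n^2
    by more than that. *)
Lemma split_bounds (lam : intpart) (D Re Mi : seq nat) (n := sumn lam) (k := aft lam) :
  perm_eq (hooks lam) (D ++ Re) -> perm_eq (iota 1 n) (D ++ Mi) ->
  size Re = k -> size Mi = k -> (k.*2 <= n)%N ->
  [/\ {in Re, forall h, h%:R ^+ 2 <= 2 * k%:R ^+ 2 * n%:R :> R},
     sq_excess R Re Mi <= k%:R * n%:R ^+ 2 &
     {in Mi, forall j, (n%:R ^+ 2 - 2 * k%:R ^+ 2 * n%:R : R) <= j%:R ^+ 2 <= (n%:R ^+ 2 : R)}].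
Proof.
move=> pR pM sR sM k2; have := @sq_excess_ge_lin R lam D Re Mi pR pM k2.
cbv zeta; rewrite -/n -/k /sq_excess.
set SM := \sum_(j <- Mi) _; set SR := \sum_(h <- Re) _ => Qlin.
have jn : {in Mi, forall j, j%:R ^+ 2 <= n%:R ^+ 2 :> R}.
  by move=> j /(mem_Mi pM)/andP[_ jn]; rewrite lerXn2r ?nnegrE// ler_nat.
have SR0 : 0 <= SR by apply: sumr_ge0 => h _; exact: sqr_ge0.
have k0 : 0 <= k%:R :> R by []; have n0 : 0 <= n%:R :> R by [].
have SMn : SM <= k%:R * n%:R ^+ 2.
  rewrite /SM; case: {+}Mi sM jn => [|j s] sM jn; first by rewrite big_nil mulr_ge0// sqr_ge0.
  have := sum_le_mem (mem_head j s) jn; have := jn j (mem_head _ _).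
  by rewrite sM; lra.
split.
- move=> h hR; suff : h%:R ^+ 2 <= SR by nra.
  rewrite /SR (big_rem h)//= lerDl; apply: sumr_ge0 => i _; exact: sqr_ge0.
- by lra.
- move=> j jM; rewrite jn// andbT.
  by have := sum_le_mem jM jn; rewrite sM -/SM; nra.
Qed.

Lemma maj_law_cos_aft0 (lam : intpart) (a b : R) : aft lam = 0%N ->
  \int[normalized_maj_law R lam]_x cos (a * x + b) = cos b.
Proof.
move=> k0; have [D [Re [Mi [pR pM sR sM]]]] := hook_split lam.
have sRM : size Re = size Mi by rewrite sR sM.
have Re0 : Re = [::] by apply: size0nil; rewrite sR.
have Mi0 : Mi = [::] by apply: size0nil; rewrite sM.
have [|p [-> _]] := @maj_law_cos_even R lam D Re Mi a b pR pM sRM; first by rewrite Re0.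
by rewrite Re0 Mi0 !big_nil mulr1 => ->; rewrite mul1r.
Qed.

Lemma maj_law_cos_irwin_hall (M : nat) (a b e : R) : 0 < e ->
  exists n0, forall lam, aft lam = M -> (n0 <= sumn lam)%N ->
  `|\int[normalized_maj_law R lam]_x cos (a * x + b) -
    \int[normalized_irwin_hall_law R M]_x cos (a * x + b)| <= e.
Proof.
move=> e0; under eq_exists do under eq_forall do rewrite irwin_hall_law_cos.
case: M => [|M'].
  exists 0%N => lam k0 _.
  by rewrite maj_law_cos_aft0// expr0 mul1r subrr normr0 ltW.
set M := M'.+1; have Mp : 0 < M%:R :> R by rewrite ltr0n.
set z := a / Num.sqrt (M%:R / 12).
have z2 : z ^+ 2 = 12 * a ^+ 2 / M%:R.
  rewrite /z exprMn exprVn sqr_sqrtr ?divr_ge0 ?ltW//; field.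
  by rewrite gt_eqF.
have e1 : 0 < e / (2 * M%:R) by rewrite divr_gt0// mulr_gt0.
have [d d0 hd] := sinc_cts_sq z e1.
pose eta := Num.min 1 (Num.min d (e / (2 * M%:R))).
have eta0 : 0 < eta by rewrite /eta !lt_min ltr01 d0 e1.
(* 384 = 16 * 24: with Q >= M n^2 / 16 this gives 24 a^2 M^2 n <= eta Q, and 24 a^2 M^2 n / Q bounds
   both (h t)^2 for h in [Re] and |(j t)^2 - z^2| for j in [Mi]. *)
have [n1 hn1] := natr_ge_eventually (384 * a ^+ 2 * M%:R / eta).
exists (maxn n1 (maxn 4 M.*2)) => lam kM; rewrite !geq_max => /and3P[/hn1 nn n4 nM].
have [D [Re [Mi [pR pM sR sM]]]] := hook_split lam.
have sRM : size Re = size Mi by rewrite sR sM.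
have sdE := maj_sd_sq R pR pM sRM; have := sq_excess_ge_quad R pR pM n4.
have := @sq_excess_ge_lin R lam D Re Mi pR pM; cbv zeta; rewrite kM => /(_ nM).
have := @split_bounds lam D Re Mi pR pM sR sM; cbv zeta; rewrite kM => /(_ nM)[bRe Qhi bMi].
rewrite kM in sR sM.
set Q := sq_excess R Re Mi in sdE Qhi * => Qlin Qn.
set t := a / maj_sd R lam.
have np : 0 < (sumn lam)%:R :> R by rewrite ltr0n; exact: leq_trans n4.
move: (sumn lam)%:R np nn Qlin Qn Qhi bRe bMi => n np nn Qlin Qn Qhi bRe bMi.
have Qp : 0 < Q by apply: lt_le_trans Qn; rewrite divr_gt0// mulr_gt0// exprn_gt0.
have t2 : t ^+ 2 = 12 * a ^+ 2 / Q.
  rewrite /t exprMn exprVn sdE sqr_sqrtr ?divr_ge0 ?ltW//; field.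
  by rewrite gt_eqF.
have M1 : 1 <= M%:R :> R by rewrite ler1n.
have a0 := sqr_ge0 a.
have wn : 384 * a ^+ 2 * M%:R <= eta * n by rewrite [leRHS]mulrC -ler_pdivrMr.
have wQ : 24 * a ^+ 2 * M%:R ^+ 2 * n <= eta * Q.
  apply: (@le_trans _ _ (eta * (M%:R * n ^+ 2 / 16))); last by rewrite ler_wpM2l// ltW.
  have := ler_wpM2r (ltW (mulr_gt0 Mp np)) wn; lra.
have hR2 : {in Re, forall h, (h%:R * t) ^+ 2 <= eta}.
  move=> h /bRe hb; rewrite exprMn t2 mulrA ler_pdivrMr//; apply: le_trans wQ.
  have := ler_wpM2r a0 hb; lra.
have jM2 : {in Mi, forall j, `|(j%:R * t) ^+ 2 - z ^+ 2| <= eta}.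
  move=> j /bMi/andP[jlo jhi].
  have -> : (j%:R * t) ^+ 2 - z ^+ 2 = 12 * a ^+ 2 * (M%:R * j%:R ^+ 2 - Q) / (Q * M%:R).
    by rewrite exprMn t2 z2; field; rewrite !gt_eqF.
  rewrite normrM normfV (gtr0_norm (mulr_gt0 Qp Mp)) ler_pdivrMr ?mulr_gt0// [leRHS]mulrA.
  apply: (@le_trans _ _ (24 * a ^+ 2 * M%:R ^+ 2 * n * M%:R)); last by rewrite ler_wpM2r// ltW.
  have a12 : 0 <= 12 * a ^+ 2 by lra.
  rewrite normrM (ger0_norm a12).
  have : `|M%:R * j%:R ^+ 2 - Q| <= 2 * M%:R ^+ 3 * n.
    have jlo' := ler_wpM2l (ltW Mp) jlo; have jhi' := ler_wpM2l (ltW Mp) jhi.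
    have M23 : M%:R ^+ 2 * n <= M%:R ^+ 3 * n.
      rewrite ler_wpM2r// ?(ltW np)// exprS ler_peMl// sqr_ge0.
    by rewrite ler_norml; apply/andP; split; lra.
  by move=> /(ler_wpM2l a0); lra.
have e1d : eta <= e / (2 * M%:R) by rewrite /eta !ge_min lexx !orbT.
have eta1 : eta <= 1 by rewrite /eta ge_min lexx.
have etad : eta <= d by rewrite /eta !ge_min lexx !orbT.
have hR1 : {in Re, forall h, `|h%:R * t| <= 1}.
  move=> h /hR2 hb; rewrite -[leRHS]/(1%R) -(@ler_pXn2r _ 2)// ?nnegrE//.
  by rewrite expr1n real_normK ?num_real// (le_trans hb).
have [p [-> p1 pE]] := maj_law_cos_even b pR pM sRM hR1.
rewrite -/t in pE.
have PR : `|\prod_(h <- Re) sinc (h%:R * t) - 1| <= e / 2.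
  have -> : e / 2 = (size Re)%:R * (e / (2 * M%:R)) by rewrite sR; field; rewrite gt_eqF.
  rewrite -[X in _ - X](expr1n _ (size Re)); apply: prod_near_exp; first by rewrite normr1.
  move=> h hR; split; first exact: sinc_le_norm.
  have /andP[lo _] := sinc_approx (h%:R * t); have := sinc_le1 (h%:R * t).
  have := hR2 _ hR; have := sqr_ge0 (h%:R * t).
  by rewrite ler_norml => *; apply/andP; split; lra.
have PM : `|\prod_(j <- Mi) sinc (j%:R * t) - sinc z ^+ M| <= e / 2.
  have -> : e / 2 = (size Mi)%:R * (e / (2 * M%:R)) by rewrite sM; field; rewrite gt_eqF.
  rewrite -[in X in _ - X]sM; apply: prod_near_exp; first exact: sinc_le_norm.
  move=> j jM; split; first exact: sinc_le_norm.
  by apply: hd; exact: le_trans (jM2 _ jM) _.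
rewrite -mulrBl normrM.
apply: (@le_trans _ _ `|p - sinc z ^+ M|).
  by rewrite -[leRHS]mulr1 ler_wpM2l// ler_norml cos_geN1 cos_le1.
move: PR PM; rewrite -pE; set PR := \prod_(h <- Re) _ => hPR hPM.
(* As |p| <= 1, the product over [Re] is removed without a division. *)
have -> : p - sinc z ^+ M = - (p * (PR - 1)) + (p * PR - sinc z ^+ M) by ring.
apply: (le_trans (ler_normD _ _)); rewrite normrN normrM.
have : `|p| * `|PR - 1| <= 1 * (e / 2) by apply: ler_pM.
by lra.
Qed.

End maj_law_cos_irwin_hall.

(** * Sufficiency of the three cases *)

Section maj_law_limits.
Variable R : realType.
Implicit Types (lam : nat -> intpart).

Lemma maj_law_cvg lam (mu : probability R R) :
  cos_cvg (fun N => normalized_maj_law R (lam N)) mu ->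
  cvg_in_distribution (fun N => normalized_maj_law R (lam N)) mu.
Proof.
(* Chosen so that its square is at least 1/e, as the Chebyshev bound requires. *)
move=> h; apply: levy_cos h _ => e e0; exists (1 + e^-1) => N.
have ie0 : 0 < e^-1 by rewrite invr_gt0.
have B0 : 0 < 1 + e^-1 by lra.
change (fine (normalized_maj_law R (lam N) (tail_set (1 + e^-1))) <= e).
apply: le_trans (maj_law_tail (lam N) B0) _.
rewrite -[leRHS]invrK lef_pV2 ?posrE ?exprn_gt0//.
by rewrite expr2; nra.
Qed.

Lemma cvg_normal lam : (forall K, \forall N \near \oo, K <= aft (lam N))%N ->
  cvg_in_distribution (fun N => normalized_maj_law R (lam N)) (normal_law 0 1).
Proof.
move=> haft; apply: maj_law_cvg => a b; rewrite normal_law_cos.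
apply/cvgrPdist_le => e e0.
have /cvgrPdist_le/(_ _ e0)/nbhs_ballP[d /= d0 hd] := @continuous_expR R (- (a ^+ 2 / 2)).
have [K1 hK1] := natr_ge_eventually (192 * a ^+ 2).
have [K2 hK2] := natr_ge_eventually (2 * (192 * a ^+ 2) ^+ 2 / (d / 2)).
near=> N.
have k4 : (4 <= aft (lam N))%N by near: N; exact: haft.
have /hK1 k1 : (K1 <= aft (lam N))%N by near: N; exact: haft.
have /hK2 k2 : (K2 <= aft (lam N))%N by near: N; exact: haft.
have n4 : (4 <= sumn (lam N))%N by apply: leq_trans k4 _; exact: leq_subr.
have kp : 0 < (aft (lam N))%:R :> R by rewrite ltr0n (leq_trans _ k4).
have [p -> /andP[plo phi]] := maj_law_cos_normal b n4 (leq_trans (isT : 0 < 4)%N k4) k1.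
set w := 2 * _ / _ in plo phi.
have w0 : 0 <= w by rewrite divr_ge0// mulr_ge0// sqr_ge0.
have wd : w <= d / 2.
  rewrite /w ler_pdivrMr// [leRHS]mulrC -ler_pdivrMr ?divr_gt0//; exact: k2.
rewrite -mulrBl normrM; apply: (@le_trans _ _ `|expR (- (a ^+ 2 / 2)) - p|).
  by rewrite -[leRHS]mulr1 ler_wpM2l// ler_norml cos_geN1 cos_le1.
have h1 : `|expR (- (a ^+ 2 / 2)) - expR (- (a ^+ 2 / 2) - w)| <= e.
  apply: hd; rewrite /ball /= opprB addrC subrK ger0_norm//.
  by apply: le_lt_trans wd _; rewrite ltr_pdivrMr// ltr_pMr// ltr1n.
have h2 : `|expR (- (a ^+ 2 / 2)) - expR (- (a ^+ 2 / 2) + w)| <= e.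
  apply: hd; rewrite /ball /= opprD addrA subrr sub0r normrN ger0_norm//.
  by apply: le_lt_trans wd _; rewrite ltr_pdivrMr// ltr_pMr// ltr1n.
by move: h1 h2; rewrite !ler_norml => /andP[? ?] /andP[? ?]; apply/andP; split; lra.
Unshelve. all: by end_near. Qed.

Lemma cvg_irwin_hall lam (M : nat) :
  (forall K, \forall N \near \oo, K <= sumn (lam N))%N ->
  (\forall N \near \oo, aft (lam N) = M) ->
  cvg_in_distribution (fun N => normalized_maj_law R (lam N)) (normalized_irwin_hall_law R M).
Proof.
move=> hn hM; apply: maj_law_cvg => a b; apply/cvgrPdist_le => e e0.
have [n0 hn0] := maj_law_cos_irwin_hall M a b e0.
near=> N; rewrite distrC; apply: hn0; near: N; first exact: hM.
exact: hn.
Unshelve. all: by end_near. Qed.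

(** The cosine integrals agree, so the constant sequence converges to both laws, and limits are
    unique. *)
Lemma same_law_aft0 (lam0 : intpart) : aft lam0 = 0%N ->
  same_law (normalized_maj_law R lam0) (normalized_irwin_hall_law R 0).
Proof.
move=> k0; apply: (@cvg_in_distribution_same_law _ (fun=> normalized_maj_law R lam0)).
  by move=> x _; exact: cvg_cst.
apply: (@maj_law_cvg (fun=> lam0)) => a b.
by rewrite maj_law_cos_aft0// irwin_hall_law_cos expr0 mul1r; exact: cvg_cst.
Qed.

Lemma same_law_cvg (mu_ : nat -> probability R R) (mu : probability R R) :
  (\forall N \near \oo, same_law (mu_ N) mu) -> cvg_in_distribution mu_ mu.
Proof.
move=> h x _; apply: cvg_near_cst; apply: filterS h => N hN.
by apply: hN; exact: measurable_le_set.
Qed.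

Lemma discrete_maj_law (lam0 : intpart) : discrete_law (normalized_maj_law R lam0).
Proof.
pose X := normalized (majRV lam0 : {RV (unif_SYT lam0 : probability _ R) >-> R}).
exists (range X).
  apply: finite_set_countable; apply: finite_image; exact: finite_finset.
rewrite /normalized_maj_law /normalized_law /distribution /= /pushforward.
rewrite (_ : _ @^-1` _ = setT); first exact: probability_setT.
by apply/seteqP; split => // T _; exists T.
Qed.

End maj_law_limits.

(** * Subsequences and necessity *)

Definition frequently (P : nat -> Prop) := forall N0, exists2 N, (N0 <= N)%N & P N.

Lemma not_eventually (P : nat -> Prop) :
  ~ (\forall N \near \oo, P N) -> frequently (fun N => ~ P N).
Proof.
move=> h N0; apply: contrapT => h2; apply: h; exists N0 => // N /= hN.
by apply: contrapT => nP; apply: h2; exists N.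
Qed.

Lemma frequently_choice (P : nat -> nat -> Prop) : (forall K, frequently (P K)) ->
  exists phi : nat -> nat, forall N, (N <= phi N)%N /\ P N (phi N).
Proof.
move=> h; have h' N : exists m, (N <= m)%N /\ P N m by have [m ? ?] := h N N; exists m.
by have [phi] := choice h'; exists phi.
Qed.

Lemma frequently_pigeonhole (T : finType) (f : nat -> T) (P : nat -> Prop) :
  frequently P -> exists t, frequently (fun N => P N /\ f N = t).
Proof.
move=> fP; apply: contrapT => h.
have {}h t : exists N0, forall N, (N0 <= N)%N -> ~ (P N /\ f N = t).
  apply: contrapT => h2; apply: h; exists t => N0; apply: contrapT => h3.
  by apply: h2; exists N0 => N hN PN; apply: h3; exists N.
have [g hg] := choice h; have [N hN PN] := fP (\max_(t : T) g t).
by apply: (hg (f N) N) => //; apply: leq_trans hN; exact: leq_bigmax.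
Qed.

Lemma intpart_inj : injective parts.
Proof. by move=> [s hs] [s' hs'] /= e; subst s'; congr Intpart; exact: bool_irrelevance. Qed.

Lemma nth_intpart_gt0 (lam : intpart) i : (i < size lam)%N -> (0 < nth 0 lam i)%N.
Proof.
have /andP[_ n0] := intpartP lam => hi; rewrite lt0n; apply: contraNneq n0 => <-.
exact: mem_nth.
Qed.

Lemma nth_leq_sumn (s : seq nat) i : (nth 0 s i <= sumn s)%N.
Proof. by elim: s i => [|a s IH] [|i] //=; [exact: leq_addr|apply: leq_trans (IH i) (leq_addl _ _)]. Qed.

Lemma size_leq_sumn (lam : intpart) : (size lam <= sumn lam)%N.
Proof.
have /andP[_] := intpartP lam; elim: (parts lam) => //= a s IH.
rewrite inE negb_or => /andP[a0 /IH h]; rewrite -add1n leq_add//.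
by rewrite lt0n eq_sym.
Qed.

(** Pigeonhole: a partition of size below K is recorded by its first K parts, padded with zeros. As
    parts are positive, the record also determines their number. *)
Lemma frequently_small_intpart (lam : nat -> intpart) (K : nat) (P : nat -> Prop) :
  frequently (fun N => P N /\ (sumn (lam N) < K)%N) ->
  exists lam0, frequently (fun N => P N /\ lam N = lam0).
Proof.
case: K => [/(_ 0%N)[N _ []] //|K] h.
pose f N : {ffun 'I_K.+1 -> 'I_K.+1} := [ffun i : 'I_K.+1 => inord (nth 0 (lam N) i)].
have [t ht] := frequently_pigeonhole f h.
have fE N M : (sumn (lam N) < K.+1)%N -> (sumn (lam M) < K.+1)%N -> f N = f M ->
    (size (lam N) <= size (lam M))%N /\
    forall i, (i < K.+1)%N -> nth 0%N (lam N) i = nth 0%N (lam M) i.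
  move=> hN hM e.
  have ne i : (i < K.+1)%N -> nth 0%N (lam N) i = nth 0%N (lam M) i.
    move=> iK; have := congr1 (fun g : {ffun 'I_K.+1 -> 'I_K.+1} => val (g (Ordinal iK))) e.
    by rewrite !ffunE /= !inordK// ltnS; apply: leq_trans (nth_leq_sumn _ _) _.
  split => //; rewrite leqNgt; apply/negP => lt.
  have := nth_intpart_gt0 lt; rewrite ne ?nth_default//.
  by apply: leq_trans hM; rewrite ltnS size_leq_sumn.
have [N1 _ [[_ s1] e1]] := ht 0%N.
exists (lam N1) => N0; have [N hN [[PN sN] eN]] := ht N0; exists N => //; split => //.
apply: intpart_inj; have eq : f N = f N1 by rewrite eN.
have [l1 n1] := fE _ _ sN s1 eq; have [l2 n2] := fE _ _ s1 sN (esym eq).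
apply: (@eq_from_nth _ 0%N) => [|i hi]; first by apply/eqP; rewrite eqn_leq l1.
by apply: n1; apply: leq_trans hi (leq_trans (size_leq_sumn _) (ltnW sN)).
Qed.

Section subsequences.
Variable lam : nat -> intpart.

Definition subseq_index (phi : nat -> nat) := forall N, (N <= phi N)%N.

Lemma intpart_trichotomy : exists2 phi, subseq_index phi &
  [\/ forall K, \forall N \near \oo, (K <= aft (lam (phi N)))%N,
      exists2 M, forall N, aft (lam (phi N)) = M & forall N, (N <= sumn (lam (phi N)))%N
    | exists lam0, forall N, lam (phi N) = lam0].
Proof.
have [h|] := pselect (forall K, \forall N \near \oo, (K <= aft (lam N))%N).
  by exists id => [N|]; [exact: leqnn|apply: Or31].
move=> /existsNP[K /not_eventually fK].
have fK' : frequently (fun N => aft (lam N) < K.+1)%N.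
  by move=> N0; have [N hN /negP lt] := fK N0; exists N => //; rewrite ltnS ltnW// ltnNge.
have [t ht] := frequently_pigeonhole (fun N => inord (aft (lam N)) : 'I_K.+1) fK'.
pose M := nat_of_ord t.
have {}ht : frequently (fun N => aft (lam N) = M).
  by move=> N0; have [N hN [lt e]] := ht N0; exists N => //; rewrite /M -e inordK.
have [hs|] := pselect (forall K', frequently (fun N => aft (lam N) = M /\ (K' <= sumn (lam N))%N)).
  have [phi hphi] := frequently_choice hs; exists phi => [N|]; first by have [] := hphi N.
  by apply: Or32; exists M => N; have [_ []] := hphi N.
move=> /existsNP[K' hK'].
have fs : frequently (fun N => aft (lam N) = M /\ (sumn (lam N) < K')%N).
  move=> N0; apply: contrapT => h; apply: hK' => N1.
  have [N hN e] := ht (maxn N0 N1); move: hN; rewrite geq_max => /andP[hN0 hN1].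
  exists N => //; split => //; rewrite leqNgt; apply/negP => lt; apply: h.
  by exists N.
have [lam0 h0] := frequently_small_intpart fs.
have [phi hphi] := frequently_choice (fun _ : nat => h0).
exists phi => [N|]; first by have [] := hphi N.
by apply: Or33; exists lam0 => N; have [_ []] := hphi N.
Qed.

End subsequences.

(** * Distinguishing the limits; necessity *)

Section limits.
Variable R : realType.
Implicit Types (mu nu : probability R R).

Lemma cvg_in_distribution_subseq (mu_ : nat -> probability R R) mu (phi : nat -> nat) :
  subseq_index phi -> cvg_in_distribution mu_ mu ->
  cvg_in_distribution (fun N => mu_ (phi N)) mu.
Proof.
move=> hphi h x cx.
have phioo : phi N @[N --> \oo] --> \oo.
  by apply/cvgnyPge => A; exists A => // N /= AN; exact: leq_trans AN (hphi N).
exact: (cvg_comp _ _ phioo (h x cx)).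
Qed.

Lemma limit_trichotomy (lam : nat -> intpart) mu :
  cvg_in_distribution (fun N => normalized_maj_law R (lam N)) mu ->
  exists2 phi, subseq_index phi &
  [\/ (forall K, \forall N \near \oo, (K <= aft (lam (phi N)))%N) /\ same_law mu (normal_law 0 1),
      exists M, [/\ forall N, aft (lam (phi N)) = M, forall N, (N <= sumn (lam (phi N)))%N
        & same_law mu (normalized_irwin_hall_law R M)]
    | exists lam0, (forall N, lam (phi N) = lam0) /\ same_law mu (normalized_maj_law R lam0)].
Proof.
move=> h; have [phi hphi H] := intpart_trichotomy lam; exists phi => //.
have hs := cvg_in_distribution_subseq hphi h.
case: H => [haft|[M hM hn]|[lam0 h0]].
- apply: Or31; split=> //; apply: cvg_in_distribution_same_law hs _.
  exact: (@cvg_normal R (fun N => lam (phi N))).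
- apply: Or32; exists M; split=> //; apply: cvg_in_distribution_same_law hs _.
  apply: (@cvg_irwin_hall R (fun N => lam (phi N))) => [K|]; last exact: nearW.
  by exists K => // N /= KN; exact: leq_trans KN (hn N).
- apply: Or33; exists lam0; split=> //; apply: cvg_in_distribution_same_law hs _.
  by apply: same_law_cvg; apply: nearW => N A _; rewrite h0.
Qed.

(** True of every normalized law of maj and of IH_0; false for the normal law and for IH_M with M >
    0, whose transforms are below 1 in absolute value off 0. *)
Definition lattice_like mu := exists2 t : R, 0 < t & \int[mu]_x cos (t * x + 0) = 1.

Lemma normal_not_lattice mu : same_law mu (normal_law 0 1) -> ~ lattice_like mu.
Proof.
move=> h [t t0]; rewrite (same_law_integral _ h) normal_law_cos cos0 mulr1 => e.
have : expR (- (t ^+ 2 / 2)) < 1 by rewrite expR_lt1 oppr_lt0 divr_gt0// exprn_gt0.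
by rewrite e ltxx.
Qed.

Lemma irwin_hall_scale_gt0 M : 0 < Num.sqrt (M.+1%:R / 12) :> R.
Proof. by rewrite sqrtr_gt0 divr_gt0. Qed.

Lemma irwin_hall_not_lattice mu M :
  same_law mu (normalized_irwin_hall_law R M.+1) -> ~ lattice_like mu.
Proof.
move=> h [t t0]; rewrite (same_law_integral _ h) irwin_hall_law_cos cos0 mulr1 => e.
have s1 : `|sinc (t / Num.sqrt (M.+1%:R / 12))| < 1.
  by apply: sinc_lt1; rewrite gt_eqF// divr_gt0// irwin_hall_scale_gt0.
have : `|sinc (t / Num.sqrt (M.+1%:R / 12))| ^+ M.+1 < 1 by rewrite exprn_ilt1.
by rewrite -normrX e normr1 ltxx.
Qed.

Lemma irwin_hall_root mu M (t := 2 * pi * Num.sqrt (M.+1%:R / 12) : R) :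
  same_law mu (normalized_irwin_hall_law R M.+1) -> \int[mu]_x cos (t * x + 0) = 0.
Proof.
move=> h; rewrite (same_law_integral _ h) irwin_hall_law_cos cos0 mulr1 /t mulfK ?gt_eqF ?irwin_hall_scale_gt0//.
by rewrite sinc_2pi expr0n.
Qed.

Lemma normal_not_irwin_hall mu M : same_law mu (normal_law 0 1) ->
  ~ same_law mu (normalized_irwin_hall_law R M.+1).
Proof.
move=> h /irwin_hall_root; rewrite (same_law_integral _ h) normal_law_cos cos0 mulr1.
by apply/eqP; rewrite gt_eqF// expR_gt0.
Qed.

Lemma irwin_hall_inj mu M M' : same_law mu (normalized_irwin_hall_law R M.+1) ->
  same_law mu (normalized_irwin_hall_law R M'.+1) -> M = M'.
Proof.
wlog MM' : M M' / (M < M')%N.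
  by move=> W h h'; case: (ltngtP M M') => // lt; [exact: W|apply/esym; exact: W].
move=> /irwin_hall_root + h'; rewrite (same_law_integral _ h') irwin_hall_law_cos cos0 mulr1.
move=> /eqP; rewrite expf_eq0/= gt_eqF//; apply: sinc_gt0.
have p0 : 0 < 2 * pi :> R by rewrite mulr_gt0// pi_gt0.
rewrite divr_gt0 ?mulr_gt0 ?irwin_hall_scale_gt0 ?pi_gt0//=.
rewrite ltr_pdivrMr ?irwin_hall_scale_gt0// ltr_pM2l//.
by rewrite ltr_sqrt ?divr_gt0// ltr_pM2r// ltr_nat.
Qed.

Lemma lattice_like_maj mu lam0 : same_law mu (normalized_maj_law R lam0) -> lattice_like mu.
Proof.
move=> h; have [t t0 e] := maj_law_lattice R lam0.
by exists t => //; rewrite (same_law_integral _ h).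
Qed.

Lemma lattice_like_irwin_hall0 mu : same_law mu (normalized_irwin_hall_law R 0) ->
  lattice_like mu.
Proof.
move=> h; exists 1 => //; rewrite (same_law_integral _ h) irwin_hall_law_cos.
by rewrite cos0 mulr1 expr0.
Qed.

Lemma maj_limit_necessary (lam : nat -> intpart) mu
    (law := fun N => normalized_maj_law R (lam N)) : cvg_in_distribution law mu ->
  [\/ forall K, \forall N \near \oo, (K <= aft (lam N))%N,
      exists M, (forall K, \forall N \near \oo, (K <= sumn (lam N))%N) /\
        (\forall N \near \oo, aft (lam N) = M)
    | \forall N \near \oo, same_law (law N) mu].
Proof.
move=> h; apply: contrapT => no.
have h1 := fun p => no (@Or31 _ _ _ p); have h2 := fun p => no (@Or32 _ _ _ p).
have {no}h3 := fun p => no (@Or33 _ _ _ p).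
(* A subsequence avoiding the desired property still converges to mu, so mu has a
   second description, which contradicts the first. *)
have lim psi : subseq_index psi ->
  cvg_in_distribution (fun N => normalized_maj_law R (lam (psi N))) mu.
  by move=> hpsi; exact: cvg_in_distribution_subseq hpsi h.
(* Take a subsequence whose laws all differ from mu. A lattice limit leaves only IH_0 with aft = 0,
   or a constant shape, and in both cases some law of the subsequence equals mu. *)
have notlat : ~ lattice_like mu.
  move=> L; have [psi hpsi] := frequently_choice (fun _ : nat => not_eventually h3).
  have [|phi _ H] := limit_trichotomy (lim psi _); first by move=> N; have [] := hpsi N.
  case: H => [[_ /normal_not_lattice //]|[[|M]]|[lam0 [e s]]].
  - move=> [a0 _ s]; have [_] := hpsi (phi 0%N); apply => A mA.
    by rewrite /law (same_law_aft0 (a0 0%N)) ?s.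
  - by move=> [_ _ /irwin_hall_not_lattice].
  - by have [_] := hpsi (phi 0%N); apply => A mA; rewrite /law e s.
have notnormal : ~ same_law mu (normal_law 0 1).
  move=> L; have /existsNP[K /not_eventually fK] := h1.
  have [psi hpsi] := frequently_choice (fun _ : nat => fK).
  have [|phi _ H] := limit_trichotomy (lim psi _); first by move=> N; have [] := hpsi N.
  case: H => [[/(_ K)[N _ /(_ N (leqnn N)) /= hN] _]|[[|M]]|[lam0 [e s]]].
  - by have [_] := hpsi (phi N).
  - by move=> [_ _ /lattice_like_irwin_hall0].
  - by move=> [_ _ /(normal_not_irwin_hall L)].
  - by apply: notlat; exact: lattice_like_maj s.
have [phi _ [[_ //]|[[|M]]|[lam0 [e s]]]] := limit_trichotomy h.
- by move=> [_ _ /lattice_like_irwin_hall0].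
- move=> [_ _ L]; apply: h2; exists M.+1.
  (* A subsequence violating this has a further one along which the size grows and aft is constant;
     its limit is mu again, so [irwin_hall_inj] forces the constant to be M + 1, a contradiction. *)
  have ev K : \forall N \near \oo, (K <= sumn (lam N))%N /\ aft (lam N) = M.+1.
    apply: contrapT => /not_eventually fK.
    have [psi hpsi] := frequently_choice (fun _ : nat => fK).
    have [|phi' _ H] := limit_trichotomy (lim psi _); first by move=> N; have [] := hpsi N.
    case: H => [[_ //]|[[|M']]|[lam0 [e s]]].
    - by move=> [_ _ /lattice_like_irwin_hall0].
    - move=> [aE sE /(irwin_hall_inj L) MM']; have [_] := hpsi (phi' K); apply.
      by rewrite aE MM'.
    - by apply: notlat; exact: lattice_like_maj s.
  split=> [K|]; first by apply: filterS (ev K) => N [].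
  by apply: filterS (ev 0%N) => N [].
- by apply: notlat; exact: lattice_like_maj s.
Qed.

End limits.

Theorem theorem1p7 (R : realType) (lam : nat -> intpart) :
  let law N : probability R R := normalized_maj_law R (lam N) in
  let case_i := aft (lam N) @[N --> \oo] --> \oo in
  let case_ii (M : nat) :=
    (sumn (lam N) @[N --> \oo] --> \oo) /\ (aft (lam N) @[N --> \oo] --> M) in
  let case_iii := exists N0, forall N, (N0 <= N)%N -> same_law (law N) (law N0) in
  [/\ (exists mu, cvg_in_distribution law mu) <->
        [\/ case_i, exists M : nat, case_ii M | case_iii],
      case_i -> cvg_in_distribution law (normal_law 0 1),
      forall M : nat, case_ii M ->
        cvg_in_distribution law (normalized_irwin_hall_law R M)
    & case_iii -> exists2 mu, cvg_in_distribution law mu & discrete_law mu].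
Proof.
move=> law case_i case_ii case_iii.
have i_cvg : case_i -> cvg_in_distribution law (normal_law 0 1).
  by move=> /cvgnyPge; exact: cvg_normal.
have ii_cvg M : case_ii M -> cvg_in_distribution law (normalized_irwin_hall_law R M).
  move=> [/cvgnyPge hn /discrete_cvg hM]; exact: cvg_irwin_hall.
have iii_cvg : case_iii -> exists2 mu, cvg_in_distribution law mu & discrete_law mu.
  move=> [N0 h]; exists (law N0); last exact: discrete_maj_law.
  by apply: same_law_cvg; exists N0.
split=> //; split=> [[mu /maj_limit_necessary[h|[M [hn hM]]|[N0 _ h]]]|].
- by apply: Or31; apply/cvgnyPge.
- by apply: Or32; exists M; split; [exact/cvgnyPge|exact/discrete_cvg].
- apply: Or33; exists N0 => N N0N A mA.
  by rewrite (h N N0N A mA) -(h N0 (leqnn N0) A mA).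
- case=> [/i_cvg h|[M /ii_cvg h]|/iii_cvg[mu h _]]; eexists; exact: h.
Qed.
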